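(* Let $\Gamma=PSL(2;8)$. The joint spectral measure (over $\mathbb{T}^2$) for all embeddings of $\Gamma$ into the fundamental representations of $G_2$ is $$\mathrm{d}\varepsilon = \frac{1}{448\pi^4} J^2 \, \mathrm{d}_7 \times \mathrm{d}_7 + \frac{1}{6} \, \mathrm{d}_3 \times \mathrm{d}_3 + \frac{1}{6} \, \mathrm{d}_2 \times \mathrm{d}_2 - \frac{5}{126} \, \mathrm{d}_1 \times \mathrm{d}_1 - \frac{1}{18} \, \mathrm{d}^{(1)} + \frac{1}{864\pi^4} a_3^{-1} J^2 \, \mathrm{d}^{((9))} + \frac{1}{864\pi^4} a_1^{-1} J^2 \, \mathrm{d}^{((9/2))} + \frac{1}{864\pi^4} a_2^{-1} J^2 \, \mathrm{d}^{((9/4))},$$ where $a_1 = 3 + 2\cos(\pi/9) + 2\cos(2\pi/9)$, $a_2 = 3 - 2\cos(2\pi/9) + 2\sin(\pi/18)$ and $a_3 = 3 - 2\cos(\pi/9) - 2\sin(\pi/18)$.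
   Context: $G_2$ is the compact simply connected simple Lie group of dimension 14, with fundamental representations $\rho_1$, $\rho_2$ of dimensions 7 and 14. Its maximal torus is identified with $\mathbb{T}^2$ so that, for $(\omega_1,\omega_2)=(e^{2\pi i\theta_1},e^{2\pi i\theta_2})\in\mathbb{T}^2$, $$\chi_{\rho_1} = 1 + \omega_1 + \omega_1^{-1} + \omega_2 + \omega_2^{-1} + \omega_1\omega_2^{-1} + \omega_1^{-1}\omega_2,$$ $$\chi_{\rho_2} = \chi_{\rho_1} + 1 + \omega_1\omega_2 + \omega_1^{-1}\omega_2^{-1} + \omega_1^2\omega_2^{-1} + \omega_1^{-2}\omega_2 + \omega_1\omega_2^{-2} + \omega_1^{-1}\omega_2^2 .$$ The Weyl group $D_{12}$ of $G_2$ (dihedral of order 12) is the subgroup of $GL(2,\mathbb{Z})$ generated by $T_2=\begin{pmatrix}0&-1\\-1&0\end{pmatrix}$ and $T_6=\begin{pmatrix}0&1\\-1&1\end{pmatrix}$, acting on $\mathbb{T}^2$ by $T(\omega_1,\omega_2)=(\omega_1^{a_{11}}\omega_2^{a_{12}},\omega_1^{a_{21}}\omega_2^{a_{22}})$ for $T=(a_{il})$. It contains the subgroup $S_3$ generated by $T_2$ and $T_6^2$. An embedding of a finite group $\Gamma$ in $G_2$ is an injective homomorphism $\iota:\Gamma\to G_2$; put $\varrho_j=\rho_j\circ\iota$, $j=1,2$. Let $\Delta_j$ be the adjacency matrix of the McKay graph of $\varrho_j$ (the matrix of tensoring with $\varrho_j$ on the irreducible representations of $\Gamma$), and $e_{\ast}$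 the basis vector of the trivial representation. The joint spectral measure over $\mathbb{T}^2$ of the embedding is the unique $D_{12}$-invariant probability measure $\varepsilon$ on $\mathbb{T}^2$ such that for all integers $m,n\geq 0$ $$\int_{\mathbb{T}^2}\chi_{\rho_1}^m\chi_{\rho_2}^n\,\mathrm{d}\varepsilon=\langle\Delta_1^m\Delta_2^n e_\ast,e_\ast\rangle=\sum_C\frac{|C|}{|\Gamma|}\chi_{\varrho_1}(C)^m\chi_{\varrho_2}(C)^n,$$ the sum being over the conjugacy classes $C$ of $\Gamma$. Notation for measures on $\mathbb{T}^2$: $\mathrm{d}_k$ is the uniform probability measure on the $k$-th roots of unity; $\mathrm{d}^{(n)}$ is the uniform probability measure on $\{(e^{2\pi i q_1/3n},e^{2\pi i q_2/3n}) : q_1,q_2\in\{0,1,\ldots,3n-1\},\ q_1+q_2\equiv 0 \bmod 3\}$; for rational $n\geq 2$, with $\omega=e^{2\pi i/3}$ and $\tau=e^{2\pi i/n}$, $\mathrm{d}^{((n))}$ is the uniform probability measure on the $S_3$-orbit of the points $(\tau,\tau)$, $(\overline{\omega}\,\overline{\tau},\omega)$, $(\omega,\overline{\omega}\,\overline{\tau})$ (a set of 18 points when $n>2$). A function multiplying a measure is a density, and functions on $\mathbb{T}^2$ are written in the coordinates $\theta_1,\theta_2$. The function $J$ is $$J = 8\pi^2\big(\cos 2\pi(2\theta_1+\theta_2)+\cos 2\pi(\theta_1-3\theta_2)+\cos 2\pi(3\theta_1-2\theta_2)-\cos 2\pi(\theta_1+2\theta_2)-\cos 2\pi(3\theta_1-\theta_2)-\cos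 2\pi(2\theta_1-3\theta_2)\big).$$ $PSL(2;8)$ is the projective special linear group of degree 2 over the field with 8 elements, of order 504. *)

(* Defs.v *)
From HB Require Import structures.
From mathcomp Require Import all_boot all_order all_algebra all_fingroup.
From mathcomp Require Import all_solvable all_field all_character.
From mathcomp Require Import finmap complex ring.
From mathcomp Require Import all_classical all_reals all_analysis.

Set Implicit Arguments.
Unset Strict Implicit.
Unset Printing Implicit Defensive.

Import Order.TTheory GRing.Theory Num.Theory.
Import numFieldNormedType.Exports.

Local Open Scope classical_set_scope.
Local Open Scope complex_scope.
Local Open Scope ring_scope.

Section Circle.
Variable R : realType.

Record circle := Circle { cval : R[i]; circleP : `|cval| == 1 }.

HB.instance Definition _ := [isSub for cval].
HB.instance Definition _ := [Choice of circle by <:].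

Definition circle1 : circle := @Circle 1 (introT eqP (normr1 _)).

HB.instance Definition _ := isPointed.Build circle circle1.

Definition circle_coords (w : circle) : R * R := (complex.Re (cval w), complex.Im (cval w)).

(* The sigma-algebra induced by the Borel sets of the plane. *)
HB.instance Definition _ :=
  Measurable.copy circle (g_sigma_algebra_preimageType circle_coords).

Fact e2pi_subproof (x : R) :
  `|cos (2 * pi * x) +i* sin (2 * pi * x)| == 1 :> R[i].
Proof. by rewrite normc_def /= cos2Dsin2 sqrtr1. Qed.

(* e^(2 pi i x) *)
Definition e2pi (x : R) : circle := Circle (e2pi_subproof x).

(* The coordinate theta of w = e^(2 pi i theta), taken in [0, 1). *)
Definition angle (w : circle) : R := xget 0 [set t | 0 <= t < 1 /\ e2pi t = w].

Fact monomial_subproof (a b : int) (w : circle * circle) :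
  `|cval w.1 ^ a * cval w.2 ^ b| == 1.
Proof.
have norm1 (c : circle) (k : int) : `|cval c ^ k| = 1.
  have /eqP c1 := circleP c.
  case: k => k; first by rewrite -exprnP normrX c1 expr1n.
  by rewrite NegzE -exprnN normfV normrX c1 expr1n invr1.
by rewrite normrM !norm1 mulr1.
Qed.

Definition monomial (a b : int) (w : circle * circle) : circle :=
  Circle (monomial_subproof a b w).

End Circle.

Notation torus R := (circle R * circle R)%type.

Section UniformMeasure.
Context d (T : measurableType d) (R : realType).

(* Meaningful for a finite nonempty set [A]: [fset_set A] is empty when [A]
   is infinite. *)
Definition uniform (A : set T) : set T -> \bar R :=
  mscale ((#|` fset_set A|)%:R^-1)%:nng
    (msum (fun k => dirac (nth point (fset_set A) k)) #|` fset_set A|).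

HB.instance Definition _ (A : set T) := Measure.on (uniform A).

Fact uniform_fin_num (A : set T) : fin_num_fun (uniform A).
Proof.
move=> B mB; rewrite /uniform /= /mscale/= fin_numM //= /msum.
by apply/sum_fin_numP => i _ _; rewrite fin_num_measure.
Qed.

HB.instance Definition _ (A : set T) :=
  Measure_isFinite.Build _ _ _ (uniform A) (uniform_fin_num A).

End UniformMeasure.

Section Torus.
Variable R : realType.

Definition T2 : 'M[int]_2 :=
  \matrix_(i, j) (if i == j then 0 else -1).

Definition T6 : 'M[int]_2 :=
  \matrix_(i, j) (if i == 0 then (if j == 0 then 0 else 1)
                  else (if j == 0 then -1 else 1)).

Inductive generated (S : set 'M[int]_2) : set 'M[int]_2 :=
| generated_mem g : S g -> generated S g
| generated_one : generated S 1
| generated_mul g h : generated S g -> generated S h -> generated S (g * h)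
| generated_inv g : generated S g -> generated S g^-1.

Definition D12 : set 'M[int]_2 := generated [set T2; T6].
Definition S3 : set 'M[int]_2 := generated [set T2; T6 ^+ 2].

Definition torus_act (T : 'M[int]_2) (w : torus R) : torus R :=
  (monomial (T 0 0) (T 0 1) w, monomial (T 1 0) (T 1 1) w).

Definition chi1 (w : torus R) : R[i] :=
  let w1 := cval w.1 in let w2 := cval w.2 in
  1 + w1 + w1^-1 + w2 + w2^-1 + w1 * w2^-1 + w1^-1 * w2.

Definition chi2 (w : torus R) : R[i] :=
  let w1 := cval w.1 in let w2 := cval w.2 in
  chi1 w + 1 + w1 * w2 + w1^-1 * w2^-1 + w1 ^+ 2 * w2^-1 + w1 ^- 2 * w2
    + w1 * w2 ^- 2 + w1^-1 * w2 ^+ 2.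

Definition J_angle (t1 t2 : R) : R :=
  8 * pi ^+ 2 *
    (cos (2 * pi * (2 * t1 + t2)) + cos (2 * pi * (t1 - 3 * t2))
     + cos (2 * pi * (3 * t1 - 2 * t2)) - cos (2 * pi * (t1 + 2 * t2))
     - cos (2 * pi * (3 * t1 - t2)) - cos (2 * pi * (2 * t1 - 3 * t2))).

Definition J (w : torus R) : R := J_angle (angle w.1) (angle w.2).

(* $d_k$ *)
Definition unif_roots (k : nat) : {finite_measure set (circle R) -> \bar R} :=
  uniform R [set w : circle R | cval w ^+ k = 1].

(* $d_k \times d_k$ *)
Definition unif_roots_sq (k : nat) : {measure set (torus R) -> \bar R} :=
  (unif_roots k \x unif_roots k)%E.

(* $d^{(n)}$ *)
Definition unif_p (n : nat) : {measure set (torus R) -> \bar R} :=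
  uniform R [set (e2pi (q.1%:R / (3 * n)%:R), e2pi (q.2%:R / (3 * n)%:R)) |
    q in [set q : nat * nat |
      [/\ (q.1 < 3 * n)%N, (q.2 < 3 * n)%N & (3 %| q.1 + q.2)%N]]].

(* The points $(\tau,\tau)$, $(\bar\omega\bar\tau,\omega)$ and
   $(\omega,\bar\omega\bar\tau)$, with $\omega = e^{2\pi i/3}$ and
   $\tau = e^{2\pi i/n}$. *)
Definition unif_pp_base (n : rat) : set (torus R) :=
  let tau := (ratr n)^-1 : R in let om := 3^-1 : R in
  [set (e2pi tau, e2pi tau); (e2pi (- om - tau), e2pi om);
       (e2pi om, e2pi (- om - tau))].

(* $d^{((n))}$ *)
Definition unif_pp (n : rat) : {measure set (torus R) -> \bar R} :=
  uniform R [set torus_act T w | T in S3 & w in unif_pp_base n].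

Definition integralC (mu : {measure set (torus R) -> \bar R})
    (f : torus R -> R[i]) : R[i] :=
  (\int[mu]_(w in setT) complex.Re (f w)) +i* (\int[mu]_(w in setT) complex.Im (f w)).

End Torus.

Section G2.
Variable R : realType.

(* The cross product on the imaginary octonions R^7, whose basis (e_i),
   indexed by Z/7, multiplies by e_i e_(i+1) = e_(i+3) and the cyclic
   permutations of these identities. *)
Definition cross (x y : 'cV[R]_7) : 'cV[R]_7 :=
  \col_(k < 7)
    (x (k + 4) 0 * y (k + 5) 0 - x (k + 5) 0 * y (k + 4) 0
     + (x (k + 1) 0 * y (k + 3) 0 - x (k + 3) 0 * y (k + 1) 0)
     + (x (k + 2) 0 * y (k + 6) 0 - x (k + 6) 0 * y (k + 2) 0)).

Fact cross_is_linearl y : linear (cross^~ y).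
Proof. by move=> a u v; apply/colP => k; rewrite !mxE; ring. Qed.
Fact cross_is_linearr x : linear (cross x).
Proof. by move=> a u v; apply/colP => k; rewrite !mxE; ring. Qed.

Definition cross_automorphism (g : 'M[R]_7) : Prop :=
  g \in unitmx /\
  forall x y, g *m cross x y = cross (g *m x) (g *m y).

(* Compact G_2, as the automorphism group of the octonions: an automorphism is
   determined by its restriction to the imaginary octonions, and the
   restrictions are the automorphisms of the cross product. *)
Record G2 := MkG2 { G2val : 'M[R]_7; G2P : `[< cross_automorphism G2val >] }.

HB.instance Definition _ := [isSub for G2val].
HB.instance Definition _ := [Choice of G2 by <:].

Fact G2_one_subproof : `[< cross_automorphism 1%:M >].
Proof. by apply/asboolP; split=> [|x y]; rewrite ?unitmx1 // !mul1mx. Qed.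
Fact G2_mul_subproof (g h : G2) :
  `[< cross_automorphism (G2val g *m G2val h) >].
Proof.
have [/asboolP[ug Hg] /asboolP[uh Hh]] := (G2P g, G2P h).
by apply/asboolP; split=> [|x y]; rewrite ?unitmx_mul ?ug // -!mulmxA Hh Hg.
Qed.
Fact G2_inv_subproof (g : G2) : `[< cross_automorphism (invmx (G2val g)) >].
Proof.
have /asboolP[ug Hg] := G2P g; apply/asboolP; split=> [|x y].
  by rewrite unitmx_inv.
by apply: (canLR (mulKmx ug)); rewrite Hg !mulKVmx.
Qed.

Let one := MkG2 G2_one_subproof.
Let mul g h := MkG2 (G2_mul_subproof g h).
Let inv g := MkG2 (G2_inv_subproof g).
Fact G2_mulA : associative mul.
Proof. by move=> g h k; apply/val_inj; rewrite /= mulmxA. Qed.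
Fact G2_mul1 : left_id one mul.
Proof. by move=> g; apply/val_inj; rewrite /= mul1mx. Qed.
Fact G2_mulr1 : right_id one mul.
Proof. by move=> g; apply/val_inj; rewrite /= mulmx1. Qed.
Fact G2_mulV : left_inverse one inv mul.
Proof.
by move=> g; apply/val_inj; have /asboolP[ug _] := G2P g; rewrite /= mulVmx.
Qed.
Fact G2_mulrV : right_inverse one inv mul.
Proof.
by move=> g; apply/val_inj; have /asboolP[ug _] := G2P g; rewrite /= mulmxV.
Qed.
HB.instance Definition _ :=
  isGroup.Build G2 G2_mulA G2_mul1 G2_mulr1 G2_mulV G2_mulrV.

Definition leibniz_defect (x y : 'cV[R]_7) (D : 'M[R]_7) : 'cV[R]_7 :=
  D *m cross x y - cross (D *m x) y - cross x (D *m y).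

Fact leibniz_distr a (p q r p' q' r' : 'cV[R]_7) :
  a *: p + p' - (a *: q + q') - (a *: r + r')
    = a *: (p - q - r) + (p' - q' - r').
Proof. by apply/colP => k; rewrite !mxE; ring. Qed.
Fact leibniz_defect_is_linear x y : linear (leibniz_defect x y).
Proof.
move=> a D E; rewrite /leibniz_defect !mulmxDl -!scalemxAl.
by rewrite cross_is_linearl cross_is_linearr leibniz_distr.
Qed.

HB.instance Definition _ x y := GRing.isLinear.Build _ _ _ _
  (leibniz_defect x y) (leibniz_defect_is_linear x y).

(* The Lie algebra of G_2: the derivations of the cross product (see g2P). *)
Definition g2 : {vspace 'M[R]_7} :=
  (\bigcap_(i < 7) \bigcap_(j < 7)
     lker (linfun (leibniz_defect (delta_mx i 0) (delta_mx j 0))%R))%VS.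

Fact leibniz_defect_linearl D y : linear (fun x => leibniz_defect x y D).
Proof.
move=> a u v; rewrite /leibniz_defect cross_is_linearl !mulmxDr -!scalemxAr.
by rewrite !cross_is_linearl leibniz_distr.
Qed.
Fact leibniz_defect_linearr D x : linear (fun y => leibniz_defect x y D).
Proof.
move=> a u v; rewrite /leibniz_defect cross_is_linearr !mulmxDr -!scalemxAr.
by rewrite !cross_is_linearr leibniz_distr.
Qed.

Lemma g2P (D : 'M[R]_7) :
  reflect (forall x y, D *m cross x y = cross (D *m x) y + cross x (D *m y))
    (D \in g2).
Proof.
have defectE x y : (leibniz_defect x y D == 0) =
    (D *m cross x y == cross (D *m x) y + cross x (D *m y)).
  by rewrite /leibniz_defect -addrA -opprD subr_eq0.
have D0 x y : (D \in lker (linfun (leibniz_defect x y))) =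
    (leibniz_defect x y D == 0) by rewrite memv_ker lfunE.
apply: (iffP idP) => [Dg2 x y | Dder]; last first.
  apply/subv_bigcapP => i _; apply/subv_bigcapP => j _.
  by rewrite -memvE D0 defectE Dder.
have De i j : leibniz_defect (delta_mx i 0) (delta_mx j 0) D = 0.
  apply/eqP; rewrite -D0; move: Dg2; rewrite memvE => /subv_bigcapP/(_ i isT).
  by move=> /subv_bigcapP/(_ j isT); rewrite -memvE.
have linS (f : 'cV[R]_7 -> 'cV[R]_7) : linear f ->
    (forall i, f (delta_mx i 0) = 0) -> forall z, f z = 0.
  move=> f_lin fe z.
  pose fL := GRing.isLinear.Build _ _ _ _ f f_lin.
  pose fl : {linear 'cV[R]_7 -> 'cV[R]_7} := HB.pack f fL.
  rewrite (matrix_sum_delta z) -[f]/(fl : _ -> _) linear_sum big1 // => i _.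
  by rewrite big_ord1 linearZ /= fe scaler0.
apply/eqP; rewrite -defectE; apply/eqP.
apply: (linS _ (leibniz_defect_linearl D y)) => i.
by apply: (linS _ (leibniz_defect_linearr D (delta_mx i 0))).
Qed.

Lemma Ad_g2 (g : G2) D : D \in g2 -> G2val g *m D *m invmx (G2val g) \in g2.
Proof.
have /asboolP[ug Hg] := G2P g.
have /asboolP[_ Hi] := G2_inv_subproof g.
move=> /g2P DD; apply/g2P => x y.
by rewrite -!mulmxA Hi DD mulmxDr !Hg !mulKVmx.
Qed.

Definition rho1 (g : G2) : 'M[R[i]]_7 := map_mx (real_complex R) (G2val g).

(* The 14-dimensional fundamental representation is the adjoint one; this is the
   matrix of Ad g in a basis of the Lie algebra, complexified. *)
Definition rho2 (g : G2) : 'M[R[i]]_(\dim g2) :=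
  map_mx (real_complex R)
    (\matrix_(i, j) coord (vbasis g2) i
       (G2val g *m (vbasis g2)`_j *m invmx (G2val g))).

Fact rho1_1 : rho1 1%g = 1%:M.
Proof. by rewrite /rho1 /= map_mx1. Qed.
Fact rho1_M g h : rho1 (g * h)%g = rho1 g *m rho1 h.
Proof. by rewrite /rho1 /= map_mxM. Qed.
Fact rho2_1 : rho2 1%g = 1%:M.
Proof.
rewrite /rho2 -(map_mx1 (real_complex R)); congr map_mx; apply/matrixP => i j; rewrite !mxE /=.
by rewrite invmx1 mul1mx mulmx1 coord_free ?(basis_free (vbasisP _)) // eq_sym.
Qed.
Fact rho2_M g h : rho2 (g * h)%g = rho2 g *m rho2 h.
Proof.
rewrite /rho2 -map_mxM; congr map_mx; apply/matrixP => i j; rewrite !mxE /=.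
have /asboolP[ug _] := G2P g; have /asboolP[uh _] := G2P h.
have -> : invmx (G2val g *m G2val h) = invmx (G2val h) *m invmx (G2val g).
  have ugh : G2val g *m G2val h \in unitmx by rewrite unitmx_mul ug.
  by rewrite -[RHS](mulKmx ugh) !mulmxA mulmxK // -mulmxA mulmxV // mulmx1.
set b := vbasis g2.
rewrite !mulmxA -(mulmxA (G2val g)) -(mulmxA (G2val g)).
rewrite {1}(coord_vbasis (Ad_g2 h _)); last first.
  by rewrite vbasis_mem // mem_nth // size_tuple.
rewrite mulmx_sumr mulmx_suml linear_sum; apply: eq_bigr => k _.
by rewrite !mxE -scalemxAr -scalemxAl linearZ /= mulrC.
Qed.

End G2.

Section McKay.
Variables (R : realType) (gT : finGroupType) (G : {group gT}).

Definition irrG : irrType R[i] G := DecSocleType (regular_repr R[i] G).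

(* The multiplicity of the irreducible representation [i] in [rG]: the sum of
   the multiplicities of the isotypic components of [rG] similar to [i] (at most
   one component is). *)
Definition irr_mult n (rG : mx_representation R[i] G n) (i : irrG) : nat :=
  \sum_(W : DecSocleType rG | irr_comp irrG (socle_repr W) == i) socle_mult W.

(* The adjacency matrix of the McKay graph: the entry (i, j) is the
   multiplicity of the j-th irreducible representation in the tensor product of
   the i-th one with [rG]. *)
Definition mckay n (rG : mx_representation R[i] G n) : 'M[R[i]]_#|irrG| :=
  \matrix_(i, j)
    (irr_mult (prod_repr (irr_repr (enum_val i : irrG)) rG) (enum_val j))%:R.

Definition triv : 'I_#|irrG| := enum_rank (principal_comp irrG).

Record embedding := Embedding {
  emb :> gT -> G2 R;
  embM : {in G &, {morph emb : x y / (x * y)%g}};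
  emb_inj : {in G &, injective emb}
}.

Variable iota : embedding.

Fact emb1 : iota 1%g = 1%g.
Proof.
by apply: (mulIg (iota 1%g)); rewrite -embM ?group1 // !mul1g.
Qed.

Fact varrho1_subproof : mx_repr G (fun x => rho1 (iota x)).
Proof.
by split=> [|x y Gx Gy]; rewrite ?emb1 ?rho1_1 // embM // rho1_M.
Qed.
Definition varrho1 := MxRepresentation varrho1_subproof.

Fact varrho2_subproof : mx_repr G (fun x => rho2 (iota x)).
Proof.
by split=> [|x y Gx Gy]; rewrite ?emb1 ?rho2_1 // embM // rho2_M.
Qed.
Definition varrho2 := MxRepresentation varrho2_subproof.

Definition D12_invariant (mu : set (torus R) -> \bar R) : Prop :=
  forall T, D12 T -> forall A, measurable A ->
    mu (torus_act T @^-1` A) = mu A.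

Definition has_joint_moments (mu : probability (torus R) R) : Prop :=
  forall m n : nat,
    integralC mu (fun w => chi1 w ^+ m * chi2 w ^+ n)
      = (mckay varrho1 ^+ m *m mckay varrho2 ^+ n) triv triv
    /\
    (mckay varrho1 ^+ m *m mckay varrho2 ^+ n) triv triv
      = \sum_(C in classes G) (#|C|%:R / #|G|%:R)
          * \tr (varrho1 (repr C)) ^+ m * \tr (varrho2 (repr C)) ^+ n.

Definition is_joint_spectral_measure (mu : probability (torus R) R) : Prop :=
  [/\ D12_invariant mu, has_joint_moments mu
    & forall nu : probability (torus R) R,
        D12_invariant nu -> has_joint_moments nu ->
        forall A, measurable A -> nu A = mu A].

End McKay.

Section PSL2.
Variable F : finFieldType.

Fact SL2_group_set : group_set [set g : {'GL_2[F]} | \det (GLval g) == 1].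
Proof.
apply/group_setP; split=> [|g h]; rewrite !inE ?GL_1E ?det1 //.
by move=> /eqP dg /eqP dh; rewrite GL_ME detM dg dh mulr1.
Qed.
Definition SL2 : {group {'GL_2[F]}} := Group SL2_group_set.

Definition PSL2 : {group coset_of 'Z(SL2)} := (SL2 / 'Z(SL2))%G.

End PSL2.

(* Main.v *)
Require Import Defs.
From HB Require Import structures.
From mathcomp Require Import all_boot all_order all_algebra all_fingroup all_solvable all_field all_character.
From mathcomp Require Import finmap complex ring lra.
From mathcomp Require Import all_classical all_reals all_analysis measurable_realfun.

(** The measure is the law of a random point of the torus: a uniformly chosen group element is
sent to its conjugacy class in G2, that is to an orbit of the Weyl group of order 12, and a
point of this orbit is chosen uniformly. Four facts make this the measure of the formula.

All embeddings have the same characters, up to a cyclic permutation of the three classes of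
order 9 ([character_values]). This uses no character table, only two identities on G2. The
adjoint representation is the exterior square of R^7 minus R^7 ([tr_rho2]), so the degree 14
character is determined by the degree 7 one. The spin representation of Spin(7) becomes
1 + R^7 on G2, which relates the traces of g, g^2 and g^3 ([G2_trace_identity]) and leaves few
possible traces to elements of small order. In SL(2,8) = PSL(2,8) a nonidentity element is
determined up to conjugacy by its trace. The value at an involution must be -1, because a
subgroup of order 8 has a nonnegative number of invariants. It follows that this subgroup has
no invariants in R^7 nor in the Lie algebra, that the elements of order 7 have trace 0, and that
both characters have sum 0 over the group. What is left is a polynomial system for the values at
the classes of orders 3 and 9 ([trace_system]), whose solution is 1 and the three roots of
x^3 - 3 x - 1, that is minus twice the cosines of 40, 80 and 160 degrees.

The entries at the trivial representation of products of McKay matrices are averages of products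
of traces, because the irreducible characters form common eigenvectors ([mckay_moments]). These
moments are those of the random point ([eps_moment]).

The moments determine an invariant measure. The two fundamental characters separate the orbits
of the Weyl group ([chi_fiber]), since the three numbers x + 1/x, y + 1/y, x/y + y/x are the roots
of a cubic polynomial with coefficients in the characters. A nonnegative polynomial in the
characters that vanishes on the seven orbits has expectation 0, which confines every measure with
the same moments to these orbits; interpolation in the first character, which takes seven
distinct values there, then gives the mass of each set ([moments_determine]).

The formula is an equality of finite measures on points of order dividing 126. On the 7-torsion,
and on each of the three sets of 18 points of order 9, the Jacobian takes a single nonzero value up
to sign ([J7], [J9]); for the latter these values are 8 pi^2 times numbers whose squares are a1,
a2, a3 up to a rational factor. Every
term thus gives an integral multiple of 1/6048 to each point, and the multiples add up to those of
the random point ([weights_agree]). *)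

Set Implicit Arguments.
Unset Strict Implicit.
Unset Printing Implicit Defensive.

Import Order.TTheory GRing.Theory Num.Theory.

Local Open Scope classical_set_scope.
Local Open Scope complex_scope.
Local Open Scope ring_scope.

(** * Integer tables and the octonion cross product *)

Definition sumz (n : nat) (f : nat -> int) : int :=
  foldr (fun i s => f i + s) 0 (iota 0 n).
Definition alln (n : nat) (P : nat -> bool) : bool := all P (iota 0 n).

Lemma sumzE n (f : nat -> int) : \sum_(i < n) f i = sumz n f.
Proof.
by rewrite -(big_mkord xpredT f) unlock /sumz /index_iota subn0.
Qed.

Lemma allnP n (P : nat -> bool) : alln n P -> forall i : 'I_n, P i.
Proof. by move=> /allP H i; apply: H; rewrite mem_iota ltn_ord. Qed.

Definition entry (A : seq (seq int)) i j : int := nth 0 (nth [::] A i) j.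
(** Integer matrices are lists of rows, so that identities between structure constants are
decided by evaluation. *)
Definition table n (f : nat -> nat -> int) : seq (seq int) :=
  mkseq (fun i => mkseq (f i) n) n.
Definition mul_table n A B :=
  table n (fun i j => sumz n (fun k => entry A i k * entry B k j)).
Definition mxt (R : pzRingType) n A : 'M[R]_n := \matrix_(i, j) (entry A i j)%:~R.

Lemma entry_table n f (i j : 'I_n) : entry (table n f) i j = f i j.
Proof. by rewrite /entry /table !nth_mkseq. Qed.

Lemma mxt_mul (R : pzRingType) n A B :
  mxt R n (mul_table n A B) = mxt R n A *m mxt R n B.
Proof.
apply/matrixP => i j; rewrite !mxE entry_table -sumzE rmorph_sum /=.
by apply: eq_bigr => k _; rewrite !mxE rmorphM.
Qed.

(** The structure constants of the cross product: the coefficient of e_k in e_i x e_j. *)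
Definition fano (k i j : nat) : int :=
  let at_ a b := (i == modn (addn k a) 7) && (j == modn (addn k b) 7) in
  if [|| at_ 4 5, at_ 1 3 | at_ 2 6]%N then 1
  else if [|| at_ 5 4, at_ 3 1 | at_ 6 2]%N then -1 else 0.

Section Octonions.
Variable R : realType.
Implicit Types (x y : 'cV[R]_7) (g D X : 'M[R]_7).

Definition cross_mx x : 'M[R]_7 :=
  \matrix_(k < 7, j < 7) \sum_(i < 7) (fano k i j)%:~R * x i 0.

Lemma cross_mxE x y : cross x y = cross_mx x *m y.
Proof.
pose X i := x (inord i) 0; pose Y i := y (inord i) 0.
have xX (m : 'I_7) : x m 0 = X m by rewrite /X inord_val.
have yY (m : 'I_7) : y m 0 = Y m by rewrite /Y inord_val.
apply/colP => k; rewrite !mxE.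
under eq_bigr => j _.
  rewrite mxE yY; under eq_bigr do rewrite xX.
  over.
rewrite !xX !yY.
do !rewrite ?big_ord_recl ?big_ord0 /=.
case: k => [[|[|[|[|[|[|[|//]]]]]]] lk] /=; rewrite /bump /= ?mulr0z ?mulr1z ?mulrN1z; ring.
Qed.
End Octonions.

(** * Clifford matrices and the orthogonality of automorphisms *)

(** Left multiplication by e_a on the octonions, whose basis is 1 followed by the e_i. *)
Definition gam a : seq (seq int) := table 8 (fun i j =>
  match i, j with
  | O, O => 0
  | O, S j => if j == a then -1 else 0
  | S i, O => if i == a then 1 else 0
  | S i, S j => fano i a j
  end).

Definition neq2 (a b : nat) : int := if a == b then 0 else 1.
Definition neq3 (a b c : nat) : int := if uniq [:: a; b; c] then 1 else 0.
Definition idx := iota 0 7.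
(** Products of at most three distinct generators form an orthogonal basis of the 8 x 8
matrices. Each product comes with the integer that compensates for its orderings: an
unordered pair is listed twice and an unordered triple six times, so that every basis
element has total weight 6. Words with a repeated generator have weight 0. *)
Definition clifford : seq (int * seq (seq int)) :=
  (6, table 8 (fun i j => if i == j then 1 else 0))
  :: [seq (6, gam a) | a <- idx]
  ++ [seq (3 * neq2 a b, mul_table 8 (gam a) (gam b)) | a <- idx, b <- idx]
  ++ [seq (neq3 a b.1 b.2, mul_table 8 (gam a) (mul_table 8 (gam b.1) (gam b.2)))
      | a <- idx, b <- [seq (b, c) | b <- idx, c <- idx]].

(** Evaluated on all quadruples of indices; the entries that vanish at (i, j) are discarded
before the inner loops to keep the evaluation short. *)
Definition clifford_check L :=
  alln 8 (fun i => alln 8 (fun j => 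
   let M := [seq p : int * int * seq (seq int) <- [seq (p.1, entry p.2 i j, p.2) | p <- L]
      | if intRing.mulz p.1.1 p.1.2 is Posz O then false else true] in
  alln 8 (fun k => alln 8 (fun l =>
   let s := foldr (fun p s => intZmod.addz (intRing.mulz (intRing.mulz p.1.1 p.1.2) (entry p.2 k l)) s) 0 M in
   match s with 
   | Posz 0 => ~~ (eqn i k && eqn j l)
   | Posz n => [&& eqn n 48, eqn i k & eqn j l]
   | _ => false
   end )))).
Lemma clifford_checked : clifford_check clifford.
Proof. vm_cast_no_check (erefl true). Qed.

(** The Parseval identity of the Clifford basis: its elements have square norm 8 and weight
6, whence 48. *)
Lemma clifford_complete (R : comPzRingType) (i j k l : 'I_8) :
  \sum_(p <- clifford) p.1%:~R * (mxt R 8 p.2 i j * mxt R 8 p.2 k l)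
    = (48 * ((i == k) && (j == l)))%:R.
Proof.
have := allnP (allnP (allnP (allnP clifford_checked i) j) k) l.
set s := foldr _ _ _ => chk.
have {chk} sE : s = (48 * ((i == k) && (j == l)))%N.
  have [eik ejl] : eqn i k = (i == k) /\ eqn j l = (j == l) by [].
  move: chk; rewrite eik ejl; case: s => [[|n]|//].
    by move/negbTE->.
  by case/and3P=> /eqP-> -> ->.
rewrite -[RHS]/((48 * ((i == k) && (j == l)))%N%:~R) -sE /s.
transitivity ((\sum_(p <- clifford) p.1 * entry p.2 i j * entry p.2 k l)%:~R : R).
  rewrite rmorph_sum /=; apply: eq_bigr => p _.
  by rewrite !mxE !rmorphM /= mulrA.
congr intmul.
have foldE (r : seq (int * int * seq (seq int))) : foldr (fun p s => intZmod.addz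
    (intRing.mulz (intRing.mulz p.1.1 p.1.2) (entry p.2 k l)) s) 0 r
   = \sum_(p <- r) p.1.1 * p.1.2 * entry p.2 k l by rewrite unlock.
rewrite foldE big_filter big_map [RHS]big_mkcond; apply: eq_bigr => p _ /=.
by case: ifP => //; case E: (intRing.mulz _ _) => [[]|] // _;
  rewrite -[p.1 * _]/(intRing.mulz _ _) E mul0r.
Qed.

Lemma big_clifford (V : nmodType) (F : int * seq (seq int) -> V) :
  \sum_(p <- clifford) F p
   = F (6, table 8 (fun i j => if i == j then 1 else 0))
     + \sum_(a < 7) F (6, gam a)
     + \sum_(a < 7) \sum_(b < 7) F (3 * neq2 a b, mul_table 8 (gam a) (gam b))
     + \sum_(a < 7) \sum_(b < 7) \sum_(c < 7)
         F (neq3 a b c, mul_table 8 (gam a) (mul_table 8 (gam b) (gam c))).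
Proof.
have ord7 (G : nat -> V) : \sum_(a <- idx) G a = \sum_(a < 7) G a.
  by rewrite -(big_mkord xpredT G).
rewrite /clifford; move: idx ord7 => I ord7.
rewrite big_cons !big_cat !addrA big_map !big_allpairs_dep !ord7.
congr (_ + _ + _).
  by apply: eq_bigr => a _; rewrite ord7.
apply: eq_bigr => a _; rewrite big_allpairs ord7.
by apply: eq_bigr => b _; rewrite ord7.
Qed.

Section Spin.
Variable R : realType.
Implicit Types (x y : 'cV[R]_7) (g : 'M[R]_7).
Local Notation Gam a := (mxt R 8 (gam a)).

Lemma Gam_anticomm (a b : 'I_7) :
  Gam a *m Gam b + Gam b *m Gam a = - (2 * (a == b)%:R)%:M.
Proof.
pose check := alln 7 (fun a => alln 7 (fun b => let A := mul_table 8 (gam a) (gam b) in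
  let B := mul_table 8 (gam b) (gam a) in alln 8 (fun i => alln 8 (fun j =>
   entry A i j + entry B i j ==
     if eqn a b && eqn i j then - 2 else 0)))).
have chk : check by vm_cast_no_check (erefl true).
apply/matrixP => i j.
have /= /eqP := allnP (allnP (allnP (allnP chk a) b) i) j.
rewrite -!mxt_mul !mxE -rmorphD /= => ->.
rewrite -[eqn a b]/(a == b) -[eqn i j]/(i == j).
by case: eqP; case: eqP => _ _; rewrite /= ?mulr1n ?mulr0n ?mulr1 ?mulr0 ?oppr0 ?mulrNz.
Qed.

Lemma Gam_tr (a : 'I_7) : (Gam a)^T = - Gam a.
Proof.
pose check := alln 7 (fun a => alln 8 (fun i => alln 8 (fun j =>
   entry (gam a) j i == - entry (gam a) i j))).
have chk : check by vm_cast_no_check (erefl true).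
apply/matrixP => i j; rewrite !mxE.
by rewrite (eqP (allnP (allnP (allnP chk a) i) j)) rmorphN.
Qed.

Local Notation d a b := ((a == b :> 'I_7)%:R : R).

Definition word (s : seq 'I_7) : 'M[R]_8 := \prod_(a <- s) Gam a.

(** With the cyclicity of the trace, this reduces a word of even length to shorter words and
yields the expansion of its trace over perfect matchings. *)
Lemma tr_word_swap s a b t :
  \tr (word (s ++ a :: b :: t))
  = - (2 * d a b) * \tr (word (s ++ t)) - \tr (word (s ++ b :: a :: t)).
Proof.
apply/eqP; rewrite eq_sym subr_eq eq_sym; apply/eqP.
rewrite /word !big_cat !big_cons /= -linearD -mulrDr !mulrA -mulrDl.
rewrite -!mulmxE Gam_anticomm -scalemx1 -scaleN1r scalerA mulN1r.
by rewrite -scalemxAl mul1mx -scalemxAr linearZ.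
Qed.

Lemma tr_word_rot a s : \tr (word (a :: s)) = \tr (word (s ++ [:: a])).
Proof. by rewrite /word big_cat big_cons big_seq1 -!mulmxE mxtrace_mulC. Qed.

Lemma tr_word0 : \tr (word [::]) = 8.
Proof. by rewrite /word big_nil mxtrace1. Qed.

Lemma tr_word2 a b : \tr (word [:: a; b]) = - 8 * d a b.
Proof.
have := tr_word_rot a [:: b]; rewrite (tr_word_swap [::] a b [::]) /= tr_word0.
move: (\tr _) (d _ _) => u v; lra.
Qed.

Lemma tr_word4 a b c e : \tr (word [:: a; b; c; e])
  = 8 * (d a b * d c e - d a c * d b e + d a e * d b c).
Proof.
have := tr_word_rot a [:: b; c; e].
rewrite (tr_word_swap [:: b; c] e a [::]) (tr_word_swap [:: b] c a [:: e]).
rewrite (tr_word_swap [::] b a [:: c; e]) /=.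
rewrite !tr_word2 !(eq_sym _ a).
set t := \tr _ => h.
apply: (mulIf (_ : 2 != 0 :> R)); rewrite ?pnatr_eq0 // [t * 2]mulr_natr [t *+ 2]mulr2n {1}h; ring.
Qed.

Lemma tr_word6 a b c e f k : \tr (word [:: a; b; c; e; f; k])
  = - 8 * (d a b * (d c e * d f k - d c f * d e k + d c k * d e f)
         - d a c * (d b e * d f k - d b f * d e k + d b k * d e f)
         + d a e * (d b c * d f k - d b f * d c k + d b k * d c f)
         - d a f * (d b c * d e k - d b e * d c k + d b k * d c e)
         + d a k * (d b c * d e f - d b e * d c f + d b f * d c e)).
Proof.
have := tr_word_rot a [:: b; c; e; f; k].
rewrite (tr_word_swap [:: b; c; e; f] k a [::]) (tr_word_swap [:: b; c; e] f a [:: k]).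
rewrite (tr_word_swap [:: b; c] e a [:: f; k]) (tr_word_swap [:: b] c a [:: e; f; k]).
rewrite (tr_word_swap [::] b a [:: c; e; f; k]) /=.
rewrite !tr_word4 !(eq_sym _ a).
set t := \tr _ => h.
apply: (mulIf (_ : 2 != 0 :> R)); rewrite ?pnatr_eq0 // [t * 2]mulr_natr [t *+ 2]mulr2n {1}h; ring.
Qed.

Section Automorphism.
Variable g : 'M[R]_7.
Hypothesis Gg : cross_automorphism g.

Lemma mulmx_ext m n (A B : 'M[R]_(m, n)) : (forall x : 'cV_n, A *m x = B *m x) -> A = B.
Proof.
move=> AB; apply/matrixP => i j; have /matrixP/(_ i 0) := AB (delta_mx j 0).
by rewrite -!colE !mxE.
Qed.

Lemma cross_mx_conj x : g *m cross_mx x = cross_mx (g *m x) *m g.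
Proof.
by apply: mulmx_ext => y; rewrite -!mulmxA -!cross_mxE; case: Gg => _ ->.
Qed.

Lemma cross_mx_delta (a : 'I_7) :
  cross_mx (delta_mx a 0) = mxt R 7 (table 7 (fun k j => fano k a j)).
Proof.
apply/matrixP => k j; rewrite !mxE entry_table (bigD1 a) //= big1 ?addr0 => [|i /negbTE ia].
  by rewrite mxE !eqxx mulr1.
by rewrite mxE ia mulr0.
Qed.

Lemma cross_mx_sum x : cross_mx x = \sum_(a < 7) x a 0 *: cross_mx (delta_mx a 0).
Proof.
apply/matrixP => k j; rewrite summxE mxE; apply: eq_bigr => a _.
by rewrite cross_mx_delta !mxE entry_table mulrC.
Qed.

Lemma tr_cross_mx2 x y : \tr (cross_mx x *m cross_mx y) = - 6 * (x^T *m y) 0 0.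
Proof.
pose check := alln 7 (fun a => alln 7 (fun b =>
  sumz 7 (fun i => sumz 7 (fun j => fano i a j * fano j b i))
  == if a == b then - 6 else 0)).
have chk : check by vm_cast_no_check (erefl true).
rewrite (cross_mx_sum x) (cross_mx_sum y) mulmx_suml linear_sum mxE mulr_sumr.
apply: eq_bigr => a _; rewrite mulmx_sumr linear_sum (bigD1 a) //=.
have dotE (b : 'I_7) : \tr (cross_mx (delta_mx a 0) *m cross_mx (delta_mx b 0)) =
    (if a == b then - 6 else 0)%:~R :> R.
  rewrite -(eqP (allnP (allnP chk a) b)) -sumzE rmorph_sum /=; apply: eq_bigr => i _.
  rewrite mxE -sumzE rmorph_sum /=; apply: eq_bigr => j _.
  by rewrite !cross_mx_delta !mxE !entry_table rmorphM.
rewrite -scalemxAr -scalemxAl !linearZ /= dotE eqxx big1 ?addr0 ?mxE => [|b /negbTE ba].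
  by rewrite mulrNz; ring.
by rewrite -scalemxAr -scalemxAl !linearZ /= dotE eq_sym ba !mulr0.
Qed.

(** The cross product determines the inner product through tr (L_x L_y) = -6 <x, y>, so its
automorphisms preserve it. *)
Lemma g_orthogonal : g^T *m g = 1%:M.
Proof.
have [ug _] := Gg.
apply: mulmx_ext => y; apply: trmx_inj; apply: mulmx_ext => x.
have conj z : cross_mx (g *m z) = g *m cross_mx z *m invmx g.
  by rewrite cross_mx_conj mulmxK.
have := tr_cross_mx2 (g *m y) (g *m x).
rewrite !conj -!mulmxA mulKmx // mxtrace_mulC -!mulmxA mulVmx // mulmx1 tr_cross_mx2.
rewrite trmx_mul => /(mulfI _) h.
rewrite mul1mx !trmx_mul trmxK; apply/matrixP => i j; rewrite !ord1.
by rewrite h ?oppr_eq0 ?pnatr_eq0 // !mulmxA.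
Qed.
End Automorphism.

End Spin.

(** * The trace identity of the seven-dimensional representation *)

Section SpinTrace.
Variable R : realType.
Implicit Types (x y : 'cV[R]_7) (g : 'M[R]_7).
Local Notation Gam a := (mxt R 8 (gam a)).

Definition octonion_mx g : 'M[R]_8 := block_mx (1%:M : 'M[R]_1) 0 0 g.
Definition gamma_mx x : 'M[R]_8 := block_mx (0 : 'M[R]_1) (- (x^T)) x (cross_mx x).

Lemma gamma_mx_sum x : gamma_mx x = \sum_(a < 7) x a 0 *: Gam a.
Proof.
rewrite /gamma_mx; apply/matrixP => i j; rewrite summxE.
under eq_bigr => a _ do rewrite !mxE entry_table.
case: (split_ordP (i : 'I_(1 + 7))) => k ->; case: (split_ordP (j : 'I_(1 + 7))) => l ->.
- rewrite (@block_mxEul _ 1 7 1 7) mxE big1 // => a _; rewrite !ord1 /= mulr0z mulr0 //.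
- rewrite (@block_mxEur _ 1 7 1 7) !mxE (bigD1 l) //= big1 => [|a /negbTE al].
    by rewrite !ord1 /= eqxx mulrN1z mulrN1 addr0.
  by rewrite !ord1 /= eq_sym (_ : (val a == val l) = false) ?mulr0 // -al.
- rewrite (@block_mxEdl _ 1 7 1 7) (bigD1 k) //= big1 => [|a /negbTE al].
    by rewrite !ord1 /= eqxx mulr1z mulr1 addr0.
  by rewrite !ord1 /= eq_sym (_ : (val a == val k) = false) ?mulr0 // -al.
rewrite (@block_mxEdr _ 1 7 1 7) !mxE; apply: eq_bigr => a _.
by rewrite /= mulrC.
Qed.

Lemma gamma_mx_delta (a : 'I_7) : gamma_mx (delta_mx a 0) = Gam a.
Proof.
rewrite gamma_mx_sum (bigD1 a) //= big1 => [|b /negbTE ba]; rewrite mxE ?ba ?scale0r //.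
by rewrite !eqxx scale1r addr0.
Qed.

Variable g : 'M[R]_7.
Hypothesis Gg : cross_automorphism g.
Local Notation h := (octonion_mx g).
Local Notation p1 := (\tr g).
Local Notation p2 := (\tr (g *m g)).
Local Notation p3 := (\tr (g *m g *m g)).

Lemma octonion_mx_orth : h^T *m h = 1%:M.
Proof.
rewrite /octonion_mx (@tr_block_mx _ 1 7 1 7) (@mulmx_block _ 1 7 1 7 1 7) !trmx0 !trmx1 !mulmx0 !mul0mx !mulmx1.
by rewrite (g_orthogonal Gg) !addr0 add0r -(@scalar_mx_block _ 1 7).
Qed.

(** The matrix h, with diagonal blocks 1 and g, is an automorphism of the octonions, so it
conjugates left multiplication by x into left multiplication by g x. *)
Lemma octonion_mx_conj (a : 'I_7) : h *m Gam a *m h^T = \sum_(d < 7) g d a *: Gam d.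
Proof.
have -> : h *m Gam a = (\sum_(d < 7) g d a *: Gam d) *m h.
  transitivity (gamma_mx (g *m delta_mx a 0) *m h); last first.
    by rewrite gamma_mx_sum; congr (_ *m _); apply: eq_bigr => d _; rewrite -colE mxE.
  rewrite -gamma_mx_delta /octonion_mx /gamma_mx !(@mulmx_block _ 1 7 1 7 1 7).
  rewrite ?(mul0mx, mulmx0, mul1mx, mulmx1, addr0, add0r) (cross_mx_conj Gg).
  by rewrite trmx_mul mulNmx -mulmxA (g_orthogonal Gg) mulmx1.
by rewrite -mulmxA (mulmx1C octonion_mx_orth) mulmx1.
Qed.

Lemma tr_conj_entries n (B X Y : 'M[R]_n) :
  \tr (B^T *m X *m B *m Y^T) = 
  \sum_i \sum_j \sum_k \sum_l B j i * B k l * (X j k * Y i l).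
Proof.
rewrite /mxtrace; apply: eq_bigr => i _.
rewrite exchange_big /=; under [RHS]eq_bigr do rewrite exchange_big /=.
rewrite exchange_big mxE; apply: eq_bigr => l _.
rewrite mxE mulr_suml; apply: eq_bigr => k _.
rewrite mxE !mulr_suml; apply: eq_bigr => j _.
by rewrite !mxE; ring.
Qed.

Lemma sum_kron (F : 'I_7 -> R) a : \sum_(d < 7) F d * (a == d)%:R = F a.
Proof.
rewrite (bigD1 a) //= big1 => [|d /negbTE da]; first by rewrite eqxx mulr1 addr0.
by rewrite eq_sym da mulr0.
Qed.

(** The map X |-> h X h^T on 8 x 8 matrices has trace (tr h)^2; its trace is computed here
in the Clifford basis. *)
Lemma clifford_trace :
  \sum_(p <- clifford) p.1%:~R * \tr ((mxt R 8 p.2)^T *m h *m mxt R 8 p.2 *m h^T)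
  = 48 * (\tr h) ^+ 2.
Proof.
transitivity (\sum_(i < 8) \sum_(j < 8) \sum_(k < 8) \sum_(l < 8)
    (48 * ((j == k) && (i == l)))%:R * (h j k * h i l)).
  under eq_bigr do rewrite tr_conj_entries mulr_sumr.
  rewrite exchange_big; apply: eq_bigr => i _.
  under eq_bigr do rewrite mulr_sumr.
  rewrite exchange_big; apply: eq_bigr => j _.
  under eq_bigr do rewrite mulr_sumr.
  rewrite exchange_big; apply: eq_bigr => k _.
  under eq_bigr do rewrite mulr_sumr.
  rewrite exchange_big; apply: eq_bigr => l _.
  under eq_bigr do rewrite (mulrA _%:~R).
  by rewrite -mulr_suml clifford_complete.
rewrite expr2 {2}/mxtrace mulrA mulr_sumr; apply: eq_bigr => i _.
rewrite /mxtrace mulr_sumr mulr_suml; apply: eq_bigr => j _.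
rewrite (bigD1 j) //= (bigD1 i) //= !eqxx muln1 !big1 ?addr0 ?mulrA //.
  by move=> k /negbTE kj; rewrite big1 // => l _; rewrite eq_sym kj muln0 mul0r.
by move=> l /negbTE li; rewrite eq_sym li andbF muln0 mul0r.
Qed.

Lemma conj_mul (A B : 'M[R]_8) : h *m (A *m B) *m h^T = (h *m A *m h^T) *m (h *m B *m h^T).
Proof. by rewrite !mulmxA -(mulmxA _ h^T h) octonion_mx_orth mulmx1. Qed.

Lemma tr_octonion_mx : \tr h = 1 + p1.
Proof. by rewrite (@mxtrace_block _ 1 7) mxtrace1. Qed.

Lemma word_tr (s : seq 'I_7) : (word R s)^T = (-1) ^+ size s *: word R (rev s).
Proof.
elim: s => [|a s IHs]; first by rewrite /word !big_nil scale1r trmx1.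
rewrite /word rev_cons -cats1 big_cat big_cons big_seq1 -mulmxE trmx_mul.
by rewrite IHs -/(word R (rev s)) Gam_tr mulmxN -scalemxAl exprS mulN1r scaleNr.
Qed.

Lemma word_conj s : h *m word R s *m h^T =
  \prod_(a <- s) \sum_(d < 7) g d a *: Gam d.
Proof.
elim: s => [|a s IHs].
  by rewrite /word !big_nil mulmx1 (mulmx1C octonion_mx_orth).
by rewrite /word !big_cons -mulmxE conj_mul -/(word R s) IHs octonion_mx_conj.
Qed.

Lemma tr_conj_word s : \tr ((word R s)^T *m h *m word R s *m h^T) =
  (-1) ^+ size s * \tr (word R (rev s) *m \prod_(a <- s) \sum_(d < 7) g d a *: Gam d).
Proof. by rewrite -!mulmxA (mulmxA h) word_conj word_tr -scalemxAl linearZ. Qed.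

Lemma sum_kron2 (F : 'I_7 -> 'I_7 -> R) a b :
  \sum_(d < 7) \sum_(e < 7) F d e * ((a == d)%:R * (b == e)%:R) = F a b.
Proof.
under eq_bigr => d _.
  under eq_bigr => e _ do rewrite mulrA.
  rewrite sum_kron; over.
exact: sum_kron.
Qed.

Lemma sum_kron3 (F : 'I_7 -> 'I_7 -> 'I_7 -> R) a b c :
  \sum_(d < 7) \sum_(e < 7) \sum_(f < 7)
     F d e f * ((a == d)%:R * (b == e)%:R * (c == f)%:R) = F a b c.
Proof.
under eq_bigr => d _.
  under eq_bigr => e _.
    under eq_bigr => f _ do rewrite mulrA.
    rewrite sum_kron; over.
  over.
exact: sum_kron2.
Qed.

Lemma tr_sum n (F : 'I_n -> 'M[R]_8) : \tr (\sum_(i < n) F i) = \sum_(i < n) \tr (F i).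
Proof. exact: linear_sum. Qed.

(** The diagonal coefficients of conjugation by h on products of one, two or three generators
are 8 times the principal minors of g, so that they add up to its elementary symmetric functions. *)
Lemma tr_conj_word1 a :
  \tr ((word R [:: a])^T *m h *m word R [:: a] *m h^T) = 8 * g a a.
Proof.
rewrite tr_conj_word /= expr1 mulN1r big_seq1 mulmx_sumr tr_sum -[in RHS](sum_kron (g^~ a) a).
rewrite mulr_sumr -sumrN; apply: eq_bigr => d _.
rewrite -scalemxAr mxtraceZ /=.
have -> : word R [:: a] *m Gam d = word R [:: a; d].
  by rewrite /word big_seq1 big_cons big_seq1.
by rewrite tr_word2; ring.
Qed.

Lemma tr_conj_word2 a b :
  \tr ((word R [:: a; b])^T *m h *m word R [:: a; b] *m h^T) * (neq2 a b)%:~R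
   = 8 * (g a a * g b b - g a b * g b a).
Proof.
have [<-|ab] := eqVneq a b; first by rewrite /neq2 eqxx mulr0z mulr0 subrr mulr0.
have -> : neq2 a b = 1 by rewrite /neq2 -[eq_op _ _]/(a == b) (negbTE ab).
pose F d e := g d a * g e b.
have -> : g a a * g b b - g a b * g b a = F a b - F b a by rewrite /F; ring.
rewrite mulr1 tr_conj_word /= sqrrN expr1n mul1r.
rewrite -(sum_kron2 F a b) -(sum_kron2 F b a) -sumrB mulr_sumr.
rewrite big_cons big_seq1 mulr_suml mulmx_sumr tr_sum; apply: eq_bigr => d _.
rewrite -sumrB mulr_sumr mulr_sumr mulmx_sumr tr_sum; apply: eq_bigr => e _.
rewrite -scalerAl -scalerAr -!scalemxAr !mxtraceZ /=.
have -> : word R (rev [:: a; b]) *m (Gam d * Gam e) = word R [:: b; a; d; e].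
  by rewrite /word !big_cons !big_nil !mulr1 -!mulmxE !mulmxA.
by rewrite tr_word4 (eq_sym b a) (negbTE ab) /F /=; ring.
Qed.

Lemma tr_scale3 (u v w : R) (W A B C : 'M[R]_8) :
  \tr (W *m ((u *: A) *m ((v *: B) *m (w *: C))))
    = u * v * w * \tr (W *m (A *m (B *m C))).
Proof.
by rewrite -scalemxAr -!scalemxAl -!scalemxAr !scalerA mxtraceZ; congr (_ * _); ring.
Qed.

Lemma tr_conj_word3 a b c :
  \tr ((word R [:: a; b; c])^T *m h *m word R [:: a; b; c] *m h^T) * (neq3 a b c)%:~R
   = 8 * (g a a * g b b * g c c - g a a * (g b c * g c b) - g b b * (g a c * g c a)
          - g c c * (g a b * g b a) + g a b * g b c * g c a + g a c * g c b * g b a).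
Proof.
have neqE : neq3 a b c = [&& a != b, a != c & b != c].
  by rewrite /neq3 /= !inE !negb_or andbT -andbA; case: andP.
rewrite neqE; have [<-|ab] := eqVneq a b; first by rewrite /= mulr0z mulr0; ring.
have [<-|ac] := eqVneq a c; first by rewrite /= mulr0z mulr0; ring.
have [<-|bc] := eqVneq b c; first by rewrite /= mulr0z mulr0; ring.
rewrite /= mulr1.
pose F d e f := g d a * g e b * g f c.
transitivity (8 * (F a b c - F a c b - F c b a - F b a c + F c a b + F b c a));
  last by rewrite /F; ring.
rewrite tr_conj_word -signr_odd /= expr1 mulN1r.
rewrite -(sum_kron3 F a b c) -(sum_kron3 F a c b) -(sum_kron3 F c b a).
rewrite -(sum_kron3 F b a c) -(sum_kron3 F c a b) -(sum_kron3 F b c a).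
rewrite -!sumrB -!big_split /= mulr_sumr.
rewrite !big_cons big_nil mulr1 -!mulmxE mulmx_suml mulmx_sumr tr_sum -sumrN.
apply: eq_bigr => d _.
rewrite -!sumrB -!big_split /= mulr_sumr mulmx_suml !mulmx_sumr tr_sum -sumrN.
apply: eq_bigr => e _.
rewrite -!sumrB -!big_split /= mulr_sumr !mulmx_sumr tr_sum -sumrN; apply: eq_bigr => f _.
rewrite [X in - X](_ : _ = F d e f * \tr (word R [:: c; b; a; d; e; f])); last first.
  have -> : word R [:: c; b; a; d; e; f] =
      word R (rev [:: a; b; c]) *m (Gam d *m (Gam e *m Gam f)).
    by rewrite /word !big_cons !big_nil !mulr1 -!mulmxE !mulmxA.
  exact: tr_scale3.
rewrite tr_word6 (eq_sym b a) (eq_sym c a) (eq_sym c b) (negbTE ab) (negbTE ac) (negbTE bc) /F /=.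
ring.
Qed.

(** The spin representation of Spin(7) restricts to G2 as 1 + R^7, and its tensor square is the
sum of the exterior powers of R^7 of degree at most 3. Hence (1 + p1)^2 = 1 + e1 + e2 + e3
for the elementary symmetric functions e_k of the eigenvalues, and Newton's formulas turn
this into a relation between the traces of g, g^2 and g^3. *)
Lemma G2_trace_identity :
  p1 ^+ 3 - 3 * p1 * p2 + 2 * p3 = 3 * p1 ^+ 2 + 3 * p2 + 6 * p1.
Proof.
have p2E : p2 = \sum_(a < 7) \sum_(b < 7) g a b * g b a.
  by apply: eq_bigr => a _; rewrite mxE.
have p3E : p3 = \sum_(a < 7) \sum_(b < 7) \sum_(c < 7) g a b * g b c * g c a.
  apply: eq_bigr => a _; rewrite mxE exchange_big; apply: eq_bigr => c _.
  by rewrite mxE mulr_suml.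
have := clifford_trace; rewrite big_clifford tr_octonion_mx /=.
have -> : mxt R 8 (table 8 (fun i j => if i == j then 1 else 0)) = 1%:M.
  by apply/matrixP => i j; rewrite !mxE entry_table -[eq_op _ _]/(i == j); case: eqP.
rewrite trmx1 mul1mx mulmx1 (mulmx1C octonion_mx_orth) mxtrace1.
have -> : \sum_(a < 7) 6%:~R * \tr ((Gam a)^T *m h *m Gam a *m h^T) = 48 * p1.
  rewrite [in RHS]/mxtrace mulr_sumr; apply: eq_bigr => a _.
  by have := tr_conj_word1 a; rewrite /word big_seq1 => ->; ring.
have -> : \sum_(a < 7) \sum_(b < 7) (3 * neq2 a b)%:~R *
     \tr ((mxt R 8 (mul_table 8 (gam a) (gam b)))^T *m h *m
          mxt R 8 (mul_table 8 (gam a) (gam b)) *m h^T) = 24 * (p1 ^+ 2 - p2).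
  rewrite p2E expr2 [in X in 24 * (X * _ - _)]/mxtrace mulr_suml -sumrB mulr_sumr.
  apply: eq_bigr => a _; rewrite [in RHS]/mxtrace mulr_sumr -sumrB mulr_sumr; apply: eq_bigr => b _.
  have := tr_conj_word2 a b; rewrite /word !big_cons big_nil mulr1 -mulmxE -mxt_mul.
  set T := \tr _ => E; transitivity (3 * (T * (neq2 a b)%:~R)); last by rewrite E; ring.
  by rewrite rmorphM /=; ring.
have -> : \sum_(a < 7) \sum_(b < 7) \sum_(c < 7) (neq3 a b c)%:~R *
     \tr ((mxt R 8 (mul_table 8 (gam a) (mul_table 8 (gam b) (gam c))))^T *m h *m
          mxt R 8 (mul_table 8 (gam a) (mul_table 8 (gam b) (gam c))) *m h^T)
     = 8 * (p1 ^+ 3 - 3 * p1 * p2 + 2 * p3).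
  transitivity (\sum_(a < 7) \sum_(b < 7) \sum_(c < 7)
     8 * (g a a * g b b * g c c - g a a * (g b c * g c b) - g b b * (g a c * g c a)
          - g c c * (g a b * g b a) + g a b * g b c * g c a + g a c * g c b * g b a)).
    apply: eq_bigr => a _; apply: eq_bigr => b _; apply: eq_bigr => c _.
    rewrite -tr_conj_word3 mulrC /word !big_cons big_nil mulr1.
    by rewrite -!mulmxE -!mxt_mul.
  have e1 : \sum_(a < 7) \sum_(b < 7) \sum_(c < 7) g a a * g b b * g c c = p1 ^+ 3.
    rewrite exprS expr2 {1}/mxtrace mulr_suml; apply: eq_bigr => a _.
    rewrite {1}/mxtrace mulr_suml mulr_sumr; apply: eq_bigr => b _.
    by rewrite -!mulr_sumr mulrA.
  have e2 : \sum_(a < 7) \sum_(b < 7) \sum_(c < 7) g a a * (g b c * g c b) = p1 * p2.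
    rewrite p2E /mxtrace mulr_suml; apply: eq_bigr => a _.
    by rewrite mulr_sumr; apply: eq_bigr => b _; rewrite mulr_sumr.
  have e3 : \sum_(a < 7) \sum_(b < 7) \sum_(c < 7) g b b * (g a c * g c a) = p1 * p2.
    by rewrite exchange_big.
  have e4 : \sum_(a < 7) \sum_(b < 7) \sum_(c < 7) g c c * (g a b * g b a) = p1 * p2.
    rewrite -e2 [RHS]exchange_big; apply: eq_bigr => a _ /=.
    by rewrite [RHS]exchange_big.
  have e5 : \sum_(a < 7) \sum_(b < 7) \sum_(c < 7) g a c * g c b * g b a = p3.
    by rewrite p3E; apply: eq_bigr => a _; rewrite exchange_big.
  transitivity (8 * (p1 ^+ 3 - p1 * p2 - p1 * p2 - p1 * p2 + p3 + p3)); last by ring.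
  rewrite -{1}e1 -{1}e2 -{1}e3 -{1}e4 -{2}e5 p3E -!sumrB -!big_split /= mulr_sumr.
  apply: eq_bigr => a _; rewrite -!sumrB -!big_split /= mulr_sumr.
  by apply: eq_bigr => b _; rewrite -!sumrB -!big_split /= mulr_sumr.
move: (p1) (p2) (p3) => x y z; nra.
Qed.
End SpinTrace.

(** * The character of the adjoint representation *)

(** Six times the projection of an elementary matrix onto the Lie algebra of G2. *)
Definition proj_table i j : seq (seq int) := table 7 (fun k l =>
  3 * ((if eqn i k && eqn j l then 1 else 0) - (if eqn j k && eqn i l then 1 else 0))
  + sumz 7 (fun a => fano j a i * fano k a l)).

Definition fano_mul k p q (x : int) : int :=
  match fano k p q with Posz O => 0 | s => intRing.mulz s x end.

(** The derivation property on pairs of basis vectors, with the vanishing structure constants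
skipped by fano_mul. *)
Definition proj_check := alln 7 (fun i => alln 7 (fun j => let D := proj_table i j in
  alln 7 (fun p => alln 7 (fun q => alln 7 (fun m =>
  match foldr (fun l s => intZmod.addz (fano_mul l p q (entry D m l)) s) 0 (iota 0 7),
        foldr (fun l s => intZmod.addz (intZmod.addz
          (fano_mul m l q (entry D l p)) (fano_mul m p l (entry D l q))) s) 0 (iota 0 7) with
  | Posz u, Posz v => eqn u v
  | Negz u, Negz v => eqn u v
  | _, _ => false
  end))))).

Lemma proj_checked : proj_check.
Proof. vm_cast_no_check (erefl true). Qed.

Section Adjoint.
Variable R : realType.
Implicit Types (x y : 'cV[R]_7) (g D X : 'M[R]_7).
Local Notation L a := (cross_mx (delta_mx a 0 : 'cV[R]_7)).

(** The skew matrices are the orthogonal sum of g2 and of the span of the L_a, and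
tr (L_a L_a) = -6: this is the orthogonal projection onto g2. *)
Definition proj_g2 X : 'M[R]_7 :=
  2^-1 *: (X - X^T) + 6^-1 *: \sum_(a < 7) \tr (L a *m X) *: L a.

Lemma proj_g2_is_linear : linear proj_g2.
Proof.
move=> u X Y; rewrite /proj_g2.
have -> : \sum_(a < 7) \tr (L a *m (u *: X + Y)) *: L a =
    u *: (\sum_(a < 7) \tr (L a *m X) *: L a) + \sum_(a < 7) \tr (L a *m Y) *: L a.
  rewrite scaler_sumr -big_split /=; apply: eq_bigr => a _.
  by rewrite mulmxDr -scalemxAr mxtraceD mxtraceZ scalerDl scalerA.
move: (\sum_(a < 7) _) (\sum_(a < 7) _) => S T.
by apply/matrixP => i j; rewrite !mxE; ring.
Qed.
HB.instance Definition _ := GRing.isLinear.Build _ _ _ _ proj_g2 proj_g2_is_linear.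

Lemma proj_g2_delta (i j : 'I_7) :
  proj_g2 (delta_mx i j) = 6^-1 *: mxt R 7 (proj_table i j).
Proof.
apply/matrixP => k l; rewrite !mxE summxE entry_table.
under eq_bigr => a _.
  rewrite mxE (_ : \tr _ = (fano j a i)%:~R); last first.
    rewrite /mxtrace (bigD1 j) //= big1 ?addr0 => [|m /negbTE mj].
      rewrite mxE (bigD1 i) //= big1 ?addr0 => [|m /negbTE mi].
        by rewrite cross_mx_delta !mxE entry_table !eqxx mulr1.
      by rewrite [delta_mx _ _ _ _]mxE mi mulr0.
    by rewrite mxE big1 // => m' _; rewrite [delta_mx _ _ _ _]mxE mj andbF mulr0.
  rewrite cross_mx_delta !mxE entry_table -rmorphM; over.
rewrite -rmorph_sum (sumzE _ (fun a => fano j a i * fano k a l)).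
move: (sumz _ _) => s; rewrite intrD intrM intrB.
rewrite -[eqn i k]/(i == k) -[eqn j l]/(j == l) -[eqn j k]/(j == k) -[eqn i l]/(i == l).
rewrite (eq_sym k) (eq_sym l) (eq_sym l i) (eq_sym k j) (andbC (i == l)).
by do 2!case: (_ && _) => /=; rewrite ?mulr1z ?mulr0z; field.
Qed.

Lemma proj_g2_in X : proj_g2 X \in g2 R.
Proof.
rewrite (matrix_sum_delta X) linear_sum; apply: memv_suml => i _.
rewrite linear_sum; apply: memv_suml => j _; rewrite linearZ; apply: memvZ => /=.
rewrite proj_g2_delta; apply: memvZ; set D := mxt _ _ _.
apply/subv_bigcapP => p _; apply/subv_bigcapP => q _.
rewrite -memvE memv_ker lfunE /= /leibniz_defect -addrA -opprD subr_eq0; apply/eqP/colP => m.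
have := allnP (allnP (allnP (allnP (allnP proj_checked i) j) p) q) m.
have mulE k a b u : fano_mul k a b u = fano k a b * u.
  by rewrite /fano_mul; case: (fano k a b) => [[|n]|n] //; rewrite mul0r.
set u := foldr _ _ _; set v := foldr _ _ _ => chk.
have {chk} uv : u = v by case: u v chk => [u|u] [v|v] // /eqP->.
have uE : u%:~R = (D *m cross (delta_mx p 0) (delta_mx q 0)) m 0 :> R.
  rewrite mxE -[u]/(sumz 7 (fun l => fano_mul l p q (entry (proj_table i j) m l))) -sumzE.
  rewrite rmorph_sum /=; apply: eq_bigr => l _.
  by rewrite mulE rmorphM /= cross_mxE cross_mx_delta -colE !mxE entry_table mulrC.
have vE : v%:~R = (cross (D *m delta_mx p 0) (delta_mx q 0)
                   + cross (delta_mx p 0) (D *m delta_mx q 0)) m 0 :> R.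
  rewrite -[v]/(sumz 7 (fun l => fano_mul m l q (entry (proj_table i j) l p)
     + fano_mul m p l (entry (proj_table i j) l q))) -sumzE.
  rewrite rmorph_sum /= [RHS]mxE !cross_mxE -!colE [X in X + _]mxE [X in X + _]mxE.
  rewrite [X in _ + X]mxE -big_split; apply: eq_bigr => l _ /=.
  by rewrite cross_mx_delta !mxE !entry_table !mulE intrD !intrM.
by rewrite -uE -vE uv.
Qed.

Let mxtraceB (A B : 'M[R]_7) : \tr (A - B) = \tr A - \tr B.
Proof. exact: linearB. Qed.

Lemma derivation_comm D x : D \in g2 R ->
  cross_mx (D *m x) = D *m cross_mx x - cross_mx x *m D.
Proof.
move=> /g2P DD; apply: mulmx_ext => y.
by rewrite mulmxBl -!mulmxA -!cross_mxE DD addrK.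
Qed.

Lemma derivation_skew D : D \in g2 R -> D^T = - D.
Proof.
move=> DD; apply: mulmx_ext => y; apply: trmx_inj; apply: mulmx_ext => x.
have := congr2 +%R (tr_cross_mx2 (D *m y) x) (tr_cross_mx2 y (D *m x)).
rewrite !derivation_comm // mulmxBl mulmxBr !mxtraceB -!mulmxA.
rewrite (mxtrace_mulC D) -!mulmxA addrA subrK subrr -mulrDr => /esym/eqP.
rewrite mulf_eq0 oppr_eq0 pnatr_eq0 /= addr_eq0 => /eqP h.
have -> : (D^T *m y)^T *m x = y^T *m (D *m x) by rewrite trmx_mul trmxK mulmxA.
have -> : (- D *m y)^T *m x = - ((D *m y)^T *m x) by rewrite mulNmx linearN mulNmx.
by apply/matrixP => i j; rewrite !ord1 [RHS]mxE h opprK.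
Qed.

Lemma sum_fano_cross2 (a : 'I_7) :
  \sum_(b < 7) \sum_(c < 7) (fano a b c)%:~R *: (L b *m L c) = - 3 *: L a.
Proof.
pose check := alln 7 (fun a => alln 7 (fun k => alln 7 (fun l =>
  sumz 7 (fun b => sumz 7 (fun c =>
    match fano a b c with
    | Posz O => 0
    | s => s * sumz 7 (fun i => fano k b i * fano i c l)
    end))
  == - 3 * fano k a l))).
have chk : check by vm_cast_no_check (erefl true).
apply/matrixP => k l; have /eqP := allnP (allnP (allnP chk a) k) l.
rewrite -sumzE => /(congr1 (fun z : int => z%:~R : R)).
rewrite intrM rmorph_sum /= summxE => E.
rewrite cross_mx_delta.
rewrite [RHS]mxE.
rewrite [X in _ * X]mxE.
rewrite entry_table.
transitivity ((- 3)%:~R * (fano k a l)%:~R : R); last by rewrite intrN.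
rewrite -E.
apply: eq_bigr => b _; rewrite summxE -sumzE rmorph_sum; apply: eq_bigr => c _ /=.
rewrite !cross_mx_delta !mxE; under eq_bigr do rewrite !mxE !entry_table -intrM.
rewrite -rmorph_sum (sumzE _ (fun i => fano k b i * fano i c l)).
move: (sumz 7 (fun i => fano k b i * _)) => s; rewrite -intrM.
by case: (fano a b c) => [[|n]|n]; rewrite ?mul0r.
Qed.

(** Contracting the products L_b L_c with the structure constants gives - 3 L_a. Pairing with
D, the antisymmetrized contraction is - 6 t; by [D, L_b] = L_(D b) it is also 6 t. *)
Lemma derivation_tr0 D (a : 'I_7) : D \in g2 R -> \tr (L a *m D) = 0.
Proof.
move=> DD; set t := \tr _.
suff : 12 * t = 0 by move/eqP; rewrite mulf_eq0 pnatr_eq0 => /eqP.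
have e1 : \sum_(b < 7) \sum_(c < 7) (fano a b c)%:~R * \tr (D *m (L b *m L c)) = - 3 * t.
  transitivity (\tr (D *m \sum_(b < 7) \sum_(c < 7) (fano a b c)%:~R *: (L b *m L c))).
    rewrite mulmx_sumr linear_sum; apply: eq_bigr => b _ /=.
    rewrite mulmx_sumr linear_sum; apply: eq_bigr => c _ /=.
    by rewrite -scalemxAr mxtraceZ.
  by rewrite sum_fano_cross2 -scalemxAr mxtraceZ mxtrace_mulC.
have e2 : \sum_(b < 7) \sum_(c < 7) (fano a b c)%:~R * \tr (D *m (L c *m L b)) = 3 * t.
  rewrite -[3 * t]opprK -mulNr -e1 exchange_big -sumrN; apply: eq_bigr => b _ /=.
  rewrite -sumrN; apply: eq_bigr => c _ /=; rewrite -mulNr -intrN; congr (_%:~R * _).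
  pose check := alln 7 (fun a => alln 7 (fun b => alln 7 (fun c => fano a c b == - fano a b c))).
  have chk : check by vm_cast_no_check (erefl true).
  by apply/eqP; apply: (allnP (allnP (allnP chk a) b) c).
have e3 : \sum_(b < 7) \sum_(c < 7) (fano a b c)%:~R *
    (\tr (D *m (L b *m L c)) - \tr (D *m (L c *m L b))) = 6 * t.
  rewrite /t mxtrace_mulC [in RHS]/mxtrace mulr_sumr exchange_big; apply: eq_bigr => c _ /=.
  rewrite mxE mulr_sumr; apply: eq_bigr => b _.
  rewrite [X in _ - X](_ : _ = \tr (L b *m D *m L c)); last first.
    by rewrite mulmxA mxtrace_mulC mulmxA.
  rewrite mulmxA -mxtraceB -mulmxBl -derivation_comm // tr_cross_mx2.
  have -> : ((D *m (delta_mx b 0 : 'cV[R]_7))^T *m (delta_mx c 0 : 'cV[R]_7)) 0 0 = D c b.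
    by rewrite -!colE !mxE.
  pose check := alln 7 (fun a => alln 7 (fun b => alln 7 (fun c => fano a b c == - fano b a c))).
  have chk : check by vm_cast_no_check (erefl true).
  rewrite cross_mx_delta !mxE entry_table (eqP (allnP (allnP (allnP chk a) b) c)) intrN.
  by ring.
have : \sum_(b < 7) \sum_(c < 7) (fano a b c)%:~R *
    (\tr (D *m (L b *m L c)) - \tr (D *m (L c *m L b))) = - 3 * t - 3 * t.
  rewrite -{1}e1 -e2 -sumrB; apply: eq_bigr => b _; rewrite -sumrB; apply: eq_bigr => c _.
  by rewrite mulrBr.
rewrite e3; lra.
Qed.

Lemma proj_g2_id D : D \in g2 R -> proj_g2 D = D.
Proof.
move=> DD; rewrite /proj_g2 derivation_skew // opprK big1 => [|a _].
  by apply/matrixP => i j; rewrite scaler0 addr0 !mxE; lra.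
by rewrite derivation_tr0 // scale0r.
Qed.

(** Conjugation by g on the skew matrices is the exterior square of R^7, which is the sum of
g2 and R^7; the trace on g2 is obtained by composing with the projection. *)
Lemma tr_rho2 (g : G2 R) :
  \tr (rho2 g) = (((\tr (G2val g)) ^+ 2 - \tr (G2val g *m G2val g)) / 2 - \tr (G2val g))%:C.
Proof.
have /asboolP Gg := G2P g; have [ug _] := Gg; set h := G2val g in Gg ug *.
have hV : invmx h = h^T.
  by rewrite -[LHS]mul1mx -(g_orthogonal Gg) mulmxK.
rewrite /rho2 trace_map_mx; congr (_%:C).
transitivity (\sum_i \sum_j (h *m proj_g2 (delta_mx i j) *m h^T) i j).
  rewrite /mxtrace; set b := vbasis (g2 R).
  transitivity (\sum_k coord b k (proj_g2 (h *m b`_k *m h^T))).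
    apply: eq_bigr => k _; rewrite mxE hV proj_g2_id // -hV; apply: Ad_g2.
    by rewrite vbasis_mem // mem_nth // size_tuple.
  under eq_bigr => k _.
    rewrite {1}(matrix_sum_delta (h *m _ *m _)) linear_sum linear_sum.
    under eq_bigr do rewrite linear_sum linear_sum.
    over.
  rewrite exchange_big; apply: eq_bigr => i _ /=.
  rewrite exchange_big; apply: eq_bigr => j _ /=.
  rewrite [in RHS](coord_vbasis (proj_g2_in (delta_mx i j))) mulmx_sumr mulmx_suml summxE.
  apply: eq_bigr => k _; rewrite linearZ /= linearZ /= -scalemxAr -scalemxAl [RHS]mxE.
  by rewrite mulrC.
have conj_delta (B : 'M[R]_7) k l i j :
    (h *m delta_mx k l *m B) i j = h i k * B l j.
  rewrite mxE (bigD1 l) //= big1 ?addr0 => [|m /negbTE ml].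
    rewrite mxE (bigD1 k) //= big1 ?addr0 => [|m /negbTE mk].
      by rewrite mxE !eqxx mulr1.
    by rewrite mxE mk mulr0.
  by rewrite mxE big1 ?mul0r // => m' _; rewrite mxE ml andbF mulr0.
have tr_delta (A : 'M[R]_7) i j : \tr (A *m delta_mx i j) = A j i.
  rewrite /mxtrace (bigD1 j) //= big1 ?addr0 => [|m /negbTE mj].
    rewrite mxE (bigD1 i) //= big1 ?addr0 => [|m /negbTE mi].
      by rewrite mxE !eqxx mulr1.
    by rewrite mxE mi mulr0.
  by rewrite mxE big1 // => m' _; rewrite mxE mj andbF mulr0.
transitivity (\sum_i \sum_j (2^-1 * (h i i * h j j - h i j * h j i)
    + 6^-1 * \sum_(a < 7) L a j i * (h *m L a *m h^T) i j)).
  apply: eq_bigr => i _; apply: eq_bigr => j _.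
  rewrite /proj_g2 mulmxDr mulmxDl [LHS]mxE -!scalemxAr -!scalemxAl; congr (_ + _).
    rewrite [LHS]mxE mulmxBr mulmxBl trmx_delta; congr (_ * _).
    by rewrite [LHS]mxE [X in _ + X]mxE !conj_delta !mxE.
  rewrite [LHS]mxE; congr (_ * _).
  rewrite mulmx_sumr mulmx_suml summxE; apply: eq_bigr => a _.
  by rewrite -scalemxAr -scalemxAl [LHS]mxE tr_delta.
have -> : (\tr h ^+ 2 - \tr (h *m h)) / 2 =
    \sum_i \sum_j 2^-1 * (h i i * h j j - h i j * h j i).
  rewrite expr2 {1}/mxtrace mulr_suml -sumrB mulrC mulr_sumr; apply: eq_bigr => i _.
  by rewrite /mxtrace mulr_sumr mxE -sumrB mulr_sumr.
have -> : \tr h = - (\sum_i \sum_j 6^-1 * \sum_(a < 7) L a j i * (h *m L a *m h^T) i j).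
  transitivity (- (6^-1 * \sum_(a < 7) \tr (L a *m (h *m L a *m h^T)))); last first.
    congr (- _); under [RHS]eq_bigr do rewrite -mulr_sumr.
    rewrite -mulr_sumr; congr (_ * _).
    under [RHS]eq_bigr do rewrite exchange_big.
    rewrite [RHS]exchange_big; apply: eq_bigr => a _ /=.
    by rewrite /mxtrace [RHS]exchange_big; apply: eq_bigr => j _; rewrite mxE.
  rewrite -[LHS]opprK; congr (- _); rewrite mulr_sumr -sumrN; apply: eq_bigr => a _.
  rewrite (cross_mx_conj Gg) -[X in _ *m X]mulmxA -hV mulmxV // mulmx1 tr_cross_mx2.
  rewrite (_ : (_ *m _) 0 0 = h a a); first by field.
  by rewrite mulmxA trmx_delta -rowE -colE !mxE.
rewrite opprK -big_split; apply: eq_bigr => i _ /=.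
by rewrite -big_split.
Qed.

End Adjoint.

(** * Conjugacy in SL(2,8) *)

Section Matrix2.
Variable K : comNzRingType.
Implicit Types x y z w : K.

Definition mx2 x y z w : 'M[K]_2 := \matrix_(i < 2, j < 2)
  if i == 0 then (if j == 0 then x else y) else (if j == 0 then z else w).

Lemma ord2P (i : 'I_2) : i = 0 \/ i = 1.
Proof. by case: i => [[|[|//]] h]; [left | right]; apply: val_inj. Qed.

Lemma mx2_eq (A B : 'M[K]_2) :
  A 0 0 = B 0 0 -> A 0 1 = B 0 1 -> A 1 0 = B 1 0 -> A 1 1 = B 1 1 -> A = B.
Proof.
move=> e00 e01 e10 e11; apply/matrixP => i j.
by case: (ord2P i) => ->; case: (ord2P j) => ->.
Qed.

Lemma mx2_eta (A : 'M[K]_2) : A = mx2 (A 0 0) (A 0 1) (A 1 0) (A 1 1).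
Proof. by apply: mx2_eq; rewrite !mxE. Qed.

Lemma sum2 (G : 'I_2 -> K) : \sum_i G i = G 0 + G 1.
Proof.
rewrite !big_ord_recl big_ord0 addr0; congr (G _ + G _); exact: val_inj.
Qed.

Lemma mx2_mul x y z w x' y' z' w' : mx2 x y z w *m mx2 x' y' z' w' =
  mx2 (x * x' + y * z') (x * y' + y * w') (z * x' + w * z') (z * y' + w * w').
Proof. by apply: mx2_eq; rewrite !mxE sum2 !mxE. Qed.

Lemma mx2_tr x y z w : \tr (mx2 x y z w) = x + w.
Proof. by rewrite /mxtrace sum2 !mxE. Qed.

Lemma mx2_1 : 1%:M = mx2 1 0 0 1.
Proof. by apply: mx2_eq; rewrite !mxE. Qed.

Lemma mx2_det x y z w : \det (mx2 x y z w) = x * w - y * z.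
Proof.
rewrite (expand_det_row _ 0) sum2 !mxE /cofactor !det_mx11 !mxE /=.
by rewrite expr0 expr1 mul1r mulN1r mulrN.
Qed.
End Matrix2.

Section Order8.
Variable F : finFieldType.
Hypothesis cardF : #|F| = 8%N.
Implicit Types (a b t x y z w : F) (A P : 'M[F]_2).

Lemma pchar2 : 2 \in [pchar F].
Proof. exact: (@card_finPcharP _ 2 3). Qed.
Lemma addxx x : x + x = 0. Proof. exact: addrr_pchar2 pchar2 x. Qed.
Lemma oppx x : - x = x. Proof. exact: oppr_pchar2 pchar2 x. Qed.
Lemma two0 : 2 = 0 :> F. Proof. exact: addxx. Qed.
Lemma expx8 x : x ^+ 8 = x. Proof. by rewrite -cardF expf_card. Qed.
Lemma expx7 x : x != 0 -> x ^+ 7 = 1.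
Proof. by move=> x0; apply: (mulfI x0); rewrite -exprS expx8 mulr1. Qed.

Lemma det2E A : \det A = A 0 0 * A 1 1 + A 0 1 * A 1 0.
Proof. by rewrite {1}(mx2_eta A) mx2_det oppx. Qed.
Lemma tr2E A : \tr A = A 0 0 + A 1 1.
Proof. by rewrite {1}(mx2_eta A) mx2_tr. Qed.

Definition companion t : 'M[F]_2 := mx2 0 1 1 t.
Definition transvection y : 'M[F]_2 := mx2 1 y 0 1.

Lemma det_companion t : \det (companion t) = 1.
Proof. by rewrite mx2_det mul0r mulr1 sub0r oppx. Qed.
Lemma det_transvection y : \det (transvection y) = 1.
Proof. by rewrite mx2_det mulr1 mulr0 subr0. Qed.

Lemma companion_neq1 t : companion t != 1.
Proof.
by apply/eqP => /matrixP/(_ 0 1)/eqP; rewrite !mxE /= oner_eq0.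
Qed.

(** A row vector v = (p, q) with det (v, v A) = 1 provides the base change. The determinant is
a quadratic form in (p, q); it takes the value 1 because squaring is onto if A is not
diagonal, and through its cross term otherwise. *)
Lemma conj_companion A : \det A = 1 -> A != 1 ->
  exists P, \det P = 1 /\ P * A = companion (\tr A) * P.
Proof.
move=> dA A1; rewrite tr2E.
pose x := A 0 0; pose y := A 0 1; pose z := A 1 0; pose w := A 1 1.
have AE : A = mx2 x y z w := mx2_eta A.
have dE : x * w + y * z = 1 by rewrite -dA det2E.
have sq (u : F) : (u ^+ 4) ^+ 2 = u by rewrite -exprM; exact: expx8.
suff [p [q pq]] : exists p q, y * p ^+ 2 + (x + w) * p * q + z * q ^+ 2 = 1.
  exists (mx2 p q (p * x + q * z) (p * y + q * w)); split.
    by rewrite mx2_det -pq oppx; ring.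
  rewrite AE -!mulmxE !mx2_mul !mxE /=; congr mx2; rewrite ?mul0r ?mul1r ?add0r //.
    have -> : (p * x + q * z) * x + (p * y + q * w) * z =
      p * (x * w + y * z) + (x + w) * (p * x + q * z) - 2 * (p * x * w) by ring.
    by rewrite dE mulr1 two0 mul0r subr0.
  have -> : (p * x + q * z) * y + (p * y + q * w) * w =
      q * (x * w + y * z) + (x + w) * (p * y + q * w) - 2 * (q * x * w) by ring.
  by rewrite dE mulr1 two0 mul0r subr0.
(* The fourth power inverts squaring, as u^8 = u. *)
have [y0|y0] := eqVneq y 0; last first.
  exists (y^-1 ^+ 4), 0.
  by rewrite sq mulr0 expr0n !mulr0 !addr0 divff.
have [z0|z0] := eqVneq z 0; last first.
  exists 0, (z^-1 ^+ 4).
  by rewrite sq expr0n !mulr0 mul0r !add0r divff.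
have xw : x * w = 1 by rewrite -dE y0 mul0r addr0.
have xw0 : x + w != 0.
  apply: contra A1 => /eqP/(canRL (addrK _)); rewrite sub0r oppx => xwE.
  have : (x - 1) ^+ 2 = 0.
    have -> : (x - 1) ^+ 2 = x * x + 1 - 2 * x by ring.
    by rewrite {2}xwE xw two0 mul0r subr0 addxx.
  move/eqP; rewrite expf_eq0 /= subr_eq0 => /eqP x1.
  by apply/eqP; rewrite AE y0 z0 -xwE x1; exact/esym/mx2_1.
exists 1, (x + w)^-1.
by rewrite y0 z0 !mul0r add0r addr0 mulr1 divff.
Qed.

Lemma card_mul_eq (c : F) :
  (\sum_(y : F) \sum_(z : F | (y * z == c)%R) 1 = 7 + 8 * (c == 0%R))%N.
Proof.
have E y : (\sum_(z : F | (y * z == c)%R) 1 = if y == 0%R then 8 * (c == 0%R) else 1)%N.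
  have [->|y0] := eqVneq y 0.
    under eq_bigl do rewrite mul0r eq_sym.
    case: (c == 0); last by rewrite big_pred0_eq.
    by rewrite sum1_card cardF.
  rewrite (big_pred1 (y^-1 * c)) // => z.
  by rewrite (can2_eq (mulKf y0) (mulVKf y0)).
under eq_bigr do rewrite E.
rewrite (bigD1 0) //= eqxx addnC (eq_bigr (fun=> 1%N)); last by move=> y /negbTE->.
by rewrite sum1_card cardC1 cardF.
Qed.

(** The first entry x and the trace fix the diagonal; the other two entries have product
x^2 + t x + 1. *)
Lemma card_det1_tr t :
  (\sum_(A : 'M[F]_2 | (\det A == 1%R) && (\tr A == t)) 1
   = 56 + 8 * \sum_(x : F) (x ^+ 2 + t * x + 1 == 0)%R)%N.
Proof.
transitivity (\sum_(x : F) \sum_(y : F) \sum_(z : F | (y * z == x ^+ 2 + t * x + 1)%R) 1)%N.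
  rewrite pair_bigA pair_big_dep /=.
  rewrite (reindex (fun p : F * F * F => mx2 p.1.1 p.1.2 p.2 (t + p.1.1))) /=; last first.
    exists (fun A => (A 0 0, A 0 1, A 1 0)) => [[[x y] z] _|A]; first by rewrite !mxE.
    rewrite inE => /andP[_ /eqP <-].
    by rewrite tr2E [A 0 0 + _]addrC -addrA addxx addr0 -mx2_eta.
  apply: eq_bigl => -[[x y] z] /=.
  rewrite mx2_tr [x + _]addrC -addrA addxx addr0 eqxx andbT mx2_det oppx.
  rewrite -(inj_eq (addrI (y * z))) -[X in X == _]addrC.
  rewrite mulrDr -expr2 (mulrC x) [_ + x ^+ 2]addrC -addrA addxx addr0 eq_sym.
  by rewrite -(inj_eq (addIr 1)) -[in LHS]addrA addxx addr0.
under eq_bigr do rewrite card_mul_eq.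
by rewrite big_split /= sum_nat_const cardF big_distrr.
Qed.

(** An element b other than 0 and 1 is a root of X^7 - 1 = (X - 1) (X^3 + X + 1) (X^3 + X^2 + 1),
whose last factor becomes the middle one at X - 1. *)
Lemma exists_cubic_root : exists a, a ^+ 3 = a + 1.
Proof.
have [b /andP[b0 b1]] : exists b : F, (b != 0) && (b != 1).
  apply/existsP; rewrite -[X in is_true X]negbK negb_exists; apply/negP => /forallP h.
  have : (#|F| <= #|pred2 (0%R : F) 1%R|)%N.
    by apply/subset_leq_card/fintype.subsetP => x _; have := h x; rewrite !inE negb_and !negbK.
  by rewrite cardF card2; case: (_ != _).
(* The product is b^7 - 1 up to an explicit multiple of 2. *)
have : (b - 1) * (b ^+ 3 - b - 1) * ((b - 1) ^+ 3 - (b - 1) - 1) = 0.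
  transitivity (b ^+ 7 - 1 - 2 * (2 * b ^+ 6 - 2 * b ^+ 5 + b ^+ 2 - b)).
    by ring.
  by rewrite expx7 // subrr two0 mul0r subr0.
move/eqP; rewrite -mulrA mulf_eq0 subr_eq0 (negbTE b1) /= mulf_eq0.
by case/orP; rewrite -addrA -opprD subr_eq0 => /eqP h; [exists b | exists (b - 1)].
Qed.

Section CubicRoot.
Variable a : F.
Hypothesis aE : a ^+ 3 = a + 1.

(** The traces of elements of order 9, and those of elements of order 7. *)
Definition traces9 := [:: a; a ^+ 2; a ^+ 4].
Definition traces7 := [:: a + 1; a ^+ 2 + 1; a ^+ 4 + 1].

Lemma a4E : a ^+ 4 = a ^+ 2 + a. Proof. by rewrite exprS aE; ring. Qed.

Lemma frob x y : (x + y) ^+ 2 = x ^+ 2 + y ^+ 2.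
Proof.
transitivity (x ^+ 2 + y ^+ 2 + 2 * (x * y)); first by ring.
by rewrite two0 mul0r addr0.
Qed.

Lemma traces9_root t : t \in traces9 -> t ^+ 3 = t + 1.
Proof.
have frob_root (u : F) : u ^+ 3 = u + 1 -> (u ^+ 2) ^+ 3 = u ^+ 2 + 1.
  by move=> h; rewrite -[in RHS](expr1n _ 2) -frob -h; ring.
rewrite !inE => /or3P[] /eqP->; rewrite ?frob_root //.
have -> : a ^+ 4 = (a ^+ 2) ^+ 2 by rewrite -exprM.
by rewrite !frob_root.
Qed.

Lemma traces7_root t : t \in traces7 -> t ^+ 3 = t ^+ 2 + 1.
Proof.
move=> h; have /traces9_root tE : t + 1 \in traces9.
  by move: h; rewrite !inE => /or3P[] /eqP->; rewrite -addrA addxx addr0 eqxx ?orbT.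
transitivity ((t + 1) ^+ 3 - (t + 1 + 1) + t ^+ 2 + 1 - 2 * (2 * t ^+ 2 + t - 0)).
  by ring.
by rewrite tE subrr two0 mul0r subr0 add0r.
Qed.

Lemma nonzero_root t : t ^+ 3 = t + 1 \/ t ^+ 3 = t ^+ 2 + 1 -> t != 0.
Proof.
by case=> h; apply/eqP => t0; move/eqP: h;
  rewrite t0 !expr0n /= add0r eq_sym oner_eq0.
Qed.

(** A root x in the field is fixed by the eighth power; x^8 is computed by repeated squaring
from x^2 = t x + 1. *)
Lemma root_trace_condition t : t != 0 ->
  (exists x, x ^+ 2 + t * x + 1 == 0) -> t ^+ 6 + t ^+ 4 + 1 = 0.
Proof.
move=> t0 [x]; rewrite -addrA addr_eq0 oppx => /eqP x2.
have x4 : x ^+ 4 = t ^+ 3 * x + t ^+ 2 + 1.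
  rewrite (exprM x 2 2) x2 frob expr1n exprMn x2; ring.
have x8 : x ^+ 8 = t ^+ 7 * x + t ^+ 6 + t ^+ 4 + 1.
  rewrite (exprM x 4 2) x4 !frob expr1n exprMn x2 -!exprM; ring.
move: x8; rewrite expx8 expx7 // mul1r -!addrA => /eqP.
by rewrite -[X in X == _]addr0 (inj_eq (addrI x)) eq_sym => /eqP.
Qed.

Lemma card_trace0 :
  (\sum_(A : 'M[F]_2 | (\det A == 1%R) && (\tr A == 0%R)) 1 = 64)%N.
Proof.
rewrite card_det1_tr (eq_bigr (fun x => (x == 1) : nat)) => [|x _].
  by rewrite (bigD1 1) //= eqxx big1 // => x /negbTE->.
rewrite mul0r addr0 addr_eq0 oppx; congr nat_of_bool.
by rewrite sqrf_eq1 oppx orbb.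
Qed.

Lemma card_trace_irr t : t != 0 -> t ^+ 6 + t ^+ 4 + 1 != 0 ->
  (\sum_(A : 'M[F]_2 | (\det A == 1%R) && (\tr A == t)) 1 = 56)%N.
Proof.
move=> t0 /eqP h; rewrite card_det1_tr big1 // => x _.
by case: eqP => // /eqP r; case: h; apply: root_trace_condition => //; exists x.
Qed.

Lemma split_root t : t ^+ 3 = t ^+ 2 + 1 -> (t ^+ 3) ^+ 2 + t * t ^+ 3 + 1 = 0.
Proof.
move=> h; have t4 : t * t ^+ 3 = t ^+ 3 + t by rewrite {1}h; ring.
have t6 : (t ^+ 3) ^+ 2 = t ^+ 3 + t + 1.
  by rewrite {1}h frob expr1n -t4 -exprM -exprS.
rewrite t6 t4 -!addrA [1 + _]addrC -!addrA addxx addr0.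
by rewrite [t + (_ + t)]addrC -!addrA addxx addr0 addxx.
Qed.

Lemma card_trace_split t : t ^+ 3 = t ^+ 2 + 1 ->
  (\sum_(A : 'M[F]_2 | (\det A == 1%R) && (\tr A == t)) 1 = 72)%N.
Proof.
move=> h; have t0 : t != 0 by apply: nonzero_root; right.
have r := split_root h; set b := t ^+ 3 in r.
have rt x : (x ^+ 2 + t * x + 1 == 0) = (x == b) || (x == b + t).
  have -> : x ^+ 2 + t * x + 1 = (x - b) * (x - (b + t)) + 2 * (t * x + b * x + 1)
       - (b ^+ 2 + t * b + 1) by ring.
  by rewrite two0 mul0r r subr0 addr0 mulf_eq0 !subr_eq0.
have bt : b + t != b by rewrite -[X in _ != X]addr0 (inj_eq (addrI b)).
rewrite card_det1_tr (bigD1 b) //= (bigD1 (b + t) bt) //= big1 => [|x /andP[xb xbt]].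
  by rewrite !rt !eqxx orbT.
by rewrite rt (negbTE xb) (negbTE xbt).
Qed.

(** Nonidentity elements of SL(2,8) of equal trace are conjugate, so that a sum
over the group of a class function reduces to a sum over traces. *)
Lemma sum_by_trace (V : zmodType) (f : 'M[F]_2 -> V) (phi : F -> V) :
  (forall A, \det A = 1 -> A != 1 -> f A = phi (\tr A)) ->
  \sum_(A : 'M[F]_2 | \det A == 1) f A =
    f 1 + phi 0 *+ 63 + (phi 1 + \sum_(t <- traces9) phi t) *+ 56
    + (\sum_(t <- traces7) phi t) *+ 72.
Proof.
move=> fphi; have a0 : a != 0 by apply: nonzero_root; left.
have -> : \sum_(A : 'M[F]_2 | \det A == 1) f A =
    f 1 - phi 0 + \sum_(A : 'M[F]_2 | \det A == 1) phi (\tr A).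
  rewrite (bigD1 1) ?det1 //= [in RHS](bigD1 1) ?det1 //=.
  rewrite mxtrace1 two0 addrA subrK; congr (_ + _).
  by apply: eq_bigr => A /andP[/eqP dA A1]; rewrite fphi.
have sumF (G : F -> V) : \sum_t G t = G 0 + G 1 + \sum_(t <- traces9) G t
    + \sum_(t <- traces7) G t.
  pose s := [:: 0; 1] ++ traces9 ++ traces7.
  have -> : \sum_t G t = \sum_(t <- s) G t.
    have su : uniq s.
      have u9 : uniq traces9.
        have a1 : a != 1.
          by apply/eqP => h; move/eqP: aE; rewrite h expr1n addxx oner_eq0.
        have a2 : a != a ^+ 2 
          by apply/eqP => h; move/eqP: a1; apply; apply: (mulfI a0); rewrite mulr1 -expr2.
        have sqI (u v : F) : u ^+ 2 = v ^+ 2 -> u = v.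
          by move=> h; apply/eqP; rewrite -subr_eq0 -sqrf_eq0 oppx frob h addxx.
        have a24 : a ^+ 2 != a ^+ 4.
          by apply: contra a2 => /eqP; rewrite (exprM a 2 2) => /sqI <-.
        rewrite /= !inE negb_or a2 a24 /= andbT a4E -[X in X != _]add0r (inj_eq (addIr a)).
        by rewrite eq_sym sqrf_eq0.
      have u7 : uniq traces7 by rewrite -[traces7]/(map (+%R^~ 1) traces9) map_inj_uniq //; exact: addIr.
      rewrite !cat_uniq u9 u7 [uniq _]/= inE eq_sym oner_eq0 !andTb andbT; apply/andP; split.
        rewrite has_cat negb_or; apply/andP; split; apply/hasPn => t.
          move/traces9_root => h; rewrite !inE; apply/negP => /orP[] /eqP t01; move/eqP: h;
          by rewrite t01 ?expr0n ?expr1n ?addxx ?add0r /= ?oner_eq0 // eq_sym oner_eq0.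
        move/traces7_root => h; rewrite !inE; apply/negP => /orP[] /eqP t01; move/eqP: h;
        by rewrite t01 ?expr0n ?expr1n ?addxx ?add0r /= ?oner_eq0 // eq_sym oner_eq0.
      apply/hasPn => t /traces7_root h7; apply/negP => /traces9_root h9.
      have := nonzero_root (or_introl h9) => t0.
      have t1 : t = 1.
        apply: (mulfI t0); rewrite mulr1 -expr2; apply: (addIr 1).
        by rewrite -h7 h9.
      by move/eqP: h9; rewrite t1 expr1n addxx oner_eq0.
    rewrite (big_uniq _ su) /=; apply: eq_bigl => t.
    have [||_ ->] := @uniq_min_size _ s (enum F) su; first by move=> x _; rewrite mem_enum.
      by rewrite -cardE cardF.
    by rewrite mem_enum.
  by rewrite !big_cat /= !big_cons big_nil addr0 !addrA.
rewrite (partition_big (fun A => \tr A) xpredT) //=.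
have E t : \sum_(A : 'M[F]_2 | (\det A == 1) && (\tr A == t)) phi (\tr A) =
    phi t *+ (\sum_(A : 'M[F]_2 | (\det A == 1%R) && (\tr A == t)) 1)%N.
  by rewrite sum1_card -sumr_const; apply: eq_big => // A /andP[_ /eqP->].
under eq_bigr do rewrite E.
rewrite sumF card_trace0 card_trace_irr ?oner_eq0 //; last first.
  by rewrite !expr1n -addrA addxx addr0 oner_eq0.
have -> : \sum_(t <- traces9) phi t *+
    (\sum_(A : 'M[F]_2 | (\det A == 1%R) && (\tr A == t)) 1)%N
    = (\sum_(t <- traces9) phi t) *+ 56.
  rewrite -sumrMnl big_seq [RHS]big_seq; apply: eq_bigr => t /traces9_root tE.
  have t0 : t != 0 by apply: nonzero_root; left.
  rewrite card_trace_irr // (_ : _ + 1 = t) //.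
  rewrite (exprM t 3 2) (exprS t 3) tE frob expr1n.
  transitivity (t + 2 * (t ^+ 2 + 1)); first by ring.
  by rewrite two0 mul0r addr0.
have -> : \sum_(t <- traces7) phi t *+
    (\sum_(A : 'M[F]_2 | (\det A == 1%R) && (\tr A == t)) 1)%N
    = (\sum_(t <- traces7) phi t) *+ 72.
  rewrite -sumrMnl big_seq [RHS]big_seq; apply: eq_bigr => t /traces7_root tE.
  by rewrite card_trace_split.
have -> : phi 0 *+ 64 = phi 0 *+ 63 + phi 0 by exact: mulrSr.
rewrite (mulrnDl 56); move: (phi 0 *+ 63) (_ *+ 72) (_ *+ 56) (_ *+ 56) => u v w k.
by rewrite !addrA [f 1 - _ + u]addrAC subrK.
Qed.

End CubicRoot.
End Order8.

(** * Sums of a representation of SL(2,8) over subgroups *)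

Lemma mxtrace_idem (K : fieldType) n (E : 'M[K]_n) : E *m E = E -> \tr E = (\rank E)%:R.
Proof.
move=> EE; rewrite -{1}(mulmx_base E) mxtrace_mulC.
suff -> : row_base E *m col_base E = 1%:M by rewrite mxtrace1.
apply: (row_free_inj (row_base_free E)); apply: (row_full_inj (col_base_full E)).
by rewrite mul1mx -mulmxA mulmx_base mulmxA mulmx_base EE.
Qed.

Section SumsOfRepresentation.
Variables (F : finFieldType) (K : numFieldType) (n : nat) (r : 'M[F]_2 -> 'M[K]_n).
Hypothesis cardF : #|F| = 8%N.
Hypothesis rM : forall A B, \det A = 1 -> \det B = 1 -> r (A *m B) = r A *m r B.

Definition unipotent_sum : 'M[K]_n := \sum_y r (transvection y).

Lemma unipotent_sum_sqr : unipotent_sum *m unipotent_sum = 8 *: unipotent_sum.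
Proof.
rewrite {1}/unipotent_sum mulmx_suml (eq_bigr (fun=> unipotent_sum)) => [|y _].
  by rewrite sumr_const cardF scaler_nat.
rewrite mulmx_sumr [RHS](reindex_inj (addrI y)); apply: eq_bigr => z _.
rewrite -rM ?det_transvection //; congr r.
by rewrite /transvection mx2_mul !mul1r !mul0r !mulr0 !mulr1 !addr0 !add0r (addrC z).
Qed.

(** An eighth of the sum over the subgroup is the projection onto the vectors that it fixes. *)
Lemma unipotent_sum_rank : \tr unipotent_sum = (8 * \rank unipotent_sum)%:R.
Proof.
have E8 : (8 : K) != 0 by rewrite pnatr_eq0.
pose E := 8^-1 *: unipotent_sum.
have EE : E *m E = E.
  by rewrite /E -scalemxAl -scalemxAr unipotent_sum_sqr (scalerA _ 8) mulVf ?scale1r.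
have -> : unipotent_sum = 8 *: E by rewrite scalerA divff ?scale1r.
by rewrite mxtraceZ mxtrace_idem // natrM !mxrank_scale_nz // invr_eq0.
Qed.

Hypothesis tr0 : \tr unipotent_sum = 0.

Lemma unipotent_sum_eq0 : unipotent_sum = 0.
Proof.
move: tr0; rewrite unipotent_sum_rank => /eqP.
by rewrite pnatr_eq0 muln_eq0 /= mxrank_eq0 => /eqP.
Qed.

(** When the unipotent subgroup fixes no vector, its sum is zero, and so is the sum over each
of its cosets. *)
Lemma coset_trace_sum A : \det A = 1 -> \sum_y \tr (r (A *m transvection y)) = 0.
Proof.
move=> dA; transitivity (\tr (r A *m unipotent_sum)).
  rewrite mulmx_sumr linear_sum; apply: eq_bigr => y _.
  by rewrite rM ?det_transvection.
by rewrite unipotent_sum_eq0 mulmx0 mxtrace0.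
Qed.

Lemma group_trace_sum : \sum_(A : 'M[F]_2 | \det A == 1) \tr (r A) = 0.
Proof.
suff S0 : \sum_(A : 'M[F]_2 | \det A == 1) r A = 0 by rewrite -linear_sum S0 linear0.
set S := \sum_(A | _) _; have : unipotent_sum *m S = 8 *: S.
  rewrite mulmx_suml (eq_bigr (fun=> S)) => [|y _].
    by rewrite sumr_const cardF scaler_nat.
  have uT : transvection y \in unitmx by rewrite unitmxE det_transvection unitr1.
  rewrite mulmx_sumr [RHS](reindex_inj (can_inj (mulKmx uT))) /=.
  apply: eq_big => A; first by rewrite det_mulmx det_transvection mul1r.
  by move/eqP => dA; rewrite rM ?det_transvection.
rewrite unipotent_sum_eq0 mul0mx => /esym/eqP.
by rewrite scaler_eq0 pnatr_eq0 => /eqP.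
Qed.
End SumsOfRepresentation.

(** * The characters of SL(2,8) in G2 *)

(** The square norm of g - 1 is 2 n - 2 tr g. *)
Lemma orthogonal_tr_full (R : realType) n (g : 'M[R]_n) :
  g^T *m g = 1%:M -> \tr g = n%:R -> g = 1%:M.
Proof.
move=> og tg; apply/eqP; rewrite -subr_eq0; apply/eqP; set D := g - 1%:M.
have : \tr (D^T *m D) = 0.
  have DT : D^T = g^T - 1%:M by rewrite /D linearB /= trmx1.
  rewrite DT mulmxBl /D !mulmxBr og !mul1mx mulmx1.
  by rewrite !linearB /= mxtrace_tr mxtrace1 tg; ring.
have E : \tr (D^T *m D) = \sum_i \sum_j D j i ^+ 2.
  by apply: eq_bigr => i _; rewrite mxE; apply: eq_bigr => j _; rewrite mxE expr2.
rewrite E => /eqP; rewrite psumr_eq0 => [/allP h|i _]; last by apply: sumr_ge0 => j _; exact: sqr_ge0.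
apply/matrixP => j i; rewrite [RHS]mxE.
have /eqP := h i (mem_index_enum i); rewrite /= => /eqP; rewrite psumr_eq0 => [/allP h'|k _]; last exact: sqr_ge0.
by have := h' j (mem_index_enum j); rewrite /= sqrf_eq0 => /eqP.
Qed.

(** The unknowns are the values of the degree 7 character at the class of order 3 (c) and at the
three classes of order 9 (x, y, z), which squaring permutes cyclically. The hypotheses are
the trace identity at these three classes, and the vanishing of the sums of the two
characters over the group. If c = -2, then x, y, z have sum 3 and square sum 3, hence are
all 1, against the trace identity. *)
Lemma trace_system (R : realFieldType) (c x y z : R) :
  c = 1 \/ c = - 2 ->
  x ^+ 3 - 3 * x * y + 2 * c = 3 * x ^+ 2 + 3 * y + 6 * x ->
  y ^+ 3 - 3 * y * z + 2 * c = 3 * y ^+ 2 + 3 * z + 6 * y ->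
  z ^+ 3 - 3 * z * x + 2 * c = 3 * z ^+ 2 + 3 * x + 6 * z ->
  7 - 63 + 56 * (c + x + y + z) = 0 ->
  14 - 126 + 56 * ((c ^+ 2 - c) / 2 - c + ((x ^+ 2 - y) / 2 - x)
     + ((y ^+ 2 - z) / 2 - y) + ((z ^+ 2 - x) / 2 - z)) = 0 ->
  [/\ c = 1, x ^+ 3 = 3 * x + 1, y = 2 - x ^+ 2, z = 2 - y ^+ 2 & x = 2 - z ^+ 2].
Proof.
case=> -> ex ey ez s7 s14; last first.
  have sq : (x - 1) ^+ 2 + (y - 1) ^+ 2 + (z - 1) ^+ 2 = 0 by nra.
  have x1 : x = 1.
    by apply/eqP; rewrite -subr_eq0 -sqrf_eq0; apply/eqP;
       have := sqr_ge0 (x - 1); have := sqr_ge0 (y - 1); have := sqr_ge0 (z - 1); lra.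
  have y1 : y = 1.
    by apply/eqP; rewrite -subr_eq0 -sqrf_eq0; apply/eqP;
       have := sqr_ge0 (x - 1); have := sqr_ge0 (y - 1); have := sqr_ge0 (z - 1); lra.
  by move: ex; rewrite x1 y1 !expr1n; lra.
have zE : z = - x - y by lra.
have xy : x ^+ 2 + x * y + y ^+ 2 = 3 by move: s14; rewrite zE; nra.
have step (u v w : R) : u ^+ 3 - 3 * u * v + 2 * 1 = 3 * u ^+ 2 + 3 * v + 6 * u ->
    u + v + w = 0 -> u ^+ 2 + u * v + v ^+ 2 = 3 ->
    u ^+ 3 = 3 * u + u * v * w /\ - 3 * (u + 1) * w = 2 + u * v * w.
  move=> h s q; have wE : w = - u - v by lra.
  have u3 : u * (u ^+ 2 + u * v + v ^+ 2) = 3 * u by rewrite q mulrC.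
  have u3' : u ^+ 3 = 3 * u + u * v * w.
    by rewrite -u3 wE; ring.
  split=> //; rewrite wE; move: h; rewrite u3' wE => h.
  have -> : - 3 * (u + 1) * (- u - v) = (3 * u ^+ 2 + 3 * v + 6 * u) - 3 * u + 3 * u * v by ring.
  by rewrite -h; ring.
have yz : y ^+ 2 + y * z + z ^+ 2 = 3 by rewrite -xy zE; ring.
have zx : z ^+ 2 + z * x + x ^+ 2 = 3 by rewrite -xy zE; ring.
have [x3 xz] := step x y z ex ltac:(lra) xy.
have [y3 yx] := step y z x ey ltac:(lra) yz.
have [z3 zy] := step z x y ez ltac:(lra) zx.
have p1 : x * y * z = 1.
  have yx' : - 3 * (y + 1) * x = 2 + x * y * z by rewrite yx; ring.
  have zy' : - 3 * (z + 1) * y = 2 + x * y * z by rewrite zy; ring.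
  have : - 3 * (x + 1) * z + - 3 * (y + 1) * x + - 3 * (z + 1) * y = 9 - 3 * (3 - (x ^+ 2 + x * y + y ^+ 2)).
    by rewrite zE; ring.
  by rewrite xz yx' zy' xy; move: (x * y * z) => p; lra.
have final (u v w : R) : u ^+ 3 = 3 * u + 1 -> u + v + w = 0 -> (u + 1) * w = - 1 -> v = 2 - u ^+ 2.
  move=> u3 s uw; have u1 : u + 1 != 0.
    by apply/eqP => u1; move: uw; rewrite u1 mul0r; lra.
  suff : w = (u + 1) * (u - 2) by move=> wE; move: s; rewrite wE; nra.
  apply: (mulfI u1); rewrite uw.
  have -> : (u + 1) * ((u + 1) * (u - 2)) = u ^+ 3 - 3 * u - 2 by ring.
  by rewrite u3; ring.
have p2 : y * z * x = 1 by rewrite -p1; ring.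
have p3 : z * x * y = 1 by rewrite -p1; ring.
rewrite p1 in x3 xz; rewrite p2 in y3 yx; rewrite p3 in z3 zy.
split=> //; [apply: (final _ _ z) | apply: (final _ _ x) | apply: (final _ _ y)] => //; lra.
Qed.

Section CharacterValues.
Variables (R : realType) (F : finFieldType) (r : 'M[F]_2 -> G2 R).
Hypothesis cardF : #|F| = 8%N.
Hypothesis rM : forall A B, \det A = 1 -> \det B = 1 -> r (A *m B) = (r A * r B)%g.
Hypothesis r_inj : forall A, \det A = 1 -> r A = 1%g -> A = 1%:M.
Variable a : F.
Hypothesis aE : a ^+ 3 = a + 1.

Implicit Types (t y : F) (A B P : 'M[F]_2).

Definition char7 A : R := \tr (G2val (r A)).
Definition char14 A : R := (char7 A ^+ 2 - char7 (A *m A)) / 2 - char7 A.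
Definition phi7 t : R := char7 (companion t).

Lemma G2val_inj : injective (@G2val R). Proof. exact: val_inj. Qed.

Lemma G2val_rM A B : \det A = 1 -> \det B = 1 ->
  G2val (r (A *m B)) = G2val (r A) *m G2val (r B).
Proof. by move=> dA dB; rewrite rM. Qed.

Lemma r1 : r 1%:M = 1%g.
Proof. by apply: (mulIg (r 1%:M)); rewrite -rM ?det1 // mulmx1 mul1g. Qed.

Lemma char7_1 : char7 1%:M = 7.
Proof. by rewrite /char7 r1 mxtrace1. Qed.

Lemma char7_conj P A B : \det P = 1 -> \det A = 1 -> \det B = 1 ->
  P *m A = B *m P -> char7 A = char7 B.
Proof.
move=> dP dA dB PA; have /asboolP[uP _] := G2P (r P).
have : G2val (r P) *m G2val (r A) = G2val (r B) *m G2val (r P).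
  by rewrite -!G2val_rM // PA.
move=> /(canRL (mulKmx uP)) E.
by rewrite /char7 E mxtrace_mulC mulmxK.
Qed.

Lemma char7_phi A : \det A = 1 -> A != 1 -> char7 A = phi7 (\tr A).
Proof.
move=> dA A1; have [P [dP PA]] := conj_companion cardF dA A1.
by apply: (char7_conj dP) => //; rewrite det_companion.
Qed.

Lemma G2_char7_identity A : \det A = 1 ->
  char7 A ^+ 3 - 3 * char7 A * char7 (A *m A) + 2 * char7 (A *m A *m A)
    = 3 * char7 A ^+ 2 + 3 * char7 (A *m A) + 6 * char7 A.
Proof.
move=> dA; have /asboolP/G2_trace_identity := G2P (r A).
by rewrite -!G2val_rM // det_mulmx dA mulr1.
Qed.

Lemma char7_neq7 A : \det A = 1 -> A != 1 -> char7 A != 7.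
Proof.
move=> dA; apply: contra => /eqP c7; apply/eqP/r_inj => //.
have /asboolP Gg := G2P (r A).
by apply: G2val_inj; rewrite /= (orthogonal_tr_full (g_orthogonal Gg)).
Qed.

Lemma companion2 t : companion t *m companion t = mx2 1 t t (1 + t ^+ 2).
Proof. by rewrite /companion mx2_mul; congr mx2; ring. Qed.
Lemma companion3 t : companion t *m companion t *m companion t =
  mx2 t (1 + t ^+ 2) (1 + t ^+ 2) (t + t + t ^+ 3).
Proof. by rewrite companion2 mx2_mul; congr mx2; ring. Qed.

Lemma transvection_neq1 (y : F) : y != 0 -> transvection y != 1.
Proof.
by move=> y0; apply/eqP => /matrixP/(_ 0 1)/eqP; rewrite !mxE /= (negbTE y0).
Qed.

Lemma sum_transvection (V : nmodType) (f : 'M[F]_2 -> V) v : 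
  (forall y, y != 0 -> f (transvection y) = v) -> \sum_y f (transvection y) = f 1%:M + v *+ 7.
Proof.
move=> fv; rewrite (bigD1 0) //= (_ : transvection (0 : F) = 1%:M); last by rewrite mx2_1.
by rewrite (eq_bigr (fun=> v)) ?sumr_const ?cardC1 ?cardF.
Qed.

(** The trace identity leaves the values -1 and -3 at an involution. With -3, the sum of the
traces over a subgroup of order 8 would be 7 - 21, but it is 8 times a dimension. *)
Lemma phi7_0 : phi7 0 = -1.
Proof.
have C0 : companion (0 : F) *m companion 0 = 1%:M.
  by rewrite companion2 mx2_1 expr0n addr0.
have dC := det_companion cardF 0.
have := G2_char7_identity dC; rewrite C0 mul1mx char7_1 -/(phi7 0).
have := char7_neq7 dC (companion_neq1 0); rewrite -/(phi7 0) => n7 e3.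
have : (phi7 0 - 7) * ((phi7 0 + 1) * (phi7 0 + 3)) = 0 by move: (phi7 0) e3 => x; nra.
move/eqP; rewrite mulf_eq0 subr_eq0 (negbTE n7) /= mulf_eq0 !addr_eq0.
case/orP => /eqP // p3; exfalso.
have := unipotent_sum_rank cardF G2val_rM.
have c3 y : y != 0 -> char7 (transvection y) = - 3.
  move=> y0; rewrite char7_phi ?det_transvection ?transvection_neq1 //.
  by rewrite mx2_tr addxx // p3.
rewrite /unipotent_sum linear_sum /= (sum_transvection c3) char7_1 => h.
have : (0 : R) <= 7 + (- 3) *+ 7 by rewrite h ler0n.
by rewrite -mulr_natr; lra.
Qed.

Lemma char7_transvection y : y != 0 -> char7 (transvection y) = - 1.
Proof.
move=> y0; rewrite char7_phi ?det_transvection ?transvection_neq1 //.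
by rewrite mx2_tr addxx // phi7_0.
Qed.

Lemma tr_unipotent_sum7 : \tr (unipotent_sum (fun A => G2val (r A))) = 0.
Proof.
rewrite /unipotent_sum linear_sum /= (sum_transvection char7_transvection).
by rewrite char7_1 -mulr_natr; ring.
Qed.

(** A diagonal matrix of trace t and its products with the transvections all have trace t, so
the vanishing sum over this coset is 8 times the value. *)
Lemma phi7_split t : t ^+ 3 = t ^+ 2 + 1 -> phi7 t = 0.
Proof.
move=> tE; have t0 : t != 0 by apply: nonzero_root; right.
(* The roots of X^2 + t X + 1 are t^3 and t^3 + t, and A has these eigenvalues. *)
pose b := t ^+ 3; pose A := mx2 b 0 0 (b + t).
have dA : \det A = 1.
  rewrite mx2_det mulr0 subr0 mulrDr -expr2 (mulrC b t); apply/eqP.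
  by rewrite -subr_eq0 oppx // split_root.
have := coset_trace_sum cardF G2val_rM tr_unipotent_sum7 dA.
rewrite (eq_bigr (fun=> phi7 t)) => [|y _].
  by rewrite sumr_const cardF => /eqP; rewrite mulrn_eq0 /= => /eqP.
have tA : \tr (A *m transvection y) = t.
  by rewrite mx2_mul mx2_tr !mulr0 !mul0r mulr1 add0r addr0 mulr1 addrA addxx // add0r.
rewrite -/(char7 _) char7_phi ?tA // ?det_mulmx ?dA ?det_transvection ?mulr1 //.
by apply: contraNneq t0 => A1; rewrite -tA A1 mxtrace1 two0.
Qed.

Lemma char14E A : \det A = 1 -> \tr (rho2 (r A)) = (char14 A)%:C.
Proof. by move=> dA; rewrite tr_rho2 -G2val_rM. Qed.

Lemma rho2_rM A B : \det A = 1 -> \det B = 1 ->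
  rho2 (r (A *m B)) = rho2 (r A) *m rho2 (r B).
Proof. by move=> dA dB; rewrite rM // rho2_M. Qed.

Lemma transvection2 y : transvection y *m transvection y = 1%:M.
Proof.
by rewrite mx2_mul mx2_1 !mul0r !mulr0 !mul1r mulr1 !addr0 addxx // add0r.
Qed.

Lemma char14_transvection y : y != 0 -> char14 (transvection y) = - 2.
Proof.
by move=> y0; rewrite /char14 transvection2 char7_transvection // char7_1; lra.
Qed.

Lemma char14_1 : char14 1%:M = 14.
Proof. by rewrite /char14 mulmx1 char7_1; lra. Qed.

Lemma tr_unipotent_sum14 : \tr (unipotent_sum (fun A => rho2 (r A))) = 0.
Proof.
rewrite /unipotent_sum linear_sum /=.
transitivity ((\sum_y char14 (transvection y))%:C).
  by rewrite rmorph_sum /=; apply: eq_bigr => y _; rewrite char14E ?det_transvection.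
rewrite (sum_transvection char14_transvection) char14_1 -mulr_natr.
by rewrite [X in X%:C](_ : _ = 0) //; ring.
Qed.

Lemma sum_char7 : \sum_(A : 'M[F]_2 | \det A == 1) char7 A = 0.
Proof. exact: group_trace_sum cardF G2val_rM tr_unipotent_sum7. Qed.

Lemma sum_char14 : \sum_(A : 'M[F]_2 | \det A == 1) char14 A = 0.
Proof.
have := group_trace_sum cardF rho2_rM tr_unipotent_sum14.
rewrite (eq_bigr (fun A => (char14 A)%:C)) => [|A /eqP dA]; last exact: char14E.
by rewrite -rmorph_sum => /(congr1 (@complex.Re R)).
Qed.

Definition phi14 t : R := char14 (companion t).

Lemma phi7_2 t : t != 0 -> char7 (companion t *m companion t) = phi7 (t ^+ 2).
Proof.
move=> t0; have tr2 : \tr (companion t *m companion t) = t ^+ 2.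
  by rewrite companion2 mx2_tr addrA addxx // add0r.
rewrite char7_phi ?tr2 // ?det_mulmx ?det_companion ?mulr1 //.
apply: contraNneq t0 => C1; rewrite -sqrf_eq0 -tr2 C1 mxtrace1; exact/eqP/two0.
Qed.

Lemma phi7_3 t : t + t ^+ 3 != 0 ->
  char7 (companion t *m companion t *m companion t) = phi7 (t + t ^+ 3).
Proof.
move=> t0; have tr3 : \tr (companion t *m companion t *m companion t) = t + t ^+ 3.
  by rewrite companion3 mx2_tr !addrA addxx // add0r.
rewrite char7_phi ?tr3 // ?det_mulmx ?det_companion ?mulr1 //.
by apply: contraNneq t0 => C1; rewrite -tr3 C1 mxtrace1; exact/eqP/two0.
Qed.

Lemma char14_phi A : \det A = 1 -> A != 1 -> char14 A = phi14 (\tr A).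
Proof.
move=> dA A1; have [P [dP PA]] := conj_companion cardF dA A1.
have dC := det_companion cardF (\tr A).
rewrite /phi14 /char14 (char7_conj dP dA dC PA); congr ((_ - _) / _ - _).
move: PA; rewrite -!mulmxE => PA.
apply: (char7_conj dP); rewrite ?det_mulmx ?dA ?dC ?mulr1 //.
by rewrite mulmxA PA -mulmxA PA mulmxA.
Qed.

Lemma phi14_0 : phi14 0 = - 2.
Proof.
rewrite /phi14 /char14 companion2 expr0n addr0 -mx2_1 char7_1 -/(phi7 0) phi7_0.
by lra.
Qed.

Lemma phi14E t : t != 0 -> phi14 t = (phi7 t ^+ 2 - phi7 (t ^+ 2)) / 2 - phi7 t.
Proof. by move=> t0; rewrite /phi14 /char14 phi7_2. Qed.

Lemma identity_phi t : t != 0 -> t + t ^+ 3 != 0 ->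
  phi7 t ^+ 3 - 3 * phi7 t * phi7 (t ^+ 2) + 2 * phi7 (t + t ^+ 3)
    = 3 * phi7 t ^+ 2 + 3 * phi7 (t ^+ 2) + 6 * phi7 t.
Proof.
move=> t0 t3; rewrite -(phi7_3 t3) -(phi7_2 t0).
exact/G2_char7_identity/det_companion.
Qed.

(** The trace identity at an element of order 3. *)
Lemma phi7_1 : phi7 1 = 1 \/ phi7 1 = - 2.
Proof.
have dC := det_companion cardF (1 : F).
have C3 : companion (1 : F) *m companion 1 *m companion 1 = 1%:M.
  by rewrite companion3 mx2_1 expr1n addxx // !expr1n add0r.
have := G2_char7_identity dC; rewrite C3 char7_1 phi7_2 ?oner_eq0 // expr1n -/(phi7 1).
have := char7_neq7 dC (companion_neq1 1); rewrite -/(phi7 1) => n7 e3.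
have : (phi7 1 - 7) * ((phi7 1 - 1) * (phi7 1 + 2)) = 0 by move: (phi7 1) e3 => x; nra.
move/eqP; rewrite mulf_eq0 subr_eq0 (negbTE n7) /= mulf_eq0 subr_eq0 addr_eq0.
by case/orP => /eqP; [left | right].
Qed.

Lemma traces7_0 : {in traces7 a, forall t, phi7 t = 0}.
Proof. by move=> t /(traces7_root cardF aE); exact: phi7_split. Qed.

Lemma order9_identity t : t \in traces9 a ->
  phi7 t ^+ 3 - 3 * phi7 t * phi7 (t ^+ 2) + 2 * phi7 1
    = 3 * phi7 t ^+ 2 + 3 * phi7 (t ^+ 2) + 6 * phi7 t.
Proof.
move=> /(traces9_root cardF aE) tE.
have t1 : t + t ^+ 3 = 1 by rewrite tE addrA addxx // add0r.
have t0 : t != 0 by apply: nonzero_root; left.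
by have := identity_phi t0; rewrite t1 oner_eq0 => /(_ isT).
Qed.

Lemma phi14_split : {in traces7 a, forall t, phi14 t = 0}.
Proof.
move=> t /(traces7_root cardF aE) tE; have t0 : t != 0 by apply: nonzero_root; right.
rewrite phi14E // !phi7_split //; first by lra.
by rewrite -[in RHS](expr1n _ 2) -(frob cardF) -tE; ring.
Qed.

(** Every embedding has the same characters up to the cyclic permutation of the three
classes of order 9. *)
Lemma character_values :
  [/\ phi7 1 = 1,
      phi7 a ^+ 3 = 3 * phi7 a + 1,
      phi7 (a ^+ 2) = 2 - phi7 a ^+ 2,
      phi7 (a ^+ 4) = 2 - phi7 (a ^+ 2) ^+ 2 &
      phi7 a = 2 - phi7 (a ^+ 4) ^+ 2].
Proof.
have m9 : [/\ a \in traces9 a, a ^+ 2 \in traces9 a & a ^+ 4 \in traces9 a].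
  by rewrite !inE !eqxx ?orbT.
have [/order9_identity ex /order9_identity ey /order9_identity ez] := m9.
have a22 : (a ^+ 2) ^+ 2 = a ^+ 4 by rewrite -exprM.
have a42 : (a ^+ 4) ^+ 2 = a by rewrite -exprM; exact: expx8.
have a0 : a != 0 by apply: nonzero_root; left.
have s7 : 7 - 63 + 56 * (phi7 1 + phi7 a + phi7 (a ^+ 2) + phi7 (a ^+ 4)) = 0.
  have := sum_char7; rewrite (sum_by_trace cardF aE char7_phi) char7_1 phi7_0.
  rewrite [X in X *+ 72]big1_seq => [|t /andP[_ /traces7_0] //].
  rewrite !big_cons big_nil addr0 mul0rn addr0 -[X in _ + X + _]mulr_natr -[X in _ + X]mulr_natr.
  by move=> <-; ring.
have s14 : 14 - 126 + 56 * (phi14 1 + phi14 a + phi14 (a ^+ 2) + phi14 (a ^+ 4)) = 0.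
  have := sum_char14; rewrite (sum_by_trace cardF aE char14_phi) char14_1 phi14_0.
  rewrite [X in X *+ 72]big1_seq => [|t /andP[_ /phi14_split] //].
  rewrite !big_cons big_nil addr0 mul0rn addr0 -[X in _ + X + _]mulr_natr -[X in _ + X]mulr_natr.
  by move=> <-; ring.
move: s14; rewrite !phi14E ?oner_eq0 ?expf_neq0 // expr1n a22 a42.
move: ex ey ez; rewrite a22 a42.
move=> ex ey ez s14; have c1 := phi7_1.
exact: (trace_system c1 ex ey ez s7 s14).
Qed.

Lemma character_moments (m n : nat) :
  \sum_(A : 'M[F]_2 | \det A == 1) char7 A ^+ m * char14 A ^+ n =
    7 ^+ m * 14 ^+ n + 63 * ((- 1) ^+ m * (- 2) ^+ n) + 56 * (- 1) ^+ n
    + 56 * (\sum_(x <- [:: phi7 a; phi7 (a ^+ 2); phi7 (a ^+ 4)]) x ^+ m * (x ^+ 2 - x - 1) ^+ n)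
    + 216 * (0 ^+ m * 0 ^+ n).
Proof.
have [c xE yE zE x'E] := character_values.
have a22 : (a ^+ 2) ^+ 2 = a ^+ 4 by rewrite -exprM.
have a42 : (a ^+ 4) ^+ 2 = a by rewrite -exprM; exact: expx8.
have a0 : a != 0 by apply: nonzero_root; left.
rewrite (@sum_by_trace _ cardF a aE _ _ (fun t => phi7 t ^+ m * phi14 t ^+ n)); last first.
  by move=> A dA A1; rewrite char7_phi // char14_phi.
rewrite char7_1 char14_1 phi7_0 phi14_0 phi14E ?oner_eq0 // expr1n c.
rewrite !big_cons !big_nil !addr0 (phi14E a0) (phi14E (expf_neq0 2 a0)) (phi14E (expf_neq0 4 a0)).
rewrite a22 a42.
have m7 : [/\ a + 1 \in traces7 a, a ^+ 2 + 1 \in traces7 a & a ^+ 4 + 1 \in traces7 a].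
  by rewrite !inE !eqxx ?orbT.
have [/[dup] /traces7_0-> /phi14_split-> /[dup] /traces7_0-> /phi14_split->
  /[dup] /traces7_0-> /phi14_split->] := m7.
have e1 : (1 ^+ 2 - 1) / 2 - 1 = - 1 :> R by lra.
have e (x y : R) : y = 2 - x ^+ 2 -> (x ^+ 2 - y) / 2 - x = x ^+ 2 - x - 1 :> R by lra.
rewrite e1 (e _ _ yE) (e _ _ zE) (e _ _ x'E).
rewrite expr1n mul1r.
set u := (7 ^+ m * _); set v := ((-1) ^+ m * _); set w := (-1) ^+ n; set w0 := (0 ^+ m * _).
set x := (phi7 a ^+ m * _); set y := (phi7 (a ^+ 2) ^+ m * _); set z := (phi7 (a ^+ 4) ^+ m * _).
move: u v w w0 x y z => u v w w0 x y z.
rewrite -[X in _ + X + _ + _]mulr_natr -[X in _ + _ + X + _]mulr_natr -[X in _ + _ + _ + X]mulr_natr.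
by ring.
Qed.

End CharacterValues.

(** * Moments of the McKay graphs *)

Section McKayMoments.
Variables (R : realType) (gT : finGroupType) (G : {group gT}).
Local Notation K := R[i].
Local Notation irrK := (irrG R G).

Lemma pchar'G : ([pchar K]^'.-group G)%g.
Proof. by apply/pgroupP => p _ _; rewrite inE /= pchar_num. Qed.

Definition irr_char (i : irrK) x : K := \tr (irr_repr i x).

(** Each isotypic component contributes its multiplicity times an irreducible character. *)
Lemma trace_irr_mult n (rG : mx_representation K G n) x : x \in G ->
  \tr (rG x) = \sum_(i : irrK) (irr_mult rG i)%:R * irr_char i x.
Proof.
move=> Gx; pose sG : socleType rG := DecSocleType rG.
have S1 : (Socle sG :=: 1%:M)%MS.
  by rewrite reducible_Socle1 //; apply: mx_Maschke_pchar; exact: pchar'G.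
rewrite -(mxtrace_submod1 (Socle_module sG) S1) // mxtrace_Socle //.
rewrite (partition_big (fun W : sG => irr_comp irrK (socle_repr W)) xpredT) //=.
apply: eq_bigr => i _; rewrite /irr_mult natr_sum mulr_suml; apply: eq_bigr => W /eqP Wi.
rewrite mulr_natl; congr (_ *+ _); rewrite /irr_char -Wi.
have rs := rsim_irr_comp_pchar irrK pchar'G (socle_irr W).
exact: mxtrace_rsim rs x Gx.
Qed.

Lemma mckay_char n (rG : mx_representation K G n) (i : 'I_#|irrK|) x : x \in G ->
  \sum_j mckay rG i j * irr_char (enum_val j) x = irr_char (enum_val i) x * \tr (rG x).
Proof.
move=> Gx; have := trace_irr_mult (prod_repr (irr_repr (enum_val i : irrK)) rG) Gx.
rewrite /= mxtrace_prod => ->; rewrite [RHS](reindex (fun j : 'I_#|irrK| => enum_val j)) /=; last first.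
  exact/onW_bij/enum_val_bij.
by apply: eq_bigr => j _; rewrite mxE.
Qed.

(** The values at x of the irreducible characters form a common eigenvector of the McKay
matrices, with eigenvalues the traces at x. *)
Lemma mckay_pow_char n1 n2 (r1 : mx_representation K G n1) (r2 : mx_representation K G n2)
    p q (i : 'I_#|irrK|) x : x \in G ->
  \sum_j (mckay r1 ^+ p *m mckay r2 ^+ q) i j * irr_char (enum_val j) x
    = irr_char (enum_val i) x * \tr (r1 x) ^+ p * \tr (r2 x) ^+ q.
Proof.
move=> Gx; pose c : 'cV[K]_#|irrK| := \col_j irr_char (enum_val j) x.
have mc n (rG : mx_representation K G n) : mckay rG *m c = \tr (rG x) *: c.
  apply/colP => k; rewrite mxE [RHS]mxE [c k 0]mxE mulrC -mckay_char //.
  by apply: eq_bigr => j _; rewrite [c j 0]mxE.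
have mck n (rG : mx_representation K G n) k : mckay rG ^+ k *m c = \tr (rG x) ^+ k *: c.
  elim: k => [|k IHk]; first by rewrite !expr0 mul1mx scale1r.
  by rewrite exprS -mulmxE -mulmxA IHk -scalemxAr mc scalerA -exprSr.
have /colP/(_ i) : mckay r1 ^+ p *m mckay r2 ^+ q *m c = (\tr (r2 x) ^+ q * \tr (r1 x) ^+ p) *: c.
  by rewrite -mulmxA mck -scalemxAr mck scalerA.
rewrite mxE [RHS]mxE [c i 0]mxE => E; rewrite -mulrA [X in _ = _ * X]mulrC [RHS]mulrC -E.
by apply: eq_bigr => j _; rewrite [c j 0]mxE.
Qed.

(** The sum over the group lies in the trivial component of the group algebra, which acts by
zero in the other irreducible representations. *)
Lemma sum_irr_char (i : irrK) : 
  \sum_(x in G) irr_char i x = (#|G| * (i == principal_comp irrK))%:R.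
Proof.
have [->|i1] := eqVneq i (principal_comp irrK).
  rewrite muln1 -sum1_card natr_sum; apply: eq_bigr => x Gx.
  by rewrite /irr_char irr1_repr // mxtrace1 degree_irr1.
rewrite muln0 -linear_sum.
suff -> : \sum_(x in G) irr_repr i x = 0 by rewrite linear0.
transitivity (gring_op (irr_repr i) (gset_mx K G G)).
  rewrite /gset_mx linear_sum; apply: eq_bigr => x Gx.
  exact/esym/gring_opG.
rewrite eq_sym in i1; apply: (irr_repr'_op0_pchar pchar'G i1).
have gG : (gset_mx K G G \in enveloping_algebra_mx (regular_repr K G))%MS.
  apply/envelop_mxP; exists (fun x => (x \in G)%:R); rewrite /gset_mx.
  by apply: eq_bigr => x Gx; rewrite Gx scale1r.
by rewrite genmxE -(gring_rowK gG) mem_gring_mx irr1_rfix rfix_regular.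
Qed.

Lemma mxtrace_reprJ n (rG : mx_representation K G n) :
  {in G &, forall x y, \tr (rG (x ^ y)%g) = \tr (rG x)}.
Proof.
move=> x y Gx Gy; rewrite conjgE !repr_mxM ?groupM ?groupV //.
by rewrite mxtrace_mulC -mulmxA -repr_mxM ?groupV // mulgV repr_mx1 mulmx1.
Qed.

(** Summing the eigenvector equation over the group leaves only the coefficient of the trivial
representation. *)
Lemma mckay_moments n1 n2 (r1 : mx_representation K G n1) (r2 : mx_representation K G n2) p q :
  (mckay r1 ^+ p *m mckay r2 ^+ q) (triv R G) (triv R G)
   = \sum_(C in classes G) (#|C|%:R / #|G|%:R) * \tr (r1 (repr C)) ^+ p * \tr (r2 (repr C)) ^+ q.
Proof.
have nG : #|G|%:R != 0 :> K by rewrite pnatr_eq0 -lt0n cardG_gt0.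
pose f x := \tr (r1 x) ^+ p * \tr (r2 x) ^+ q.
have fJ : {in G &, forall x y, f (x ^ y)%g = f x}.
  by move=> x y Gx Gy; rewrite /f !mxtrace_reprJ.
transitivity ((\sum_(x in G) f x) / #|G|%:R); last first.
  rewrite (sum_by_classes fJ) mulr_suml; apply: eq_bigr => C _.
  by rewrite /f -!mulrA; congr (_ * _); rewrite [RHS]mulrC -mulrA.
apply: (canRL (mulfK nG)).
set M := _ *m _; transitivity (\sum_(x in G) \sum_j M (triv R G) j * irr_char (enum_val j) x).
  rewrite exchange_big (bigD1 (triv R G)) //= [X in _ + X]big1 => [|j jt].
    by rewrite addr0 -mulr_sumr sum_irr_char enum_rankK eqxx muln1.
  rewrite -mulr_sumr sum_irr_char (_ : (_ == _) = false) ?muln0 ?mulr0 //.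
  apply: contraNF jt => /eqP jt; by rewrite /triv -jt enum_valK.
apply: eq_bigr => x Gx; rewrite mckay_pow_char // /triv enum_rankK.
by rewrite /irr_char irr1_repr // mxtrace1 degree_irr1 mul1r.
Qed.
End McKayMoments.

(** * From PSL(2,8) to SL(2,8) *)

Section ProjectiveGroup.
Variables (F : finFieldType).
Hypothesis cardF : #|F| = 8%N.
Implicit Types (A B : 'M[F]_2).

Definition gl_of A : {'GL_2[F]} := insubd (1%g : {'GL_2[F]}) A.
Definition psl_of A : coset_of 'Z(SL2 F)%g := coset 'Z(SL2 F)%g (gl_of A).

Lemma gl_ofK A : \det A = 1 -> GLval (gl_of A) = A.
Proof.
by move=> dA; apply: insubdK; rewrite -topredE /= -[_ \is a _]/(A \in unitmx) unitmxE dA unitr1.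
Qed.

Lemma mem_SL2 (g : {'GL_2[F]}) : (g \in SL2 F) = (\det (GLval g) == 1).
Proof. by rewrite inE. Qed.

Lemma gl_of_SL2 A : \det A = 1 -> gl_of A \in SL2 F.
Proof. by move=> dA; rewrite mem_SL2 gl_ofK // dA. Qed.

(** Commuting with the two elementary transvections forces a scalar matrix, whose square is 1,
hence the identity in characteristic 2. *)
Lemma center_SL2 : 'Z(SL2 F)%g = 1%g.
Proof.
apply/trivgP/fintype.subsetP => g /centerP[]; rewrite mem_SL2 => /eqP dg cg; rewrite inE.
have comm A : \det A = 1 -> GLval g *m A = A *m GLval g.
  move=> dA; have E : commute g (gl_of A) := cg _ (gl_of_SL2 dA).
  by rewrite -(gl_ofK dA) -!GL_MxE E.
apply/eqP/val_inj => /=; change (GLval g = 1%:M); move: (GLval g) dg comm => A; rewrite (mx2_eta A).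
move: (A 0 0) (A 0 1) (A 1 0) (A 1 1) => x y z w; rewrite mx2_det => dg comm.
have := comm (mx2 1 1 0 1); rewrite mx2_det mulr0 subr0 mulr1 => /(_ erefl).
have := comm (mx2 1 0 1 1); rewrite mx2_det mul0r subr0 mulr1 => /(_ erefl).
rewrite !mx2_mul ?mulr1 ?mul1r ?mulr0 ?mul0r ?addr0 ?add0r => /matrixP lo /matrixP up.
have := up 0 0; rewrite !mxE /= => /eqP; rewrite -[X in X == _]addr0 (inj_eq (addrI x)) => /eqP z0.
have := up 0 1; rewrite !mxE /= addrC => /addrI xw.
have := lo 0 0; rewrite !mxE /= => /eqP; rewrite -[X in _ == X]addr0 (inj_eq (addrI x)) => /eqP y0.
move: dg; rewrite y0 -z0 -xw mul0r subr0 -expr2 => /eqP.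
by rewrite sqrf_eq1 oppx // orbb => /eqP->; rewrite mx2_1.
Qed.

Lemma gl_ofM A B : \det A = 1 -> \det B = 1 -> gl_of (A *m B) = (gl_of A * gl_of B)%g.
Proof.
move=> dA dB; apply: val_inj.
change (GLval (gl_of (A *m B)) = GLval (gl_of A) *m GLval (gl_of B)).
by rewrite !gl_ofK // det_mulmx dA dB mulr1.
Qed.

Lemma SL2_norm : SL2 F \subset 'N('Z(SL2 F))%g.
Proof. exact: gFnorm. Qed.

Lemma psl_ofM A B : \det A = 1 -> \det B = 1 -> psl_of (A *m B) = (psl_of A * psl_of B)%g.
Proof.
move=> dA dB; rewrite /psl_of gl_ofM //.
by apply: morphM; apply: (fintype.subsetP SL2_norm); exact: gl_of_SL2.
Qed.

Lemma psl_of_inj A B : \det A = 1 -> \det B = 1 -> psl_of A = psl_of B -> A = B.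
Proof.
move=> dA dB.
have inj : ('injm (coset 'Z(SL2 F)%g))%g by rewrite ker_coset /= center_SL2.
move=> /(injmP inj) E; rewrite -(gl_ofK dA) -(gl_ofK dB) E //;
  by apply: (fintype.subsetP SL2_norm); exact: gl_of_SL2.
Qed.

Lemma psl_of_mem A : \det A = 1 -> psl_of A \in PSL2 F.
Proof. by move=> dA; apply: mem_quotient; exact: gl_of_SL2. Qed.

Lemma sum_PSL2 (V : nmodType) (f : coset_of 'Z(SL2 F)%g -> V) :
  \sum_(x in PSL2 F) f x = \sum_(A : 'M[F]_2 | \det A == 1) f (psl_of A).
Proof.
have -> : \sum_(x in PSL2 F) f x = \sum_(x in imset psl_of (mem [pred A | \det A == 1])) f x.
  apply: eq_bigl => x; apply/idP/imsetP => [|[A dA ->]]; last exact/psl_of_mem/eqP.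
  case/morphimP => g _ gS ->; exists (GLval g); first by rewrite inE -mem_SL2.
  congr coset; apply: val_inj; apply/esym/gl_ofK/eqP; by rewrite -mem_SL2.
rewrite big_imset //= => A B; rewrite !inE => /eqP dA /eqP dB; exact: psl_of_inj.
Qed.

Lemma card_PSL2 : #|PSL2 F| = 504%N.
Proof.
have [a aE] := exists_cubic_root cardF.
rewrite -sum1_card sum_PSL2; apply/eqP; rewrite -(@eqr_nat int) natr_sum.
rewrite (sum_by_trace cardF aE (phi := fun=> 1)) //.
by rewrite !big_cons !big_nil.
Qed.

Variables (R : realType) (iota : embedding R (PSL2 F)).

Definition r_of A : G2 R := iota (psl_of A).

Lemma r_ofM A B : \det A = 1 -> \det B = 1 -> r_of (A *m B) = (r_of A * r_of B)%g.
Proof. by move=> dA dB; rewrite /r_of psl_ofM // embM ?psl_of_mem. Qed.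

Lemma r_of_inj A : \det A = 1 -> r_of A = 1%g -> A = 1%:M.
Proof.
move=> dA rA; apply: psl_of_inj; rewrite ?det1 //.
apply: (emb_inj (e := iota)); rewrite ?psl_of_mem ?det1 //.
rewrite -/(r_of A) rA; apply: (mulgI (r_of 1%:M)).
by rewrite mulg1 -r_ofM ?det1 // mulmx1.
Qed.

Lemma class_moments (m n : nat) :
  \sum_(C in classes (PSL2 F)) (#|C|%:R / #|PSL2 F|%:R)
     * \tr (varrho1 iota (repr C)) ^+ m * \tr (varrho2 iota (repr C)) ^+ n
  = ((\sum_(A : 'M[F]_2 | \det A == 1) char7 r_of A ^+ m * char14 r_of A ^+ n) / 504)%:C.
Proof.
pose f (x : coset_of 'Z(SL2 F)%g) : R[i] := \tr (varrho1 iota x) ^+ m * \tr (varrho2 iota x) ^+ n.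
have fJ : {in PSL2 F &, forall x y, f (x ^ y)%g = f x}.
  by move=> x y Gx Gy; rewrite /f !mxtrace_reprJ.
transitivity ((\sum_(x in PSL2 F) f x) / 504).
  rewrite (sum_by_classes fJ) mulr_suml; apply: eq_bigr => C _.
  rewrite card_PSL2 /f -!mulrA; congr (_ * _).
  by rewrite mulrC -mulrA.
rewrite sum_PSL2 rmorphM fmorphV rmorph_nat rmorph_sum; congr (_ / _).
apply: eq_bigr => A /eqP dA.
by rewrite rmorphM !rmorphXn /= -(char14E r_ofM dA) /f /= /rho1 trace_map_mx.
Qed.
End ProjectiveGroup.

(** * The torus, its monomials and the fundamental characters *)

Section CircleGroup.
Variable R : realType.
Implicit Types (w : circle R) (x y t : R) (k l : int).

Lemma circle_inj w w' : cval w = cval w' -> w = w'.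
Proof. exact: val_inj. Qed.

Lemma cval_neq0 w : cval w != 0.
Proof. by rewrite -normr_eq0 (eqP (circleP w)) oner_eq0. Qed.

Lemma e2piD x y : cval (e2pi (x + y)) = cval (e2pi x) * cval (e2pi y).
Proof.
rewrite /= mulrDr cosD sinD; apply/eqP; rewrite eq_complex /=.
by rewrite eqxx /= [X in _ == X + _]mulrC [X in _ == _ + X]mulrC addrC; apply/eqP; congr (_ + _); rewrite mulrC.
Qed.

Lemma e2pi0 : cval (e2pi (0 : R)) = 1.
Proof. by rewrite /= mulr0 cos0 sin0. Qed.

Lemma e2piN x : cval (e2pi (- x)) = (cval (e2pi x))^-1.
Proof.
by apply: (mulfI (cval_neq0 (e2pi x))); rewrite -e2piD subrr e2pi0 mulfV // cval_neq0.
Qed.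

Lemma e2pi1 : cval (e2pi (1 : R)) = 1.
Proof. by rewrite /= mulr1 mulr_natl cos2pi sin2pi. Qed.

Lemma e2piMn x (n : nat) : cval (e2pi (n%:R * x)) = cval (e2pi x) ^+ n.
Proof.
elim: n => [|n IHn]; first by rewrite mul0r e2pi0 expr0.
by rewrite -natr1 mulrDl mul1r e2piD IHn exprSr.
Qed.

Lemma e2piMz x k : cval (e2pi (k%:~R * x)) = cval (e2pi x) ^ k.
Proof.
case: k => n; first exact: e2piMn.
by rewrite NegzE rmorphN mulNr e2piN e2piMn exprnN.
Qed.

Lemma e2pi_int k : cval (e2pi (k%:~R : R)) = 1.
Proof. by rewrite -[k%:~R]mulr1 e2piMz e2pi1 exp1rz. Qed.

Lemma Re_e2pi x : complex.Re (cval (e2pi x)) = cos (2 * pi * x). Proof. by []. Qed.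

Lemma e2pi_onto w : exists2 t, 0 <= t < 1 & e2pi t = w.
Proof.
case: w => -[x y] /= c1.
have xy : x ^+ 2 + y ^+ 2 = 1.
  move: (c1); rewrite normc_def /= => /eqP [] /(congr1 (fun z => z ^+ 2)).
  by rewrite sqr_sqrtr ?addr_ge0 ?sqr_ge0 // expr1n.
have x1 : - 1 <= x <= 1.
  by rewrite -ler_norml -(@expr_le1 _ 2) // real_normK ?num_real // -xy lerDl sqr_ge0.
have pi0 : 0 < 2 * pi :> R by rewrite mulr_gt0 // pi_gt0.
pose s := acos x / (2 * pi); have sE : 2 * pi * s = acos x by rewrite mulrC divfK // gt_eqF.
have s0 : 0 <= s by rewrite divr_ge0 ?acos_ge0 // ltW.
have s1 : s <= 1 / 2.
  by rewrite ler_pdivrMr // mulrA div1r mulVf ?mul1r ?acos_lepi.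
have sy : sin (acos x) = `|y|.
  by rewrite sin_acos // -xy addrAC subrr add0r sqrtr_sqr.
have cx : cos (acos x) = x by apply: acosK; rewrite in_itv.
have [y0|y0] := leP 0 y.
  exists s; first by rewrite s0 /=; lra.
  by apply: circle_inj; rewrite /= sE cx sy ger0_norm.
have s_gt0 : 0 < s.
  rewrite divr_gt0 // acos_gt0 // lt_neqAle; case/andP: x1 => -> -> /=; rewrite andbT.
  apply/eqP => xe; move: xy; rewrite xe expr1n => /(canRL (addKr _)).
  by rewrite addNr => /eqP; rewrite sqrf_eq0 lt_eqF.
exists (1 - s); first by lra.
apply: circle_inj; rewrite /= mulrBr mulr1 sE.
rewrite cosB sinB mulr_natl cos2pi sin2pi cx sy ltr0_norm //.
by rewrite !mul1r !mul0r addr0 sub0r opprK.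
Qed.

Lemma angleK w : e2pi (angle w) = w.
Proof.
rewrite /angle; case: xgetP => [t -> [] //|/(_ _)]; have [t t01 tw] := e2pi_onto w.
by move=> /(_ t) [].
Qed.

Lemma e2pi_eq1 t : 0 <= t < 1 -> cval (e2pi t) = 1 -> t = 0.
Proof.
move=> /andP[t0 t1] /(congr1 (@complex.Re R)) /= ct.
have pi0 : 0 < pi :> R := pi_gt0 R.
have key (u : R) : 0 <= u <= 1 / 2 -> cos (2 * pi * u) = 1 -> u = 0.
  move=> /andP[u0 u12] cu; have : 2 * pi * u = 0.
    apply: cos_inj; rewrite ?cos0 // in_itv /=; last by rewrite lexx ltW.
    have : 0 <= pi * u by rewrite mulr_ge0 // ltW.
    have : pi * u <= pi * (1 / 2) by rewrite ler_pM2l.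
    by move=> *; apply/andP; split; lra.
  by move/eqP; rewrite mulf_eq0 mulf_eq0 pnatr_eq0 (gt_eqF pi0) /= => /eqP.
have [t2|t2] := leP t (1 / 2); first by apply: key => //; rewrite t0.
have : 1 - t = 0; last by lra.
apply: key; first by lra.
by rewrite mulrBr mulr1 cosB ct mulr_natl cos2pi sin2pi mul1r mul0r addr0.
Qed.

Lemma e2pi_eq1_int x : cval (e2pi x) = 1 -> x \is a Num.int.
Proof.
move=> e1; have := @e2pi_eq1 (x - (Num.floor x)%:~R).
rewrite e2piD e2piN e2pi_int e1 invr1 mul1r => /(_ _ erefl) h.
have : x - (Num.floor x)%:~R = 0.
  apply: h; have /andP[a b] := floor_itv x.
  by rewrite subr_ge0 a ltrBlDl -[1]/(1%:~R) -intrD.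
by move/eqP; rewrite subr_eq0 => /eqP->; exact: intr_int.
Qed.
End CircleGroup.

Section TorusMonomials.
Variable R : realType.
Implicit Types (w : torus R) (a b k l : int).

(** Since monomials come with their inverses, the characters and the Jacobian are integral
combinations of these real parts. *)
Definition RM a b w : R := complex.Re (cval (monomial a b w)).

Lemma add_inv_circle (z : circle R) : cval z + (cval z)^-1 = (2 * complex.Re (cval z))%:C.
Proof.
have [t _ <-] := e2pi_onto z; rewrite -e2piN; apply/eqP.
rewrite eq_complex /= mulrN cosN sinN subrr eqxx andbT; apply/eqP; ring.
Qed.

Lemma monomialV a b w : cval (monomial (- a) (- b) w) = (cval (monomial a b w))^-1.
Proof. by rewrite /= invfM !invr_expz. Qed.

Lemma monomial_pair a b w : cval w.1 ^ a * cval w.2 ^ b + cval w.1 ^ (- a) * cval w.2 ^ (- b)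
  = (2 * RM a b w)%:C.
Proof. by rewrite -add_inv_circle -monomialV. Qed.

Definition chi1r w : R := 1 + 2 * (RM 1 0 w + RM 0 1 w + RM 1 (- 1) w).
Definition chi2r w : R := chi1r w + 1 + 2 * (RM 1 1 w + RM 2 (- 1) w + RM 1 (- 2) w).

Lemma chi1E w : chi1 w = (chi1r w)%:C.
Proof.
rewrite /chi1r !mulrDr !rmorphD /= -!monomial_pair /chi1 !opprK !oppr0.
by rewrite !expr1z !expr0z !exprN1 !mulr1 !mul1r !addrA.
Qed.

Lemma chi2E w : chi2 w = (chi2r w)%:C.
Proof.
rewrite /chi2r /chi2; move: (chi1r w) (chi1E w) => c1 ->.
rewrite !mulrDr !rmorphD /= -!monomial_pair !opprK.
by rewrite rmorph1 !expr1z !exprN1 !addrA.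
Qed.

Lemma e2pi_monomial a b (t1 t2 : R) :
  complex.Re (cval (e2pi t1) ^ a * cval (e2pi t2) ^ b) = cos (2 * pi * (a%:~R * t1 + b%:~R * t2)).
Proof. by rewrite -!e2piMz -e2piD. Qed.

Lemma JE w : J w = 8 * pi ^+ 2 * (RM 2 1 w + RM 1 (- 3) w + RM 3 (- 2) w
   - RM 1 2 w - RM 3 (- 1) w - RM 2 (- 3) w).
Proof.
have [t1E t2E] := (angleK w.1, angleK w.2); rewrite /J; move: (angle w.1) (angle w.2) t1E t2E.
move=> t1 t2 t1E t2E; rewrite /RM /= -t1E -t2E !e2pi_monomial /J_angle.
by rewrite !mulrNz !mulNr !mul1r.
Qed.

Lemma torus_eq w w' : cval w.1 = cval w'.1 -> cval w.2 = cval w'.2 -> w = w'.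
Proof. by case: w w' => [x y] [x' y'] /= /circle_inj -> /circle_inj ->. Qed.

Lemma monomial_act a b (T : 'M[int]_2) w :
  monomial a b (torus_act T w) = monomial (a * T 0 0 + b * T 1 0) (a * T 0 1 + b * T 1 1) w.
Proof.
have [x0 y0] := (cval_neq0 w.1, cval_neq0 w.2).
apply: circle_inj; rewrite /= !expfzMl !exprz_exp !expfzDr // !(mulrC a) !(mulrC b).
by rewrite mulrACA.
Qed.

Lemma torus_actM (S T : 'M[int]_2) w : torus_act (S * T) w = torus_act S (torus_act T w).
Proof.
by rewrite /torus_act -[in RHS]/(torus_act T w) !monomial_act -mulmxE !mxE !sum2.
Qed.

Lemma torus_act1 w : torus_act 1 w = w.
Proof.
by apply: torus_eq; rewrite /= !mxE /= ?expr1z ?expr0z ?mulr1 ?mul1r.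
Qed.

Lemma RM_act a b T w : RM a b (torus_act T w) =
  RM (a * T 0 0 + b * T 1 0) (a * T 0 1 + b * T 1 1) w.
Proof. by rewrite /RM monomial_act. Qed.

Lemma RMN a b w : RM (- a) (- b) w = RM a b w.
Proof.
have [t1 _ t1E] := e2pi_onto w.1; have [t2 _ t2E] := e2pi_onto w.2.
rewrite /RM /= -t1E -t2E !e2pi_monomial !mulrNz !mulNr -opprD mulrN cosN.
by [].
Qed.
End TorusMonomials.

Section Measurability.
Variable R : realType.

(** The form in which measurability is stable under products of complex-valued functions. *)
Definition measurableC (f : torus R -> R[i]) :=
  measurable_fun setT (fun w => complex.Re (f w)) /\
  measurable_fun setT (fun w => complex.Im (f w)).

Lemma measurable_circle_coords : measurable_fun setT (@circle_coords R).
Proof.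
move=> _ B mB; rewrite setTI; exists B => //; by rewrite setTI.
Qed.

Lemma measurableC_fst : measurableC (fun w => cval w.1).
Proof.
have m : measurable_fun setT (fun w : torus R => circle_coords w.1).
  exact: (measurableT_comp measurable_circle_coords).
split.
  exact: (measurableT_comp measurable_fst m).
exact: (measurableT_comp measurable_snd m).
Qed.

Lemma measurableC_snd : measurableC (fun w => cval w.2).
Proof.
have m : measurable_fun setT (fun w : torus R => circle_coords w.2).
  exact: (measurableT_comp measurable_circle_coords).
split.
  exact: (measurableT_comp measurable_fst m).
exact: (measurableT_comp measurable_snd m).
Qed.

Lemma measurableC_mul f g : measurableC f -> measurableC g -> measurableC (fun w => f w * g w).
Proof.
move=> [f1 f2] [g1 g2]; split.
  rewrite (_ : (fun w => _) = (fun w => complex.Re (f w) * complex.Re (g w)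
    - complex.Im (f w) * complex.Im (g w))).
    by apply: measurable_funB; apply: measurable_funM.
  by apply/funext => w; case: (f w) (g w) => [a b] [c d].
rewrite (_ : (fun w => _) = (fun w => complex.Re (f w) * complex.Im (g w)
    + complex.Im (f w) * complex.Re (g w))).
  by apply: measurable_funD; apply: measurable_funM.
by apply/funext => w; case: (f w) (g w) => [a b] [c d].
Qed.

Lemma measurableC_exp (z : torus R -> circle R) (k : int) :
  measurableC (fun w => cval (z w)) -> measurableC (fun w => cval (z w) ^ k).
Proof.
move=> mz.
have mn (n : nat) : measurableC (fun w => cval (z w) ^+ n).
  elim: n => [|n IHn]; first by split; exact: measurable_cst.
  under eq_fun do rewrite exprS.
  exact: measurableC_mul.
case: k => n; first exact: mn.
have [m1 m2] := mn n.+1.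
have E w : cval (z w) ^ (Negz n) = (complex.Re (cval (z w) ^+ n.+1)) -i* (complex.Im (cval (z w) ^+ n.+1)).
  have [t _ <-] := e2pi_onto (z w).
  by rewrite NegzE -exprnN -e2piMn -e2piN /= mulrN cosN sinN.
split.
  by under eq_fun do rewrite E /=.
under eq_fun do rewrite E /=.
exact: measurable_funN.
Qed.

Lemma measurable_RM a b : measurable_fun setT (@RM R a b).
Proof.
by have [] := measurableC_mul (measurableC_exp a measurableC_fst) (measurableC_exp b measurableC_snd).
Qed.

Lemma measurable_J : measurable_fun setT (@J R).
Proof.
rewrite (funext (@JE R)).
apply: measurable_funM; first exact: measurable_cst.
by do 3?apply: measurable_funB; do 2?apply: measurable_funD; exact: measurable_RM.
Qed.
End Measurability.

(** * The Weyl group and the fibres of the characters *)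

(** Integer matrices as quadruples, on which the finite checks below evaluate. *)
Definition mat := (int * int * int * int)%type.
Definition mat1 : mat := (1, 0, 0, 1).
Definition mat_mul (s t : mat) : mat :=
  let: (a, b, c, d) := s in let: (a', b', c', d') := t in
  (a * a' + b * c', a * b' + b * d', c * a' + d * c', c * b' + d * d').
Definition mx_of (t : mat) : 'M[int]_2 := let: (a, b, c, d) := t in mx2 a b c d.
Definition mat_pow s n := iter n (mat_mul s) mat1.

Lemma mx_ofM s t : mx_of (mat_mul s t) = mx_of s * mx_of t.
Proof. by case: s t => [[[a b] c] d] [[[a' b'] c'] d']; rewrite /= -mulmxE mx2_mul. Qed.

Lemma mx_of1 : mx_of mat1 = 1.
Proof. by rewrite -[1]/(1%:M) mx2_1. Qed.

Definition mat2 : mat := (0, -1, -1, 0).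
Definition mat6 : mat := (0, 1, -1, 1).

Lemma T2E : T2 = mx_of mat2.
Proof. by apply: mx2_eq; rewrite !mxE. Qed.
Lemma T6E : T6 = mx_of mat6.
Proof. by apply: mx2_eq; rewrite !mxE. Qed.

Definition dihedral s n := [seq mat_mul (mat_pow s k) (mat_pow mat2 e) | k <- iota 0 n, e <- iota 0 2].
Definition weyl12 := dihedral mat6 6.
Definition weyl6 := dihedral (mat_mul mat6 mat6) 3.

Section Generated.
Variables (S : set 'M[int]_2) (L : seq mat).

Lemma generated_sub : (forall g, S g -> exists2 t, t \in L & g = mx_of t) -> mat1 \in L ->
  all (fun s => all (fun t => mat_mul s t \in L) L) L ->
  all (fun s => has (fun t => mat_mul s t == mat1) L) L ->
  forall g, Defs.generated S g -> exists2 t, t \in L & g = mx_of t.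
Proof.
move=> SL L1 LM LV g; elim=> {g} [g /SL//||g h _ [s sL ->] _ [t tL ->]|g _ [s sL ->]].
- by exists mat1; rewrite ?mx_of1.
- by exists (mat_mul s t); rewrite ?mx_ofM //; exact: (allP (allP LM _ sL)).
have /hasP[t tL /eqP st] := allP LV _ sL; exists t => //.
have st1 : mx_of s * mx_of t = 1 by rewrite -mx_ofM st mx_of1.
have us : mx_of s \is a GRing.unit by have [] := mulmx1_unit st1.
by apply: (mulrI us); rewrite mulrV.
Qed.

Lemma generated_pow s n : Defs.generated S (mx_of s) -> Defs.generated S (mx_of (mat_pow s n)).
Proof.
move=> Ss; elim: n => [|n IHn]; first by rewrite -[mat_pow s 0]/mat1 mx_of1; exact: generated_one.
by rewrite -[mat_pow s n.+1]/(mat_mul s (mat_pow s n)) mx_ofM; exact: generated_mul.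
Qed.

Lemma generated_dihedral s n : Defs.generated S (mx_of s) -> Defs.generated S (mx_of mat2) ->
  {in dihedral s n, forall t, Defs.generated S (mx_of t)}.
Proof.
move=> Ss S2 t /allpairsP[[k e] /= [_ _ ->]]; rewrite mx_ofM.
by apply: generated_mul; exact: generated_pow.
Qed.
End Generated.

Lemma D12P g : D12 g <-> exists2 t, t \in weyl12 & g = mx_of t.
Proof.
split=> [|[t tL ->]].
  apply: generated_sub; [|by vm_compute|by vm_compute|by vm_compute].
  by move=> h [->|->]; [exists mat2; rewrite ?T2E | exists mat6; rewrite ?T6E].
apply: generated_dihedral tL; first by rewrite -T6E; apply: generated_mem; right.
by rewrite -T2E; apply: generated_mem; left.
Qed.

Lemma S3P g : Defs.S3 g <-> exists2 t, t \in weyl6 & g = mx_of t.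
Proof.
split=> [|[t tL ->]].
  apply: generated_sub; [|by vm_compute|by vm_compute|by vm_compute].
  move=> h [->|->]; first by exists mat2; rewrite ?T2E.
  by exists (mat_mul mat6 mat6); rewrite // mx_ofM -T6E expr2.
apply: generated_dihedral tL; first by rewrite mx_ofM -T6E -expr2; apply: generated_mem; right.
by rewrite -T2E; apply: generated_mem; left.
Qed.

Section Fibers.
Variable R : realType.
Implicit Types (w : torus R) (a b : int).

Lemma RM_T2 a b w : RM a b (torus_act T2 w) = RM b a w.
Proof. by rewrite RM_act -[RHS]RMN T2E !mxE /=; congr RM; ring. Qed.
Lemma RM_T6 a b w : RM a b (torus_act T6 w) = RM (- b) (a + b) w.
Proof. by rewrite RM_act T6E !mxE /=; congr RM; ring. Qed.

Lemma D12_invariant_fun (V : Type) (f : torus R -> V) :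
  (forall w, f (torus_act T2 w) = f w) -> (forall w, f (torus_act T6 w) = f w) ->
  forall T w, D12 T -> f (torus_act T w) = f w.
Proof.
move=> f2 f6 T w DT.
suff [] : T \is a GRing.unit /\ forall w, f (torus_act T w) = f w by [].
elim: DT {w} => {T} [g [->|->]||g h _ [ug fg] _ [uh fh]|g _ [ug fg]].
- by split=> //; rewrite T2E -[_ \is a _]/(_ \in unitmx) unitmxE mx2_det.
- by split=> //; rewrite T6E -[_ \is a _]/(_ \in unitmx) unitmxE mx2_det.
- by split=> [|w]; rewrite ?unitr1 // torus_act1.
- by split=> [|w]; [rewrite unitrMl | rewrite torus_actM fg fh].
split=> [|w]; first by rewrite unitrV.
by rewrite -[LHS]fg -torus_actM divrr // torus_act1.
Qed.

Lemma chi1r_T2 w : chi1r (torus_act T2 w) = chi1r w.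
Proof.
rewrite /chi1r !RM_T2 (_ : RM (- 1) 1 w = RM 1 (- 1) w); last exact: RMN 1 (- 1) w.
by ring.
Qed.

Lemma chi1r_T6 w : chi1r (torus_act T6 w) = chi1r w.
Proof.
rewrite /chi1r !RM_T6 (_ : RM (- 1) (0 + 1) w = RM 1 (- 1) w); last exact: RMN 1 (- 1) w.
rewrite -[RM (- 0) (1 + 0) w]/(RM 0 1 w) -[RM (- - 1) (1 + - 1) w]/(RM 1 0 w).
by ring.
Qed.

Lemma chi1r_act T w : D12 T -> chi1r (torus_act T w) = chi1r w.
Proof. exact: (@D12_invariant_fun _ (@chi1r R) chi1r_T2 chi1r_T6 T w). Qed.

Lemma chi2r_act T w : D12 T -> chi2r (torus_act T w) = chi2r w.
Proof.
apply: (@D12_invariant_fun _ (@chi2r R)) => {}w; rewrite /chi2r.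
  by rewrite chi1r_T2 !RM_T2 -[RM (- 1) 2 w]/(RM (- 1) (- (- 2)) w) -[RM (- 2) 1 w]/(RM (- 2) (- (- 1)) w)
     !RMN; ring.
rewrite chi1r_T6 !RM_T6 -[RM (- 1) (1 + 1) w]/(RM (- 1) (- (- 2)) w) RMN.
rewrite -[RM (- - 1) (2 + - 1) w]/(RM 1 1 w) -[RM (- - 2) (1 + - 2) w]/(RM 2 (- 1) w).
by ring.
Qed.

Definition chi1c (x y : R[i]) := 1 + x + x^-1 + y + y^-1 + x * y^-1 + x^-1 * y.
Definition chi2c (x y : R[i]) := chi1c x y + 1 + x * y + x^-1 * y^-1 + x ^+ 2 * y^-1 + x ^- 2 * y
  + x * y ^- 2 + x^-1 * y ^+ 2.

(** The three numbers x + 1/x, y + 1/y, x/y + y/x attached to the short roots are the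
roots of a cubic polynomial whose coefficients are polynomials in the two characters. *)
Lemma short_root_cubic (s x y : R[i]) : x != 0 -> y != 0 ->
  let e := chi1c x y - 1 in let l := chi2c x y - 2 in
  (s - (x + x^-1)) * (s - (y + y^-1)) * (s - (x / y + y / x))
    = s ^+ 3 - e * s ^+ 2 + l * s - (e ^+ 2 - 2 * l - 4).
Proof. by move=> x0 y0 e l; rewrite /e /l /chi2c /chi1c; field; rewrite x0 y0. Qed.

Lemma short_root_quadratic (s x y : R[i]) : x != 0 -> y != 0 ->
  let e := chi1c x y - 1 - (x + x^-1) in
  (s - (y + y^-1)) * (s - (x / y + y / x))
    = s ^+ 2 - s * e + (chi2c x y - 2 - (x + x^-1) * e).
Proof. by move=> x0 y0 e; rewrite /e /chi2c /chi1c; field; rewrite x0 y0. Qed.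

Lemma inv_sum_eq (x u : R[i]) : x != 0 -> u != 0 -> x + x^-1 = u + u^-1 -> x = u \/ x = u^-1.
Proof.
move=> x0 u0 h; have /eqP : (x - u) * (x - u^-1) = 0.
  have -> : (x - u) * (x - u^-1) = x * ((x + x^-1) - (u + u^-1)) by field; rewrite x0 u0.
  by rewrite h subrr mulr0.
by rewrite mulf_eq0 !subr_eq0 => /orP[] /eqP; [left | right].
Qed.

Lemma chi_eq_complex w w0 : chi1r w = chi1r w0 -> chi2r w = chi2r w0 ->
  chi1c (cval w.1) (cval w.2) = chi1c (cval w0.1) (cval w0.2) /\
  chi2c (cval w.1) (cval w.2) = chi2c (cval w0.1) (cval w0.2).
Proof.
move=> h1 h2; have := (chi1E w, chi2E w); rewrite h1 h2 -chi1E -chi2E => -[c1 c2].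
by split; [exact: c1 | exact: c2].
Qed.

Lemma D12_mem t : t \in weyl12 -> D12 (mx_of t).
Proof. by move=> tL; apply/D12P; exists t. Qed.

Lemma torus_act_mx a b c d w : torus_act (mx_of (a, b, c, d)) w = (monomial a b w, monomial c d w).
Proof. by rewrite /torus_act /= !mxE. Qed.

(** If the first coordinates agree, the second coordinates are related through the roots
y + 1/y and x/y + y/x of one quadratic polynomial. *)
Lemma fiber_first w w0 : w.1 = w0.1 -> chi1r w = chi1r w0 -> chi2r w = chi2r w0 ->
  exists2 T, D12 T & w = torus_act T w0.
Proof.
move=> w1 h1 h2; have [c1 c2] := chi_eq_complex h1 h2.
have := (cval_neq0 w.1, cval_neq0 w.2, cval_neq0 w0.2).
move: c1 c2; rewrite w1 => c1 c2 [[]].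
(* The four elements of the Weyl group that can occur fix or invert the first coordinate. *)
have done_by t : t \in weyl12 -> w = torus_act (mx_of t) w0 ->
    exists2 T, D12 T & w = torus_act T w0.
  by move=> tL ->; exists (mx_of t) => //; exact: D12_mem.
have wE a b c d : cval w0.1 = cval w0.1 ^ a * cval w0.2 ^ b ->
    cval w.2 = cval w0.1 ^ c * cval w0.2 ^ d -> w = torus_act (mx_of (a, b, c, d)) w0.
  by move=> e1 e2; apply: torus_eq; rewrite torus_act_mx /= ?w1.
move: (cval w0.1) (cval w.2) (cval w0.2) c1 c2 wE => x y v c1 c2 wE x0 y0 v0.
have z : (y + y^-1) + (x / y + y / x) = (v + v^-1) + (x / v + v / x).
  apply: (addrI (1 + x + x^-1)).
  transitivity (chi1c x y); first by rewrite /chi1c; ring.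
  by rewrite c1 /chi1c; ring.
have q s : (s - (y + y^-1)) * (s - (x / y + y / x)) = (s - (v + v^-1)) * (s - (x / v + v / x)).
  by rewrite !short_root_quadratic // c1 c2.
have y2 : y = v \/ y = x / v \/ (x = x^-1 /\ (y = v^-1 \/ y = v / x)).
  have xv0 : x / v != 0 by rewrite mulf_neq0 ?invr_neq0.
  have := q (y + y^-1); rewrite subrr mul0r => /esym/eqP; rewrite mulf_eq0 !subr_eq0 => /orP[] /eqP e.
    have [|yE] := inv_sum_eq y0 v0 e; first by left.
    move: z; rewrite e => /addrI; rewrite yE => h.
    have xv : x * v != 0 by rewrite mulf_neq0.
    have e' : x * v + (x * v)^-1 = x / v + (x / v)^-1.
      by move: h; rewrite invrK !invfM !invrK [v^-1 * _]mulrC [v / x]mulrC.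
    have [/(mulfI x0) vv|xx] := inv_sum_eq xv xv0 e'; first by left; rewrite -vv.
    right; right; split; last by left.
    by apply: (mulIf v0); rewrite xx invfM invrK.
  have e' : y + y^-1 = x / v + (x / v)^-1 by rewrite e invfM invrK [v / x]mulrC.
  have [yE|yE] := inv_sum_eq y0 xv0 e'; first by right; left.
  move: yE; rewrite invfM invrK mulrC => yE.
  move: z; rewrite e [RHS]addrC => /addrI h.
  have xy0 : x / y != 0 by rewrite mulf_neq0 ?invr_neq0.
  have h' : x / y + (x / y)^-1 = v + v^-1 by rewrite invfM invrK [_^-1 * y]mulrC.
  right; have [xy|xy] := inv_sum_eq xy0 v0 h'.
    by left; rewrite -xy invfM invrK mulrA mulfV // mul1r.
  right; split; last by right.
  apply: (mulfI x0); rewrite mulfV //.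
  have vi0 : v^-1 != 0 by rewrite invr_neq0.
  by apply: (mulfI vi0); rewrite mulr1 -{2}xy yE invfM invrK mulrCA.
case: y2 => [yE|[yE|[xx [yE|yE]]]].
- apply: (done_by (1, 0, 0, 1)) => //; apply: wE; rewrite ?expr1z ?expr0z ?mulr1 ?mul1r //.
- apply: (done_by (1, 0, 1, -1)) => //; apply: wE; rewrite ?expr1z ?expr0z ?exprN1 ?mulr1 ?mul1r //.
- apply: (done_by (-1, 0, 0, -1)) => //; apply: wE; rewrite ?expr1z ?expr0z ?exprN1 ?mulr1 ?mul1r //.
apply: (done_by (-1, 0, -1, 1)) => //; apply: wE; rewrite ?expr1z ?expr0z ?exprN1 ?mulr1 ?mul1r //.
by rewrite mulrC.
Qed.

(** By the cubic polynomial, w.1 is a short root evaluated at w0, and the Weyl group is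
transitive on the short roots; this reduces to equal first coordinates. *)
Lemma chi_fiber w w0 : chi1r w = chi1r w0 -> chi2r w = chi2r w0 ->
  exists2 T, D12 T & w = torus_act T w0.
Proof.
move=> h1 h2.
suff [T DT wT] : exists2 T, D12 T & w.1 = (torus_act T w0).1.
  have [||S DS ->] := fiber_first wT; rewrite ?chi1r_act ?chi2r_act //.
  by exists (S * T); [exact: generated_mul | rewrite torus_actM].
have [c1 c2] := chi_eq_complex h1 h2.
have q s : (s - (cval w.1 + (cval w.1)^-1)) * (s - (cval w.2 + (cval w.2)^-1))
      * (s - (cval w.1 / cval w.2 + cval w.2 / cval w.1))
    = (s - (cval w0.1 + (cval w0.1)^-1)) * (s - (cval w0.2 + (cval w0.2)^-1))
      * (s - (cval w0.1 / cval w0.2 + cval w0.2 / cval w0.1)).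
  by rewrite !short_root_cubic ?cval_neq0 // c1 c2.
have := q (cval w.1 + (cval w.1)^-1); rewrite subrr !mul0r {q c1 c2}.
have first_by a b c d : (a, b, c, d) \in weyl12 ->
    cval w.1 = cval w0.1 ^ a * cval w0.2 ^ b -> exists2 T, D12 T & w.1 = (torus_act T w0).1.
  move=> tL wE; exists (mx_of (a, b, c, d)); first exact: D12_mem.
  by apply: circle_inj; rewrite torus_act_mx /= wE.
move: (cval_neq0 w.1) (cval_neq0 w0.1) (cval_neq0 w0.2) first_by.
move: (cval w.1) (cval w0.1) (cval w0.2) => x u v x0 u0 v0 first_by /esym/eqP.
rewrite !mulf_eq0 !subr_eq0 -orbA => /or3P[] /eqP e.
- case: (inv_sum_eq x0 u0 e) => xE.
    by apply: (first_by 1 0 0 1) => //; rewrite xE expr1z expr0z mulr1.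
  by apply: (first_by (-1) 0 0 (-1)) => //; rewrite xE exprN1 expr0z mulr1.
- case: (inv_sum_eq x0 v0 e) => xE.
    by apply: (first_by 0 1 1 0) => //; rewrite xE expr1z expr0z mul1r.
  by apply: (first_by 0 (-1) (-1) 0) => //; rewrite xE exprN1 expr0z mul1r.
have uv0 : u / v != 0 by rewrite mulf_neq0 ?invr_neq0.
have e' : x + x^-1 = u / v + (u / v)^-1 by rewrite e invfM invrK [v / u]mulrC.
case: (inv_sum_eq x0 uv0 e') => xE.
  by apply: (first_by 1 (-1) 1 0) => //; rewrite xE exprN1 expr1z.
by apply: (first_by (-1) 1 (-1) 0) => //; rewrite xE exprN1 expr1z invfM invrK.
Qed.
End Fibers.

(** * Points of order dividing 126 *)

Section Points.
Variable R : realType.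
Implicit Types (k l a b : int).

(** The points that occur are of order dividing 126 = 2 * 7 * 9, and are written additively. *)
Definition zeta k : circle R := e2pi (k%:~R / 126).
Definition cosz k : R := complex.Re (cval (zeta k)).
Definition pt (p : int * int) : torus R := (zeta p.1, zeta p.2).
Definition red k : nat := absz (k %% 126)%Z.
Definition redp (p : int * int) : nat * nat := (red p.1, red p.2).
Definition ptn (q : nat * nat) : torus R := pt (q.1%:Z, q.2%:Z).
(** The representative of k mod 126 up to sign between 0 and 63, on which the real part
depends. *)
Definition nrm k : nat := let r := red k in minn r (126 - r).

Lemma zetaD k l : cval (zeta (k + l)) = cval (zeta k) * cval (zeta l).
Proof. by rewrite /zeta intrD mulrDl e2piD. Qed.

Lemma zetaX k l : cval (zeta (k * l)) = cval (zeta k) ^ l.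
Proof. by rewrite /zeta -e2piMz intrM (mulrC k%:~R) -mulrA. Qed.

Lemma zeta_mod k : zeta k = zeta (red k).
Proof.
apply: circle_inj; rewrite {1}(divz_eq k 126) zetaD [(_ * 126)%R]mulrC zetaX.
rewrite {1}/zeta divff ?e2pi1 ?exp1rz ?mul1r; last by rewrite intr_eq0.
by rewrite /red gez0_abs // modz_ge0.
Qed.

Lemma zeta_inj (i j : nat) : (i < 126)%N -> (j < 126)%N -> zeta i = zeta j -> i = j.
Proof.
wlog ij : i j / (i <= j)%N.
  by move=> h i1 j1 e; case: (leqP i j) => [|/ltnW] ij; [|apply/esym]; apply: h.
move=> i1 j1 e; have : cval (zeta (j%:Z - i%:Z)) = 1.
  apply: (mulIf (cval_neq0 (zeta i))); rewrite -zetaD subrK e mul1r //.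
move/e2pi_eq1 => h; have : (j%:Z - i%:Z)%:~R / 126 = 0 :> R.
  apply: h; rewrite subzn // -pmulrn divr_ge0 //= ltr_pdivrMr // mul1r ltr_nat.
  exact: leq_ltn_trans (leq_subr _ _) j1.
move/eqP; rewrite mulf_eq0 invr_eq0 pnatr_eq0 orbF intr_eq0 subr_eq0 => /eqP[].
by [].
Qed.

Lemma pt_red p : pt p = ptn (redp p).
Proof. by rewrite /pt (zeta_mod p.1) (zeta_mod p.2). Qed.

Lemma red_lt k : (red k < 126)%N.
Proof. by rewrite -ltz_nat gez0_abs ?modz_ge0 // ltz_pmod. Qed.

Lemma ptn_inj (p q : nat * nat) : (p.1 < 126)%N -> (p.2 < 126)%N ->
  (q.1 < 126)%N -> (q.2 < 126)%N -> ptn p = ptn q -> p = q.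
Proof.
case: p q => [p1 p2] [q1 q2] /= h1 h2 h3 h4 [e1 e2 e3 e4].
have f1 : zeta p1 = zeta q1 by apply: circle_inj; rewrite /= e1 e2.
have f2 : zeta p2 = zeta q2 by apply: circle_inj; rewrite /= e3 e4.
by rewrite (zeta_inj h1 h3 f1) (zeta_inj h2 h4 f2).
Qed.

Lemma monomial_pt a b p : monomial a b (pt p) = zeta (a * p.1 + b * p.2).
Proof. by apply: circle_inj; rewrite zetaD (mulrC a) (mulrC b) !zetaX. Qed.

Lemma RM_pt a b p : RM a b (pt p) = cosz (a * p.1 + b * p.2).
Proof. by rewrite /RM monomial_pt. Qed.

Definition mat_act (t : mat) (p : int * int) : int * int :=
  let: (a, b, c, d) := t in (a * p.1 + b * p.2, c * p.1 + d * p.2).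

Lemma torus_act_pt t p : torus_act (mx_of t) (pt p) = pt (mat_act t p).
Proof. by case: t => [[[a b] c] d]; rewrite torus_act_mx !monomial_pt. Qed.

Lemma coszN k : cosz (- k) = cosz k.
Proof. by rewrite /cosz !Re_e2pi mulrNz mulNr mulrN cosN. Qed.

Lemma cosz_nrm k : cosz k = cosz (nrm k).
Proof.
rewrite {1}/cosz zeta_mod -/(cosz _) /nrm; have := red_lt k; set r := red k => r1.
case: (leqP r (126 - r)) => [//|_].
rewrite -coszN {1}/cosz zeta_mod -/(cosz _) [in RHS]/cosz (zeta_mod (126 - r)%N) -/(cosz _).
congr cosz; congr Posz; congr absz.
by rewrite -subzn ?(ltnW r1) // -[in RHS]addrC modzDr.
Qed.

Definition cosz_sum (s : seq nat) : R := \sum_(i <- s) cosz i.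

Definition J_plus (p : int * int) := [seq nrm k | k <- [:: 2 * p.1 + p.2; p.1 - 3 * p.2; 3 * p.1 - 2 * p.2]].
Definition J_minus (p : int * int) := [seq nrm k | k <- [:: p.1 + 2 * p.2; 3 * p.1 - p.2; 2 * p.1 - 3 * p.2]].

Lemma J_pt p : J (pt p) = 8 * pi ^+ 2 * (cosz_sum (J_plus p) - cosz_sum (J_minus p)).
Proof.
rewrite JE !RM_pt /cosz_sum /J_plus /J_minus /= !big_cons !big_nil !addr0 -!cosz_nrm.
rewrite !mul1r !mulN1r !mulNr; congr (_ * _).
by rewrite !opprD !addrA.
Qed.

Lemma chi1r_pt p : chi1r (pt p) = 1 + 2 * cosz_sum [seq nrm k | k <- [:: p.1; p.2; p.1 - p.2]].
Proof.
rewrite /chi1r !RM_pt /cosz_sum /= !big_cons !big_nil !addr0 -!cosz_nrm.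
by rewrite !mul1r !mul0r !addr0 !add0r mulN1r !addrA.
Qed.

Lemma chi2r_pt p : chi2r (pt p) = chi1r (pt p) + 1 +
  2 * cosz_sum [seq nrm k | k <- [:: p.1 + p.2; 2 * p.1 - p.2; p.1 - 2 * p.2]].
Proof.
rewrite /chi2r !RM_pt /cosz_sum /= !big_cons !big_nil !addr0 -!cosz_nrm.
by rewrite !mul1r !mulN1r !mulNr !addrA.
Qed.

Lemma zeta_eq1 (k : nat) : (0 < k < 126)%N -> cval (zeta k) != 1.
Proof.
move=> /andP[k0 k1]; apply/eqP => e; have : k = 0%N.
  by apply: zeta_inj => //; apply: circle_inj; rewrite e /zeta mul0r e2pi0.
by move/eqP; rewrite -leqn0 leqNgt k0.
Qed.

Lemma cosz_pair k : cval (zeta k) + cval (zeta (- k)) = (2 * cosz k)%:C.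
Proof. by rewrite -add_inv_circle -mulN1r mulrC zetaX exprN1. Qed.

Lemma cosz7 : cosz 18 + cosz 36 + cosz 54 = - (1 / 2).
Proof.
set z := cval (zeta 18).
have z7 : z ^+ 7 = 1.
  have := zetaX 18 7; rewrite -exprnP => <-; by rewrite /zeta divff ?e2pi1 // intr_eq0.
have : (1 - z) * (1 + z + z ^+ 2 + z ^+ 3 + z ^+ 4 + z ^+ 5 + z ^+ 6) = 0.
  by transitivity (1 - z ^+ 7); [ring | rewrite z7 subrr].
move/eqP; rewrite mulf_eq0 subr_eq0 eq_sym (negbTE (zeta_eq1 _)) //= => /eqP s0.
have zn (n m : nat) : (18 * n)%N = m -> cval (zeta m) = z ^+ n.
  by move=> <-; rewrite PoszM zetaX.
have zv (n m : nat) : (n <= 7)%N -> (18 * n)%N = m -> cval (zeta (- m%:Z)) = z ^+ (7 - n).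
  move=> n7 e; apply: (mulIf (cval_neq0 (zeta m))); rewrite -zetaD addNr (zn n) // -exprD subnK // z7.
  by rewrite /zeta mul0r e2pi0.
have : (1 + (2 * cosz 18 + 2 * cosz 36 + 2 * cosz 54))%:C = 0.
  rewrite !rmorphD /= -!cosz_pair (zn 1 18) // (zn 2 36) // (zn 3 54) //.
  by rewrite (zv 1 18) // (zv 2 36) // (zv 3 54) // -s0; ring.
by move/(congr1 (@complex.Re R)) => /=; lra.
Qed.

Lemma cosz42 : cosz 42 = - (1 / 2).
Proof.
set z := cval (zeta 42).
have z3 : z ^+ 3 = 1.
  have := zetaX 42 3; rewrite -exprnP => <-; by rewrite /zeta divff ?e2pi1 // intr_eq0.
have : (1 - z) * (1 + z + z ^+ 2) = 0.
  by transitivity (1 - z ^+ 3); [ring | rewrite z3 subrr].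
move/eqP; rewrite mulf_eq0 subr_eq0 eq_sym (negbTE (zeta_eq1 _)) //= => /eqP s0.
have : (1 + 2 * cosz 42)%:C = 0.
  rewrite rmorphD /= -cosz_pair -s0 -/z (_ : cval (zeta (- 42)) = z ^+ 2) ?addrA //.
  apply: (mulIf (cval_neq0 (zeta 42))); rewrite -zetaD addNr -/z -exprSr z3.
  by rewrite /zeta mul0r e2pi0.
by move/(congr1 (@complex.Re R)) => /=; lra.
Qed.

Lemma cosz0 : cosz 0 = 1. Proof. by rewrite /cosz Re_e2pi mul0r mulr0 cos0. Qed.
Lemma cosz63 : cosz 63 = - 1.
Proof.
by rewrite /cosz Re_e2pi (_ : 2 * pi * _ = pi) ?cospi //; field.
Qed.

Lemma cosz_double k : cosz (k + k) = 2 * cosz k ^+ 2 - 1.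
Proof.
rewrite /cosz zetaD; move: (zeta k) => w; have [t _ <-] := e2pi_onto w => /=.
have := cos2Dsin2 (2 * pi * t); move: (cos _) (sin _) => c s h; nra.
Qed.

(** The angles of 40, 80 and 160 degrees are those of one coset of the cube roots of unity, up
to sign. *)
Lemma cosz9 : cosz 14 + cosz 28 + cosz 56 = 0.
Proof.
set z := cval (zeta 14).
have s0 : 1 + z ^+ 3 + z ^+ 6 = 0.
  have z9 : z ^+ 9 = 1.
    have := zetaX 14 9; rewrite -exprnP => <-; by rewrite /zeta divff ?e2pi1 // intr_eq0.
  have : (1 - z ^+ 3) * (1 + z ^+ 3 + z ^+ 6) = 0.
    by transitivity (1 - z ^+ 9); [ring | rewrite z9 subrr].
  move/eqP; rewrite mulf_eq0 subr_eq0 eq_sym.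
  have -> : z ^+ 3 = cval (zeta 42) by have := zetaX 14 3; rewrite -exprnP => <-.
  by rewrite (negbTE (zeta_eq1 _)) //= => /eqP.
have : cval (zeta 14) + cval (zeta 56) + cval (zeta 98) = 0.
  have := zetaX 14 4; have := zetaX 14 7; rewrite -!exprnP -/z => -> ->.
  by transitivity (z * (1 + z ^+ 3 + z ^+ 6)); [ring | rewrite s0 mulr0].
move/(congr1 (@complex.Re R)); rewrite !raddfD /= -!Re_e2pi -/(cosz 14) -/(cosz 56) -/(cosz 98).
by rewrite (cosz_nrm 98) addrAC.
Qed.
End Points.

(** * Averages of Dirac masses *)

Section Empirical.
Context d (T : measurableType d) (R : realType).
Implicit Types (l : seq T) (D : set T).

(** Entries are counted with repetition, so that rational weights are encoded in the list. *)
Definition empirical l : set T -> \bar R :=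
  mscale ((size l)%:R^-1)%:nng (msum (fun k => dirac (nth point l k)) (size l)).

HB.instance Definition _ l := Measure.on (empirical l).

Lemma uniform_empirical D : uniform R D = empirical (finmap.enum_fset (fset_set D)).
Proof. by []. Qed.

Lemma empiricalE l D : empirical l D = ((size l)%:R^-1 * \sum_(x <- l) \1_D x)%:E.
Proof.
rewrite /empirical /mscale /msum /= EFinM; congr (_ * _)%E.
by rewrite (big_nth point) big_mkord -sumEFin.
Qed.

Lemma ge0_integral_empirical l D (f : T -> R) : measurable D -> measurable_fun setT f ->
  (forall x, 0 <= f x) ->
  (\int[empirical l]_(x in D) (f x)%:E = ((size l)%:R^-1 * \sum_(x <- l) \1_D x * f x)%:E)%E.
Proof.
move=> mD mf f0; have mDf : measurable_fun D (fun x => (f x)%:E).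
  by apply/measurable_EFinP; exact: measurable_funS mf.
rewrite ge0_integral_mscale //; last by move=> x _; rewrite lee_fin.
rewrite ge0_integral_measure_sum //; last by move=> x _; rewrite lee_fin.
rewrite EFinM; congr (_ * _)%E; rewrite (big_nth point) big_mkord -sumEFin.
by apply: eq_bigr => i _; rewrite integral_dirac.
Qed.

Lemma integral_empirical l D (f : T -> R) : measurable D -> measurable_fun setT f ->
  (\int[empirical l]_(x in D) (f x)%:E = ((size l)%:R^-1 * \sum_(x <- l) \1_D x * f x)%:E)%E.
Proof.
move=> mD mf; rewrite integralE.
have -> : (fun x => (f x)%:E)^\+%E = (fun x => (Num.max (f x) 0)%:E).
  by apply/funext => x; rewrite funeposE -EFin_max.
have -> : (fun x => (f x)%:E)^\-%E = (fun x => (Num.max (- f x) 0)%:E).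
  by apply/funext => x; rewrite funenegE -EFinN -EFin_max.
rewrite !ge0_integral_empirical //.
- rewrite -EFinB -mulrBr -sumrB; congr (_ * _)%:E; apply: eq_bigr => x _.
  by rewrite -mulrBr; congr (_ * _); case: (leP (f x) 0); case: (leP (- f x) 0); lra.
- by apply: measurable_maxr => //; exact: measurable_funN.
- by move=> x; rewrite le_max lexx orbT.
- exact: measurable_maxr.
- by move=> x; rewrite le_max lexx orbT.
Qed.

Lemma empirical_setT l : l != [::] -> empirical l setT = 1%E.
Proof.
move=> l0; rewrite empiricalE (eq_bigr (fun=> 1)) ?big_const_seq ?count_predT => [|x _].
  by rewrite iter_addr_0 mulVf // pnatr_eq0 size_eq0.
by rewrite indicE in_setT.
Qed.

(** The non-emptiness proof is an argument because it makes the total mass 1. *)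
Definition empirical_prob l (l0 : l != [::]) : set T -> \bar R := empirical l.
HB.instance Definition _ l (l0 : l != [::]) := Measure.on (empirical_prob l0).
HB.instance Definition _ l (l0 : l != [::]) :=
  Measure_isProbability.Build _ _ _ (empirical_prob l0) (empirical_setT l0).

End Empirical.

(** * Expectations of bounded functions on the torus *)

Section Expectation.
Variable R : realType.
Implicit Types (w : torus R) (f g : torus R -> R) (nu mu : probability (torus R) R).

Lemma measurable_monomial a b : measurable_fun setT (@monomial R a b).
Proof.
have [mRe mIm] := measurableC_mul (measurableC_exp a (measurableC_fst R)) (measurableC_exp b (measurableC_snd R)).
move=> _ B [C mC <-]; rewrite !setTI -comp_preimage -[_ @^-1` _]setTI.
exact: (measurable_fun_pair mRe mIm).
Qed.

Lemma measurable_torus_act T : measurable_fun setT (@torus_act R T).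
Proof. by apply: measurable_fun_pair; exact: measurable_monomial. Qed.

Lemma RM_le1 a b w : `|RM a b w| <= 1.
Proof.
rewrite /RM; move: (monomial a b w) => z; have [t _ <-] := e2pi_onto z.
by rewrite Re_e2pi ler_norml cos_geN1 cos_le1.
Qed.

Definition bounded_measurable f := measurable_fun setT f /\ exists M : R, forall w, `|f w| <= M.

Lemma bm_cst c : bounded_measurable (fun=> c).
Proof. by split; [exact: measurable_cst | exists `|c|]. Qed.

Lemma bm_add f g : bounded_measurable f -> bounded_measurable g -> bounded_measurable (fun w => f w + g w).
Proof.
move=> [mf [M fM]] [mg [N gN]]; split; first exact: measurable_funD.
by exists (M + N) => w; rewrite (le_trans (ler_normD _ _)) // lerD.
Qed.

Lemma bm_mul f g : bounded_measurable f -> bounded_measurable g -> bounded_measurable (fun w => f w * g w).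
Proof.
move=> [mf [M fM]] [mg [N gN]]; split; first exact: measurable_funM.
by exists (M * N) => w; rewrite normrM ler_pM.
Qed.

Lemma bm_exp f n : bounded_measurable f -> bounded_measurable (fun w => f w ^+ n).
Proof.
move=> bf; elim: n => [|n IHn]; first exact: bm_cst.
by under eq_fun do rewrite exprS; exact: bm_mul.
Qed.

Lemma bm_horner (p : {poly R}) f : bounded_measurable f -> bounded_measurable (fun w => p.[f w]).
Proof.
move=> bf; elim/poly_ind: p => [|p c IHp].
  by under eq_fun do rewrite horner0; exact: bm_cst.
under eq_fun do rewrite hornerMXaddC.
by apply: bm_add; [exact: bm_mul | exact: bm_cst].
Qed.

Lemma bm_sum (I : Type) (s : seq I) (F : I -> torus R -> R) :
  (forall i, bounded_measurable (F i)) -> bounded_measurable (fun w => \sum_(i <- s) F i w).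
Proof.
move=> bF; elim: s => [|i s IHs].
  by under eq_fun do rewrite big_nil; exact: bm_cst.
by under eq_fun do rewrite big_cons; exact: bm_add.
Qed.

Lemma bm_indic (A : set (torus R)) : measurable A -> bounded_measurable \1_A.
Proof.
move=> mA; split; first exact: measurable_indic.
by exists 1 => w; rewrite indicE; case: (w \in A); rewrite /= ?normr1 ?normr0.
Qed.

Lemma bm_RM a b : bounded_measurable (@RM R a b).
Proof. by split; [exact: measurable_RM | exists 1 => w; exact: RM_le1]. Qed.

Lemma bm_chi1r : bounded_measurable (@chi1r R).
Proof.
by apply: bm_add (bm_cst _) (bm_mul (bm_cst _) _); do 2?apply: bm_add; exact: bm_RM.
Qed.

Lemma bm_chi2r : bounded_measurable (@chi2r R).
Proof.
apply: bm_add; first exact: bm_add bm_chi1r (bm_cst _).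
by apply: bm_mul (bm_cst _) _; do 2?apply: bm_add; exact: bm_RM.
Qed.


Section OneMeasure.
Variable nu : probability (torus R) R.
Local Notation E f := (\int[nu]_(w in setT) f w).

Lemma bm_integrable f : bounded_measurable f -> nu.-integrable setT (EFin \o f).
Proof.
move=> [mf [M fM]]; apply: measurable_bounded_integrable => //.
  by apply: le_lt_trans (probability_le1 nu measurableT) (ltry _).
exists `|M|; split; first exact: num_real.
by move=> x Mx w _; apply: le_trans (fM w) (le_trans (ler_norm M) (ltW Mx)).
Qed.

Lemma expD f g : bounded_measurable f -> bounded_measurable g -> E (fun w => f w + g w) = E f + E g.
Proof. by move=> bf bg; rewrite RintegralD //; exact: bm_integrable. Qed.

Lemma expZ c f : bounded_measurable f -> E (fun w => c * f w) = c * E f.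
Proof. by move=> bf; rewrite RintegralZl //; exact: bm_integrable. Qed.

Lemma exp_sum (I : Type) (s : seq I) (F : I -> torus R -> R) :
  (forall i, bounded_measurable (F i)) -> E (fun w => \sum_(i <- s) F i w) = \sum_(i <- s) E (F i).
Proof.
move=> bF; elim: s => [|i s IHs].
  rewrite big_nil; under eq_Rintegral do rewrite big_nil.
  by rewrite Rintegral_cst ?mul0r.
rewrite big_cons -IHs -expD //; last exact: bm_sum.
by apply: eq_Rintegral => w _; rewrite big_cons.
Qed.

Lemma exp_ae f g : bounded_measurable f -> bounded_measurable g ->
  {ae nu, forall w, f w = g w} -> E f = E g.
Proof.
move=> [mf _] [mg _] fg; congr fine; apply: ae_eq_integral => //.
- exact/measurable_EFinP.
- exact/measurable_EFinP.
by apply: filterS fg => w fgw _ /=; rewrite fgw.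
Qed.

Lemma exp0_ae f : bounded_measurable f -> (forall w, 0 <= f w) -> E f = 0 ->
  {ae nu, forall w, f w = 0}.
Proof.
move=> bf f0 Ef; have mf := bf.1.
have Ef' : (\int[nu]_(w in setT) (f w)%:E)%E = 0%E.
  by rewrite -[LHS]fineK ?integrable_fin_num ?bm_integrable // -[fine _]/(E f) Ef.
have mEf : measurable_fun setT (EFin \o f) by exact/measurable_EFinP.
have Eabs : (\int[nu]_(w in setT) `|(EFin \o f) w|)%E = 0%E.
  by rewrite -[RHS]Ef'; apply: eq_integral => w _; rewrite /= ger0_norm.
have /(_ Eabs) := (ae_eq_integral_abs nu measurableT mEf).1.
by apply: filterS => w /(_ I) [].
Qed.

Lemma exp_indic (A : set (torus R)) : measurable A -> E \1_A = fine (nu A).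
Proof. by move=> mA; rewrite /Rintegral integral_indic // setIT. Qed.

Definition weyl_sum f w := \sum_(t <- weyl12) f (torus_act (mx_of t) w).

Lemma bm_weyl_sum A : measurable A -> bounded_measurable (weyl_sum \1_A).
Proof.
move=> mA; apply: bm_sum => t; have [mI [M MI]] := bm_indic mA; split; last by exists M.
exact: (measurableT_comp mI (measurable_torus_act _)).
Qed.

(** The measure is invariant, so all twelve terms have the same expectation. *)
Lemma exp_weyl_sum A : D12_invariant nu -> measurable A -> E (weyl_sum \1_A) = 12 * fine (nu A).
Proof.
move=> inv mA; have bmT t : bounded_measurable (fun w => \1_A (torus_act (mx_of t) w) : R).
  have [mI [M MI]] := bm_indic mA; split; last by exists M.
  exact: (measurableT_comp mI (measurable_torus_act _)).
rewrite exp_sum // big_seq (eq_bigr (fun=> fine (nu A))).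
  rewrite -big_seq big_const_seq count_predT iter_addr_0.
  by rewrite mulr_natl.
move=> t tL; rewrite -(inv _ (D12_mem tL) A mA) -exp_indic.
  by apply: eq_Rintegral => w _; rewrite !indicE.
by rewrite -[X in measurable X]setTI; exact: measurable_torus_act.
Qed.
End OneMeasure.
End Expectation.

(** * Measures determined by their joint moments *)

Lemma interpolation (K : fieldType) (T : eqType) (s : seq T) (x y : T -> K) :
  uniq [seq x i | i <- s] -> exists p : {poly K}, forall i, i \in s -> p.[x i] = y i.
Proof.
elim: s => [|j s IHs] /=; first by exists 0.
case/andP=> xj /IHs[p pE]; pose q := \prod_(i <- s) ('X - (x i)%:P).
have rq i : root q (x i) = (x i \in [seq x i | i <- s]).
  by rewrite /q -(big_map x predT (fun c => 'X - c%:P)) root_prod_XsubC.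
exists (p + ((y j - p.[x j]) / q.[x j]) *: q) => i; rewrite inE => /orP[/eqP -> | iL].
  have qj : q.[x j] != 0 by move: xj; rewrite -rq.
  by rewrite hornerD hornerZ divfK // addrC subrK.
rewrite hornerD hornerZ pE // (_ : q.[x i] = 0) ?mulr0 ?addr0 //.
by apply/eqP; rewrite -[_ == 0]/(root q (x i)) rq map_f.
Qed.

Section Uniqueness.
Variable R : realType.
Implicit Types (nu mu : probability (torus R) R) (w : torus R) (p : {poly R}).

Definition moment nu m n : R := \int[nu]_(w in setT) (chi1r w ^+ m * chi2r w ^+ n).

Lemma bm_monom m n : bounded_measurable (fun w : torus R => chi1r w ^+ m * chi2r w ^+ n).
Proof. by apply: bm_mul; apply: bm_exp; [exact: bm_chi1r | exact: bm_chi2r]. Qed.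

Lemma bm_poly p n : bounded_measurable (fun w => p.[chi1r w] * chi2r w ^+ n).
Proof. by apply: bm_mul; [apply: bm_horner | apply: bm_exp]; [exact: bm_chi1r | exact: bm_chi2r]. Qed.

Lemma eq_moments_poly nu mu p n : (forall m n, moment nu m n = moment mu m n) ->
  \int[nu]_(w in setT) (p.[chi1r w] * chi2r w ^+ n) = \int[mu]_(w in setT) (p.[chi1r w] * chi2r w ^+ n).
Proof.
move=> hm.
have E (la : probability (torus R) R) :
    \int[la]_(w in setT) (p.[chi1r w] * chi2r w ^+ n) = \sum_(i < size p) p`_i * moment la i n.
  rewrite (eq_bigr (fun i : 'I_(size p) => \int[la]_(w in setT) (p`_i * (chi1r w ^+ i * chi2r w ^+ n)))).
    rewrite -(exp_sum _ _ (F := fun (i : 'I_(size p)) w => p`_i * (chi1r w ^+ i * chi2r w ^+ n))).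
      by apply: eq_Rintegral => w _; rewrite horner_coef mulr_suml; apply: eq_bigr => i _; rewrite mulrA.
    by move=> i; apply: bm_mul (bm_cst _) (bm_monom _ _).
  by move=> i _; rewrite expZ //; exact: bm_monom.
by rewrite !E; apply: eq_bigr => i _; rewrite hm.
Qed.

(** The orbits of the points of s carry mu. The expression q, a sum of two squares of
polynomials in the characters, vanishes exactly on these orbits because chi1 separates
them. Its expectation is a combination of moments, so nu is carried by the same orbits. There
the Weyl sum of an indicator function agrees with a polynomial in chi1, and its
expectation, which is 12 times the mass, is again given by the moments. *)
Lemma moments_determine nu mu (s : seq (torus R)) :
  D12_invariant nu -> D12_invariant mu ->
  (forall m n, moment nu m n = moment mu m n) ->
  uniq [seq chi1r w | w <- s] ->
  (forall f, bounded_measurable f -> (forall w T, w \in s -> D12 T -> f (torus_act T w) = 0) ->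
    \int[mu]_(w in setT) f w = 0) ->
  forall A, measurable A -> nu A = mu A.
Proof.
move=> nuI muI hm us mu0 A mA.
have [l lE] := interpolation (@chi2r R) us.
have [pA pAE] := interpolation (weyl_sum \1_A) us.
pose Q := \prod_(c <- [seq chi1r w | w <- s]) ('X - c%:P) : {poly R}.
have Q0 c : (Q.[c] == 0) = (c \in [seq chi1r w | w <- s]) by rewrite -[_ == 0]/(root Q c) root_prod_XsubC.
pose q w := Q.[chi1r w] ^+ 2 + (chi2r w - l.[chi1r w]) ^+ 2.
have q_ge0 w : 0 <= q w by rewrite addr_ge0 ?sqr_ge0.
have qE w : q w = (Q ^+ 2 + l ^+ 2).[chi1r w] * chi2r w ^+ 0
    + ((- 2 *: l).[chi1r w] * chi2r w ^+ 1 + (1 : {poly R}).[chi1r w] * chi2r w ^+ 2).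
  by rewrite /q hornerD !horner_exp hornerZ hornerC; ring.
have bq : bounded_measurable q.
  by rewrite (funext qE); do 2?apply: bm_add; exact: bm_poly.
have Eq (la : probability (torus R) R) : \int[la]_(w in setT) q w =
    \int[la]_(w in setT) ((Q ^+ 2 + l ^+ 2).[chi1r w] * chi2r w ^+ 0)
    + (\int[la]_(w in setT) ((- 2 *: l).[chi1r w] * chi2r w ^+ 1)
    + \int[la]_(w in setT) ((1 : {poly R}).[chi1r w] * chi2r w ^+ 2)).
  rewrite -(expD la (bm_poly (- 2 *: l) 1) (bm_poly 1 2)).
  rewrite -(expD la (bm_poly _ 0) (bm_add (bm_poly (- 2 *: l) 1) (bm_poly 1 2))).
  by apply: eq_Rintegral => w _; rewrite qE.
have qmu : \int[mu]_(w in setT) q w = 0.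
  apply: mu0 => // w T ws DT; rewrite /q chi1r_act // chi2r_act // lE // subrr expr0n addr0.
  by apply/eqP; rewrite sqrf_eq0 Q0 map_f.
have qnu : \int[nu]_(w in setT) q w = 0.
  by rewrite -qmu !Eq; rewrite !(eq_moments_poly _ _ hm).
have sumA w : q w = 0 -> weyl_sum \1_A w = pA.[chi1r w].
  move/eqP; rewrite paddr_eq0 ?sqr_ge0 // !sqrf_eq0 Q0 => /andP[/mapP[w0 w0s c1] /eqP].
  rewrite c1 lE // => /eqP; rewrite subr_eq0 => /eqP c2.
  have [T /D12P[t tL ->] ->] := chi_fiber c1 c2; rewrite pAE //.
  rewrite /weyl_sum; under eq_bigr => u _ do rewrite -torus_actM -mx_ofM.
  rewrite -(big_map (fun u => mat_mul u t) predT (fun u => \1_A (torus_act (mx_of u) w0))).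
  apply: perm_big; move: t tL {c1 c2}; apply/allP; by vm_compute.
have key (la : probability (torus R) R) : D12_invariant la -> \int[la]_(w in setT) q w = 0 ->
    12 * fine (la A) = \int[la]_(w in setT) (pA.[chi1r w] * chi2r w ^+ 0).
  move=> laI q0; rewrite -exp_weyl_sum //; apply: exp_ae => //; first exact: bm_weyl_sum.
    exact: bm_poly.
  have := exp0_ae bq q_ge0 q0; apply: filterS => w /sumA ->; by rewrite expr0 mulr1.
have : 12 * fine (nu A) = 12 * fine (mu A) by rewrite !key // (eq_moments_poly _ _ hm).
move/mulfI => /(_ _) h; rewrite -[LHS]fineK ?fin_num_measure // -[RHS]fineK ?fin_num_measure //.
by rewrite h // pnatr_eq0.
Qed.
End Uniqueness.

(** * The spectral measure *)

Section SpectralMeasure.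
Variable R : realType.
Local Notation cz k := (@cosz R k).

(** The Weyl orbits of the conjugacy classes of PSL(2;8): a point of each orbit, in 126th
parts of the circle, with the number of group elements that it accounts for. *)
Definition class_points : seq (nat * (nat * nat)) :=
  [:: (1, (0, 0)); (63, (63, 0)); (56, (42, 0)); (216, (18, 54));
      (56, (70, 42)); (56, (56, 42)); (56, (28, 42))]%N.

Definition eps_points : seq (torus R) :=
  [seq torus_act (mx_of t) (ptn R q) |
    q <- flatten [seq nseq p.1 p.2 | p <- class_points], t <- weyl12].

Lemma sum_eps_points (f : torus R -> R) : \sum_(w <- eps_points) f w =
  \sum_(p <- class_points) weyl_sum f (ptn R p.2) *+ p.1.
Proof.
rewrite /eps_points big_allpairs_dep big_flatten big_map; apply: eq_bigr => p _.
by rewrite big_nseq iter_addr_0.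
Qed.

Lemma size_eps_points : size eps_points = (504 * 12)%N.
Proof. by rewrite size_allpairs. Qed.

Lemma eps_points_neq0 : eps_points != [::].
Proof. by rewrite -size_eq0 size_eps_points. Qed.

(** The law of the point obtained from a random group element and a random Weyl group element. *)
Definition eps : probability (torus R) R := empirical_prob R eps_points_neq0.

Lemma epsE A : eps A = ((504 * 12)^-1 * \sum_(p <- class_points) weyl_sum \1_A (ptn R p.2) *+ p.1)%:E.
Proof.
by rewrite -[LHS]/(empirical R eps_points A) empiricalE size_eps_points sum_eps_points natrM.
Qed.

Lemma exp_eps f : bounded_measurable f -> \int[eps]_(w in setT) f w =
  (504 * 12)^-1 * \sum_(p <- class_points) weyl_sum f (ptn R p.2) *+ p.1.
Proof.
move=> [mf _]; rewrite /Rintegral -[X in integral X]/(empirical R eps_points) integral_empirical //.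
rewrite size_eps_points sum_eps_points natrM; congr (_ * _); apply: eq_bigr => p _.
by congr (_ *+ _); apply: eq_bigr => t _; rewrite indicE in_setT mul1r.
Qed.

Lemma eps_D12_invariant : D12_invariant eps.
Proof.
move=> T /D12P[t tL ->] A mA; rewrite !epsE; congr (_ * _)%:E; apply: eq_bigr => p _.
congr (_ *+ _); rewrite /weyl_sum.
rewrite (eq_bigr (fun u => \1_A (torus_act (mx_of (mat_mul t u)) (ptn R p.2)))); last first.
  by move=> u _; rewrite mx_ofM torus_actM !indicE.
rewrite -(big_map (mat_mul t) predT (fun u => \1_A (torus_act (mx_of u) (ptn R p.2)))).
by apply: perm_big; move: t tL; apply/allP; vm_compute.
Qed.

Lemma weyl_sum_invariant (f : torus R -> R) w : (forall T, D12 T -> f (torus_act T w) = f w) ->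
  weyl_sum f w = 12 * f w.
Proof.
move=> fT; rewrite /weyl_sum big_seq (eq_bigr (fun=> f w)).
  by rewrite -big_seq big_const_seq count_predT iter_addr_0 mulr_natl.
by move=> t tL; apply: fT; exact: D12_mem.
Qed.

Lemma chi_values_trivial : chi1r (ptn R (0, 0)%N) = 7 /\ chi2r (ptn R (0, 0)%N) = 14.
Proof. by rewrite chi2r_pt chi1r_pt /cosz_sum !big_cons !big_nil cosz0; split; ring. Qed.

Lemma chi_values2 : chi1r (ptn R (63, 0)%N) = - 1 /\ chi2r (ptn R (63, 0)%N) = - 2.
Proof. by rewrite chi2r_pt chi1r_pt /cosz_sum !big_cons !big_nil cosz0 cosz63; split; ring. Qed.

Lemma chi_values3 : chi1r (ptn R (42, 0)%N) = 1 /\ chi2r (ptn R (42, 0)%N) = - 1.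
Proof. by rewrite chi2r_pt chi1r_pt /cosz_sum !big_cons !big_nil cosz0 cosz42; split; field. Qed.

Lemma chi_values7 : chi1r (ptn R (18, 54)%N) = 0 /\ chi2r (ptn R (18, 54)%N) = 0.
Proof.
by rewrite chi2r_pt chi1r_pt /cosz_sum !big_cons !big_nil /=; have := cosz7 R; split; lra.
Qed.

Lemma cosz_double9 : [/\ cz 28 = 2 * cz 14 ^+ 2 - 1, cz 56 = 2 * cz 28 ^+ 2 - 1
  & cz 14 = 2 * cz 56 ^+ 2 - 1].
Proof. by rewrite -!cosz_double; split=> //; rewrite [RHS]cosz_nrm. Qed.

Lemma chi_values9 (k l : nat) : ((k, l) \in [:: (70, 14); (56, 28); (28, 56)])%N ->
  let x := - 2 * cz l in chi1r (ptn R (k, 42)%N) = x /\ chi2r (ptn R (k, 42)%N) = x ^+ 2 - x - 1.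
Proof.
have [d1 d2 d4] := cosz_double9; have := cosz9 R; have := cosz42 R.
rewrite !inE => c42 c9 /or3P[] /eqP[-> ->] x; rewrite /x chi2r_pt chi1r_pt /cosz_sum.
all: rewrite !big_cons !big_nil /=.
all: by split; nra.
Qed.
End SpectralMeasure.

(** * Its moments and its uniqueness *)

Section Moments.
Variable R : realType.
Local Notation cz k := (@cosz R k).

Definition nonagon_values : seq R := [:: - 2 * cz 14; - 2 * cz 28; - 2 * cz 56].

Lemma eps_moment m n : moment (eps R) m n = (7 ^+ m * 14 ^+ n + 63 * ((- 1) ^+ m * (- 2) ^+ n)
  + 56 * (- 1) ^+ n + 56 * (\sum_(x <- nonagon_values) x ^+ m * (x ^+ 2 - x - 1) ^+ n)
  + 216 * (0 ^+ m * 0 ^+ n)) / 504.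
Proof.
rewrite /moment exp_eps; last exact: bm_monom.
rewrite (eq_bigr (fun p => 12 * (p.1%:R * (chi1r (ptn R p.2) ^+ m * chi2r (ptn R p.2) ^+ n)))).
  rewrite -mulr_sumr invfM -mulrA mulKf ?pnatr_eq0 // mulrC; congr (_ / _).
  rewrite !big_cons !big_nil /=.
  have [-> ->] := chi_values_trivial R; have [-> ->] := chi_values2 R.
  have [-> ->] := chi_values3 R; have [-> ->] := chi_values7 R.
  have [|-> ->] := @chi_values9 R 70 14; first by []. 
  have [|-> ->] := @chi_values9 R 56 28; first by [].
  have [|-> ->] := @chi_values9 R 28 56; first by [].
  rewrite expr1n; ring.
move=> p _; rewrite weyl_sum_invariant => [|T DT]; last by rewrite chi1r_act ?chi2r_act.
by rewrite -mulrnAr; congr (_ * _); rewrite mulr_natl.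
Qed.

Lemma nonagon_minpoly : 8 * cz 14 ^+ 3 - 6 * cz 14 + 1 = 0.
Proof.
have [d1 d2 d4] := cosz_double9 R; have c9 := cosz9 R.
have u0 : cz 14 != 0 by apply/eqP => u0; move: d1 d2 d4; rewrite u0 => ->; nra.
apply: (mulfI u0); rewrite mulr0.
have : cz 56 = 1 - cz 14 - 2 * cz 14 ^+ 2 by lra.
by rewrite d2 d1 => h; lra.
Qed.

(** The roots of x^3 - 3 x - 1 are minus twice the cosines of 40, 80 and 160 degrees; the map
x |-> 2 - x^2 permutes them cyclically. *)
Lemma nonagon_root (x : R) : x ^+ 3 = 3 * x + 1 -> x \in nonagon_values.
Proof.
move=> xE; have [d1 d2 d4] := cosz_double9 R; have c9 := cosz9 R.
have c4 : cz 56 = 1 - cz 14 - 2 * cz 14 ^+ 2 by lra.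
have /eqP : (x + 2 * cz 14) * (x + 2 * cz 28) * (x + 2 * cz 56) = 0.
  transitivity ((x ^+ 3 - 3 * x - 1) + (8 * cz 14 ^+ 3 - 6 * cz 14 + 1)
      * (1 - 2 * cz 14 - 4 * cz 14 ^+ 2 - (2 * cz 14 + 1) * x)).
    by rewrite c4 d1; ring.
  by rewrite nonagon_minpoly xE; ring.
rewrite !mulf_eq0 !addr_eq0 -!mulNr -orbA => /or3P[] /eqP ->; by rewrite !inE eqxx ?orbT.
Qed.

Lemma nonagon_step : [/\ 2 - (- 2 * cz 14) ^+ 2 = - 2 * cz 28,
  2 - (- 2 * cz 28) ^+ 2 = - 2 * cz 56 & 2 - (- 2 * cz 56) ^+ 2 = - 2 * cz 14].
Proof. by have [-> -> d4] := cosz_double9 R; split; [ring | ring | rewrite {2}d4; ring]. Qed.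

Lemma sum_nonagon (x y z : R) (f : R -> R) : x ^+ 3 = 3 * x + 1 -> y = 2 - x ^+ 2 ->
  z = 2 - y ^+ 2 -> \sum_(t <- [:: x; y; z]) f t = \sum_(t <- nonagon_values) f t.
Proof.
have [n1 n2 n4] := nonagon_step.
move=> /nonagon_root; rewrite !inE => /or3P[] /eqP -> ->; rewrite ?n1 ?n2 ?n4 => ->; rewrite ?n1 ?n2 ?n4.
all: by rewrite /nonagon_values !big_cons !big_nil; ring.
Qed.

Lemma nonagon_roots x : x \in nonagon_values -> x ^+ 3 = 3 * x + 1.
Proof.
have k := nonagon_minpoly; have [d1 d2 d4] := cosz_double9 R; have c9 := cosz9 R.
have c4 : cz 56 = 1 - cz 14 - 2 * cz 14 ^+ 2 by lra.
have cube (u : R) : 8 * u ^+ 3 - 6 * u + 1 = 0 -> (- 2 * u) ^+ 3 = 3 * (- 2 * u) + 1.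
  by move=> h; rewrite exprMn; lra.
have step (u : R) : 8 * u ^+ 3 - 6 * u + 1 = 0 ->
    8 * (2 * u ^+ 2 - 1) ^+ 3 - 6 * (2 * u ^+ 2 - 1) + 1 = 0.
  move=> h; transitivity ((8 * u ^+ 3 - 6 * u + 1) * (8 * u ^+ 3 - 6 * u - 1)); first by ring.
  by rewrite h mul0r.
have k2 : 8 * cz 28 ^+ 3 - 6 * cz 28 + 1 = 0 by rewrite d1; exact: step.
have k4 : 8 * cz 56 ^+ 3 - 6 * cz 56 + 1 = 0 by rewrite d2; exact: step.
by rewrite !inE => /or3P[] /eqP ->; exact: cube.
Qed.

(** The values at classes of order 9 are roots of x^3 - 3 x - 1, which the other values are not,
and no such root is fixed by x |-> 2 - x^2. *)
Lemma class_values_uniq : uniq [seq chi1r (ptn R p.2) | p <- class_points].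
Proof.
rewrite (_ : map _ _ = [:: 7; - 1; 1; 0; - 2 * cz 14; - 2 * cz 28; - 2 * cz 56]); last first.
  rewrite /=; have [-> _] := chi_values_trivial R; have [-> _] := chi_values2 R.
  have [-> _] := chi_values3 R; have [-> _] := chi_values7 R.
  have [|-> _] := @chi_values9 R 70 14; first by [].
  have [|-> _] := @chi_values9 R 56 28; first by [].
  by have [|-> _] := @chi_values9 R 28 56; first by [].
have [n1 n2 n4] := nonagon_step.
have rat x y : x \in nonagon_values -> y ^+ 3 <> 3 * y + 1 -> y == x = false.
  by move=> /nonagon_roots xE h; apply/eqP => yx; apply: h; rewrite yx.
have fix_free x : x \in nonagon_values -> x == 2 - x ^+ 2 = false.
  move=> /nonagon_roots xE; apply/eqP => h.
  have /eqP : (x - 1) * (x + 2) = 0 by rewrite [in X in (X - _) * _]h; nra.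
  by rewrite mulf_eq0 => /orP[]; rewrite ?subr_eq0 ?addr_eq0 => /eqP e; move: xE; rewrite e => ?; nra.
have [m1 m2 m4] : [/\ - 2 * cz 14 \in nonagon_values, - 2 * cz 28 \in nonagon_values
  & - 2 * cz 56 \in nonagon_values] by rewrite !inE !eqxx ?orbT.
have ab : - 2 * cz 14 == - 2 * cz 28 = false by rewrite -n1 fix_free.
have bc : - 2 * cz 28 == - 2 * cz 56 = false by rewrite -n2 fix_free.
have ac : - 2 * cz 14 == - 2 * cz 56 = false by rewrite -n4 eq_sym fix_free.
have {}rat (y : R) : y ^+ 3 <> 3 * y + 1 ->
    [/\ y == - 2 * cz 14 = false, y == - 2 * cz 28 = false & y == - 2 * cz 56 = false].
  by move=> h; split; exact: rat.
move: rat ab bc ac; move: (- 2 * cz 14) (- 2 * cz 28) (- 2 * cz 56) => x y z rat ab bc ac.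
have [|p1 p2 p3] := rat 7; first by lra.
have [|q1 q2 q3] := rat (- 1); first by lra.
have [|r1 r2 r3] := rat 1; first by lra.
have [|s1 s2 s3] := rat 0; first by lra.
rewrite /= !inE !negb_or ab bc ac p1 p2 p3 q1 q2 q3 r1 r2 r3 s1 s2 s3 /= !andbT.
by do ![apply/andP; split]; apply/eqP; lra.
Qed.

(** Both characters are real. *)
Lemma integralC_chi (mu : probability (torus R) R) m n :
  integralC mu (fun w => chi1 w ^+ m * chi2 w ^+ n) = (moment mu m n)%:C.
Proof.
have E w : chi1 w ^+ m * chi2 w ^+ n = (chi1r w ^+ m * chi2r w ^+ n)%:C.
  by rewrite chi1E chi2E rmorphM !rmorphXn.
rewrite /integralC; under eq_Rintegral do rewrite E /=.
under [X in _ +i* X]eq_Rintegral do rewrite E /=.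
by rewrite Rintegral_cst // mul0r.
Qed.

Lemma eps_joint_spectral (F : finFieldType) (iota : embedding R (PSL2 F)) :
  #|F| = 8%N -> is_joint_spectral_measure iota (eps R).
Proof.
move=> cardF; have mom (mu : probability (torus R) R) : has_joint_moments iota mu <->
    forall m n, moment mu m n = moment (eps R) m n.
  have clE m n : \sum_(C in classes (PSL2 F)) (#|C|%:R / #|PSL2 F|%:R)
     * \tr (varrho1 iota (repr C)) ^+ m * \tr (varrho2 iota (repr C)) ^+ n = (moment (eps R) m n)%:C.
    rewrite class_moments // eps_moment; congr (_ / _)%:C.
    have [a aE] := exists_cubic_root cardF.
    have rM A B dA dB := @r_ofM F R iota A B dA dB.
    have rI A dA := @r_of_inj F cardF R iota A dA.
    have [_ xE yE zE _] := character_values cardF rM rI aE.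
    by rewrite (character_moments cardF rM rI aE) (sum_nonagon _ xE yE zE).
  split=> h m n; last by rewrite integralC_chi mckay_moments clE h.
  by have [] := h m n; rewrite integralC_chi mckay_moments clE => /(congr1 (@complex.Re R)).
split; [exact: eps_D12_invariant | exact/mom | ].
move=> nu nuI /mom nuM; apply: (moments_determine (s := [seq ptn R p.2 | p <- class_points])) => //.
- exact: eps_D12_invariant.
- by rewrite -map_comp class_values_uniq.
move=> f bf f0; rewrite exp_eps // big_seq big1 ?mulr0 // => p pL.
rewrite /weyl_sum big_seq big1 ?mul0rn // => t tL.
by apply: f0; [exact: (map_f (fun p => ptn R p.2) pL) | exact: D12_mem].
Qed.
End Moments.

(** * Uniform measures on lists of points *)

Section UniformLists.
Context d (T : measurableType d) (R : realType).
Implicit Types (s : seq T) (D : set T).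

Lemma uniform_seqE s D : uniq s -> uniform R [set` s] D = empirical R s D.
Proof.
move=> us; rewrite uniform_empirical !empiricalE.
have p : perm_eq (finmap.enum_fset (fset_set [set` s])) s.
  apply: uniq_perm => // x.
  rewrite -[LHS]/(x \in fset_set [set` s]) in_fset_set; last exact: finite_seq.
  by rewrite mem_setE.
by rewrite (perm_big _ p) (perm_size p).
Qed.

Lemma eq_uniform_seq (A : set T) s D : uniq s -> A = [set` s] -> uniform R A D = empirical R s D.
Proof. by move=> us ->; exact: uniform_seqE. Qed.

End UniformLists.

(** Product measures are determined by their values on rectangles. *)
Lemma product_empirical d1 d2 (T1 : measurableType d1) (T2 : measurableType d2) (R : realType)
    (m1 : {finite_measure set T1 -> \bar R}) (m2 : {finite_measure set T2 -> \bar R})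
    (s1 : seq T1) (s2 : seq T2) :
  (forall D, measurable D -> m1 D = empirical R s1 D) ->
  (forall D, measurable D -> m2 D = empirical R s2 D) ->
  forall D, measurable D -> (m1 \x m2)%E D = empirical R [seq (x, y) | x <- s1, y <- s2] D.
Proof.
move=> h1 h2; apply: product_measure_unique => A B mA mB.
transitivity (empirical R s1 A * empirical R s2 B)%E; last first.
  by congr (_ * _)%E; apply/esym; [exact: h1 | exact: h2].
rewrite !empiricalE -EFinM.
apply: (etrans (empiricalE R [seq (x, y) | x <- s1, y <- s2] (A `*` B))); transitivity (((size s1 * size s2)%:R^-1
    * \sum_(x <- s1) \sum_(y <- s2) \1_(A `*` B) (x, y))%:E : \bar R).
  by rewrite size_allpairs big_allpairs_dep.
rewrite natrM invfM mulrACA; congr (_ * _)%:E; rewrite mulr_suml; apply: eq_bigr => x _.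
rewrite mulr_sumr; apply: eq_bigr => y _; rewrite !indicE -natrM mulnb.
by congr (_%:R); rewrite in_setX.
Qed.

(** * Weighted lists of points *)

Section WeightedLists.
Variables (R : realType) (g : nat * nat -> R).
Implicit Types (L : seq (int * (nat * nat))) (q : nat * nat).

Definition wsum L : R := \sum_(p <- L) p.1%:~R * g p.2.

Definition coef L q : int := foldr (fun p c => if p.2 == q then p.1 + c else c) 0 L.

Lemma wsum_coef L U : uniq U -> {subset [seq p.2 | p <- L] <= U} ->
  wsum L = \sum_(q <- U) (coef L q)%:~R * g q.
Proof.
move=> uU; elim: L => [|[c q0] L IHL] sU.
  by rewrite /wsum big_nil big1 // => q _; rewrite mul0r.
have q0U : q0 \in U by apply: sU; rewrite inE eqxx.
have {}IHL : wsum L = \sum_(q <- U) (coef L q)%:~R * g q.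
  by apply: IHL => q qL; apply: sU; rewrite inE qL orbT.
rewrite /wsum big_cons -/(wsum L) IHL /= (bigD1_seq q0) //= [in RHS](bigD1_seq q0) //= eqxx.
rewrite rmorphD mulrDl -addrA; congr (_ + (_ + _)).
by apply: eq_bigr => q qq0; rewrite eq_sym (negbTE qq0).
Qed.

Lemma eq_wsum L1 L2 : all (fun q => coef L1 q == coef L2 q) [seq p.2 | p <- L1 ++ L2] ->
  wsum L1 = wsum L2.
Proof.
move=> /allP h; set U := undup [seq p.2 | p <- L1 ++ L2].
have sU : {subset [seq p.2 | p <- L1 ++ L2] <= U} by move=> q; rewrite mem_undup.
rewrite !(@wsum_coef _ U) ?undup_uniq //; try by
  move=> q qL; apply: sU; rewrite map_cat mem_cat qL ?orbT.
rewrite big_seq [RHS]big_seq; apply: eq_bigr => q; rewrite mem_undup => /h /eqP ->.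
by [].
Qed.

Lemma wsum_cat L1 L2 : wsum (L1 ++ L2) = wsum L1 + wsum L2.
Proof. exact: big_cat. Qed.

End WeightedLists.

Section AtomicMeasures.
Variable R : realType.
Implicit Types (s : seq (nat * nat)) (A : set (torus R)).

Definition bounded126 s := all (fun q => (q.1 < 126) && (q.2 < 126))%N s.

Lemma map_ptn_uniq s : bounded126 s -> uniq s -> uniq [seq ptn R q | q <- s].
Proof.
move=> /allP b us; rewrite map_inj_in_uniq // => p q /b /andP[p1 p2] /b /andP[q1 q2].
exact: ptn_inj.
Qed.

Definition roots_list k := [seq (126 %/ k * j)%N | j <- iota 0 k].
Definition grid k := [seq (i, j) | i <- roots_list k, j <- roots_list k].

(** The angle of a k-th root of unity is an integer multiple of 1/k. *)
Lemma unif_rootsE k (D : set (circle R)) : (0 < k)%N -> (k %| 126)%N ->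
  unif_roots R k D = empirical R [seq zeta R i | i <- map Posz (roots_list k)] D.
Proof.
move=> k0 /dvdnP[m mE]; have m0 : (0 < m)%N by case: m mE.
have mE' : (126 %/ k = m)%N by rewrite mE mulnK.
have k0R : k%:R != 0 :> R by rewrite pnatr_eq0 -lt0n.
have m0R : m%:R != 0 :> R by rewrite pnatr_eq0 -lt0n.
have jk (j : nat) : (m * j)%:R / 126 = j%:R / k%:R :> R.
  rewrite -[126]/(126%:R) mE !natrM; by field; rewrite k0R m0R.
have zE (j : nat) : zeta R (126 %/ k * j)%N = e2pi (j%:R / k%:R).
  by rewrite /zeta -pmulrn mE' jk.
rewrite -2!map_comp; apply: eq_uniform_seq.
  rewrite map_inj_in_uniq ?iota_uniq // => i j; rewrite !mem_iota !add0n /= mE' => ik jk' e.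
  have /eqP : (m * i)%N = (m * j)%N by apply: (zeta_inj _ _ e); rewrite mE ltn_pmul2l.
  by rewrite eqn_pmul2l // => /eqP.
apply/seteqP; split=> w /=; last first.
  case/mapP=> j _ ->; rewrite -[X in cval X]/(zeta R (126 %/ k * j)%N) zE.
  by rewrite -e2piMn mulrC divfK // pmulrn e2pi_int.
have [t /andP[t0 t1] <-] := e2pi_onto w; rewrite -e2piMn => /e2pi_eq1_int.
rewrite intrEge0 ?mulr_ge0 // => /natrP[j jE].
apply/mapP; exists j; last by rewrite -[RHS]/(zeta R (126 %/ k * j)%N) zE -jE [k%:R * t]mulrC mulfK.
rewrite mem_iota /= add0n -(ltr_nat R) -jE -[ltRHS]mulr1 ltr_pM2l // ltr0n.
by [].
Qed.
End AtomicMeasures.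

(** * The measures of the formula as lists of points *)

Section UniformOnTorus.
Variable R : realType.
Implicit Types (s : seq (nat * nat)) (A : set (torus R)) (p : int * int).

(** Every measure of the formula is the uniform one on an explicit list of points, numbered by
126th parts of the circle. *)
Definition supported_on (mu : set (torus R) -> \bar R) s :=
  forall D, measurable D -> mu D = empirical R [seq ptn R q | q <- s] D.

Lemma supported_measure mu s A : supported_on mu s -> measurable A ->
  mu A = ((size s)%:R^-1 * \sum_(q <- s) \1_A (ptn R q))%:E.
Proof. by move=> h mA; rewrite h // empiricalE size_map big_map. Qed.

Lemma supported_integral (mu : {measure set (torus R) -> \bar R}) s A (f : torus R -> R) (c : R)
    (b : nat * nat -> nat) :
  supported_on mu s -> measurable A -> measurable_fun setT f -> (forall w, 0 <= f w) ->
  {in s, forall q, f (ptn R q) = c * (b q)%:R} ->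
  (\int[mu]_(w in A) (f w)%:E)%E
    = (c / (size s)%:R * \sum_(q <- s) (b q)%:R * \1_A (ptn R q))%:E.
Proof.
move=> h mA mf f0 fE.
rewrite (eq_measure_integral (empirical R [seq ptn R q | q <- s])); last by move=> D mD _; exact: h.
rewrite ge0_integral_empirical // size_map big_map [c / _]mulrC -mulrA; congr (_ * _)%:E.
rewrite mulr_sumr big_seq [RHS]big_seq; apply: eq_bigr => q qs.
by rewrite fE // mulrCA [_ * (b q)%:R]mulrC.
Qed.

Lemma unif_roots_sq_supported k : (0 < k)%N -> (k %| 126)%N ->
  supported_on (unif_roots_sq R k) (grid k).
Proof.
move=> k0 kd D mD; have h (B : set (circle R)) (_ : measurable B) := unif_rootsE B k0 kd.
apply: (etrans (product_empirical h h mD)).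
congr (empirical _ _ D); rewrite /grid map_allpairs -!map_comp.
by congr flatten; apply: eq_map => i /=; rewrite /roots_list -!map_comp.
Qed.

Lemma pt_seq_set (A : set (torus R)) s : bounded126 s -> uniq s ->
  (forall w, A w <-> exists2 q, q \in s & w = ptn R q) -> supported_on (uniform R A) s.
Proof.
move=> bs us As D mD; apply: eq_uniform_seq; first exact: map_ptn_uniq.
apply/seteqP; split=> w.
  by move=> /As[q qs ->]; apply/mapP; exists q.
by move/mapP => [q qs ->]; apply/As; exists q.
Qed.

(** The three points of the torus fixed by the rotations of order 3. *)
Definition wall_points : seq (nat * nat) := [:: (0, 0); (42, 84); (84, 42)]%N.

Lemma unif_p_supported : supported_on (unif_p R 1) wall_points.
Proof.
have E (j : nat) : e2pi (j%:R / (3 * 1)%:R : R) = zeta R (42 * j)%N.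
  by rewrite /zeta muln1 -pmulrn natrM; congr e2pi; field.
apply: pt_seq_set => // w; split.
  case=> -[i j] /= [i3 j3 ij] <-; rewrite !E.
  exists (42 * i, 42 * j)%N => //.
  by case: i j i3 j3 ij => [|[|[|]]] // [|[|[|]]].
case=> q qs ->; move: qs; rewrite !inE => /or3P[] /eqP ->.
- by exists (0, 0)%N => //=; rewrite !E.
- by exists (1, 2)%N => //=; rewrite !E.
by exists (2, 1)%N => //=; rewrite !E.
Qed.

(** The base points for tau = k/126; a third of the circle is 42/126. *)
Definition pp_base (k : int) : seq (int * int) := [:: (k, k); (- 42 - k, 42%:Z); (42%:Z, - 42 - k)].
Definition pp_orbit (k : int) : seq (nat * nat) := [seq redp (mat_act t p) | t <- weyl6, p <- pp_base k].

Lemma unif_pp_supported (n : rat) (k : int) : (ratr n)^-1 = k%:~R / 126 :> R ->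
  bounded126 (pp_orbit k) -> uniq (pp_orbit k) -> supported_on (unif_pp R n) (pp_orbit k).
Proof.
move=> nk bo uo.
have om : 3^-1 = 42%:~R / 126 :> R by field.
have om' : - 3^-1 - k%:~R / 126 = (- 42 - k)%:~R / 126 :> R by rewrite intrD !intrN; field.
have baseE (w : torus R) : unif_pp_base n w <-> exists2 p, p \in pp_base k & w = pt R p.
  rewrite /unif_pp_base nk om' om -![e2pi _]/(zeta R _); split.
    case=> [[->|->]|->]; [exists (k, k) | exists (- 42 - k, 42%:Z) | exists (42%:Z, - 42 - k)] => //;
      by rewrite !inE eqxx ?orbT.
  case=> p; rewrite !inE => /or3P[] /eqP -> ->; [left; left | left; right | right]; by [].
apply: pt_seq_set => // w; split.
  case=> T /S3P[t tL ->] [v /baseE[p pL ->]] <-; exists (redp (mat_act t p)).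
    exact: allpairs_f.
  by rewrite torus_act_pt pt_red.
case=> q /allpairsP[[t p] /= [tL pL ->]] ->; rewrite -pt_red -torus_act_pt.
by exists (mx_of t); [apply/S3P; exists t | exists (pt R p) => //; apply/baseE; exists p].
Qed.

Definition int_pair (q : nat * nat) : int * int := (q.1%:Z, q.2%:Z).

(** At the other points the positive and the negative cosines of J cancel in pairs. *)
Definition regular q := ~~ perm_eq (J_plus (int_pair q)) (J_minus (int_pair q)).

Definition J_terms (s1 s2 : seq nat) q :=
  let: (P, M) := (J_plus (int_pair q), J_minus (int_pair q)) in
  perm_eq P M || (perm_eq P s1 && perm_eq M s2) || (perm_eq P s2 && perm_eq M s1).

(** On the lists of interest the positive and the negative cosines of J either cancel in pairs
or are given by s1 and s2, in one order or the other. *)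
Lemma J_sq (s1 s2 : seq nat) s : ~~ perm_eq s1 s2 -> all (J_terms s1 s2) s ->
  {in s, forall q, J (ptn R q) ^+ 2 = 64 * pi ^+ 4 * (cosz_sum R s1 - cosz_sum R s2) ^+ 2 * (regular q)%:R}.
Proof.
have cp (s' t' : seq nat) : perm_eq s' t' -> cosz_sum R s' = cosz_sum R t' by exact: perm_big.
move=> n12 /allP h q /h; rewrite /J_terms /regular /ptn -/(int_pair q) J_pt.
move: (J_plus _) (J_minus _) => P M /orP[/orP[PM|/andP[P1 M2]]|/andP[P2 M1]].
- by rewrite PM (cp _ _ PM) subrr /= !mulr0 expr0n.
- rewrite (_ : perm_eq P M = false) ?(cp _ _ P1) ?(cp _ _ M2) /=; first by ring.
  by apply/negbTE; apply: contra n12 => PM; rewrite -(permPl P1) -(permPr M2).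
rewrite (_ : perm_eq P M = false) ?(cp _ _ P2) ?(cp _ _ M1) /=; first by ring.
by apply/negbTE; apply: contra n12 => PM; rewrite -(permPl M1) -(permPr P2) perm_sym.
Qed.
End UniformOnTorus.

(** * Comparison of the multiplicities *)

Section Formula.
Variable R : realType.
Implicit Types (g : nat * nat -> R) (A : set (torus R)).
Local Notation cz k := (@cosz R k).

Definition scaled (c : int) (b : nat * nat -> nat) (s : seq (nat * nat)) :=
  [seq (c * (b q)%:Z, q) | q <- s].

Lemma wsum_scaled g c b s : wsum g (scaled c b s) = c%:~R * \sum_(q <- s) (b q)%:R * g q.
Proof.
rewrite /wsum /scaled big_map mulr_sumr; apply: eq_bigr => q _.
by rewrite /= intrM -mulrA.
Qed.

Lemma wsum_scaled1 g c s : wsum g (scaled c (fun=> 1%N) s) = c%:~R * \sum_(q <- s) g q.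
Proof. by rewrite wsum_scaled; congr (_ * _); apply: eq_bigr => q _; rewrite mul1r. Qed.

Definition eps_weights : seq (int * (nat * nat)) :=
  [seq (p.1%:Z, redp (mat_act t (int_pair p.2))) | p <- class_points, t <- weyl12].

(** The multiplicity of each point in the terms of the formula, out of 6048 = 504 * 12. On a list
of n points where J^2 is v or 0, a term with coefficient c contributes c v / n at the
regular points. *)
Definition formula_weights : seq (int * (nat * nat)) :=
  scaled 216 regular (grid 7) ++ scaled 112 (fun=> 1%N) (grid 3) ++
  scaled 252 (fun=> 1%N) (grid 2) ++ scaled (- 240) (fun=> 1%N) (grid 1) ++
  scaled (- 112) (fun=> 1%N) wall_points ++ scaled 56 regular (pp_orbit 14) ++
  scaled 56 regular (pp_orbit 28) ++ scaled 56 regular (pp_orbit 56).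

Lemma weights_agree g : wsum g eps_weights = wsum g formula_weights.
Proof. by apply: eq_wsum; vm_compute. Qed.

Lemma eps_wsum A : eps R A = ((504 * 12)^-1 * wsum (fun q => \1_A (ptn R q)) eps_weights)%:E.
Proof.
rewrite epsE; congr (_ * _)%:E; rewrite /wsum /eps_weights big_allpairs_dep.
apply: eq_bigr => p _; rewrite /weyl_sum -mulr_natl mulr_sumr; apply: eq_bigr => t _.
by rewrite /= -pt_red -torus_act_pt.
Qed.

Lemma J7 : {in grid 7, forall q, J (ptn R q) ^+ 2 = 64 * pi ^+ 4 * (49 / 4) * (regular q)%:R}.
Proof.
have terms : all (J_terms [:: 0; 0; 0]%N [:: 18; 36; 54]%N) (grid 7) by vm_compute.
move=> q qs; rewrite (J_sq R (isT : ~~ perm_eq [:: 0; 0; 0]%N [:: 18; 36; 54]%N) terms qs).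
congr (_ * _ * _); rewrite /cosz_sum !big_cons !big_nil cosz0.
by have := cosz7 R; nra.
Qed.

Lemma nonagon_neq (k : nat) : (k \in [:: 14; 28; 56])%N -> 3 / 2 + 3 * cz k != 0.
Proof.
move=> kL; apply/eqP => h; have c : - 2 * cz k = 1 by lra.
have : - 2 * cz k \in nonagon_values R.
  by move: kL; rewrite !inE => /or3P[] /eqP ->; rewrite eqxx ?orbT.
by move/nonagon_roots; rewrite c expr1n; lra.
Qed.

(** With c1, c2, c4 the cosines of 40, 80 and 160 degrees, J / (8 pi^2) is 3/2 + 3 c up to sign,
where c is the one of the three that precedes in the cycle of angle doubling. *)
Lemma J9 (k : nat) : (k \in [:: 14; 28; 56])%N -> {in pp_orbit k, forall q,
  J (ptn R q) ^+ 2 = 64 * pi ^+ 4 * (3 / 2 + 3 * cosz R (nrm (4 * k))) ^+ 2 * (regular q)%:R}.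
Proof.
have [d1 d2 d4] := cosz_double9 R; have c9 := cosz9 R; have c42 := cosz42 R.
rewrite !inE => /or3P[] /eqP -> q qs.
- have terms : all (J_terms [:: 0; 56; 56]%N [:: 14; 28; 42]%N) (pp_orbit 14) by vm_compute.
  rewrite (J_sq R (isT : ~~ perm_eq [:: 0; 56; 56]%N [:: 14; 28; 42]%N) terms qs).
  congr (_ * _ ^+ 2 * _); rewrite /cosz_sum !big_cons !big_nil cosz0.
  by rewrite -[nrm _]/56%N; lra.
- have terms : all (J_terms [:: 0; 14; 14]%N [:: 28; 42; 56]%N) (pp_orbit 28) by vm_compute.
  rewrite (J_sq R (isT : ~~ perm_eq [:: 0; 14; 14]%N [:: 28; 42; 56]%N) terms qs).
  congr (_ * _ ^+ 2 * _); rewrite /cosz_sum !big_cons !big_nil cosz0.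
  by rewrite -[nrm _]/14%N; lra.
have terms : all (J_terms [:: 0; 28; 28]%N [:: 14; 42; 56]%N) (pp_orbit 56) by vm_compute.
rewrite (J_sq R (isT : ~~ perm_eq [:: 0; 28; 28]%N [:: 14; 42; 56]%N) terms qs).
congr (_ * _ ^+ 2 * _); rewrite /cosz_sum !big_cons !big_nil cosz0.
by rewrite -[nrm _]/28%N; lra.
Qed.

Lemma cos_ninths : [/\ cos (pi / 9) = - cz 56, cos (2 * pi / 9) = cz 14 & sin (pi / 18) = cz 28].
Proof.
split; rewrite /cosz Re_e2pi.
- have -> : 2 * pi * (56%:~R / 126) = - (pi / 9) + pi :> R by field.
  by rewrite cosDpi opprK cosN.
- by congr cos; field.
by rewrite -cosBpihalf -cosN; congr cos; field.
Qed.
End Formula.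

(** * The formula *)

Section Terms.
Variables (R : realType) (A : set (torus R)).
Hypothesis mA : measurable A.
Local Notation g := (fun q => \1_A (ptn R q) : R).

Lemma term_roots (c : R) (k : nat) (n : int) : (0 < k)%N -> (k %| 126)%N ->
  c / (k * k)%:R = n%:~R / (504 * 12) ->
  (c%:E * unif_roots_sq R k A)%E = ((504 * 12)^-1 * wsum g (scaled n (fun=> 1%N) (grid k)))%:E.
Proof.
move=> k0 kd cn; rewrite (supported_measure (unif_roots_sq_supported (R := R) k0 kd) mA) wsum_scaled1 -EFinM.
rewrite size_allpairs size_map size_iota mulrA cn; congr (_%:E); rewrite mulrA; congr (_ * _).
exact: mulrC.
Qed.

Lemma term_wall (c : R) (n : int) : c / 3 = n%:~R / (504 * 12) ->
  (c%:E * unif_p R 1 A)%E = ((504 * 12)^-1 * wsum g (scaled n (fun=> 1%N) wall_points))%:E.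
Proof.
move=> cn; rewrite (supported_measure (@unif_p_supported R) mA) wsum_scaled1 -EFinM.
by rewrite mulrA cn mulrA [_^-1 * _]mulrC.
Qed.

Lemma J_sq_ge0 (w : torus R) : 0 <= J w ^+ 2. Proof. exact: sqr_ge0. Qed.

Lemma measurable_J_sq : measurable_fun setT (fun w : torus R => J w ^+ 2).
Proof. by apply: measurable_funX; exact: measurable_J. Qed.

Lemma term_J (mu : {measure set (torus R) -> \bar R}) s (c v : R) (n : int) :
  supported_on mu s -> {in s, forall q, J (ptn R q) ^+ 2 = v * (regular q)%:R} ->
  c * (v / (size s)%:R) = n%:~R / (504 * 12) ->
  (c%:E * \int[mu]_(w in A) (J w ^+ 2)%:E)%E = ((504 * 12)^-1 * wsum g (scaled n regular s))%:E.
Proof.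
move=> hs hJ cn; rewrite (supported_integral hs mA measurable_J_sq J_sq_ge0 hJ) -EFinM wsum_scaled.
by rewrite mulrA cn mulrA [_^-1 * _]mulrC.
Qed.

Lemma pi_neq0 : pi != 0 :> R. Proof. by rewrite gt_eqF // pi_gt0. Qed.

Lemma term_pp (n : rat) (k : nat) (a : R) : (k \in [:: 14; 28; 56])%N ->
  (ratr n)^-1 = k%:R / 126 :> R ->
  a = 4 / 9 * (3 / 2 + 3 * cosz R (nrm (4 * k))) ^+ 2 ->
  ((1 / (864 * pi ^+ 4) * a^-1)%:E * \int[unif_pp R n]_(w in A) (J w ^+ 2)%:E)%E
    = ((504 * 12)^-1 * wsum g (scaled 56 regular (pp_orbit k)))%:E.
Proof.
move=> kL nk aE.
have sup : supported_on (unif_pp R n) (pp_orbit k).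
  apply: unif_pp_supported; first by rewrite -pmulrn.
    by move: k kL {nk aE}; apply/allP; vm_compute.
  by move: k kL {nk aE}; apply/allP; vm_compute.
have v0 : 3 / 2 + 3 * cosz R (nrm (4 * k)) != 0.
  by apply: nonagon_neq; move: k kL {nk aE sup}; apply/allP; vm_compute.
apply: (term_J sup (J9 R kL)).
have -> : size (pp_orbit k) = 18%N by rewrite size_allpairs.
rewrite aE; move: (3 / 2 + _) v0 => v v0; move: pi pi_neq0 => p p0; field; by rewrite v0 p0.
Qed.
End Terms.

Theorem theorem4p5 (R : realType) (F : finFieldType) (cardF : #|F| = 8%N)
    (iota : embedding R (PSL2 F)) :
  let a1 : R := 3 + 2 * cos (pi / 9) + 2 * cos (2 * pi / 9) in
  let a2 : R := 3 - 2 * cos (2 * pi / 9) + 2 * sin (pi / 18) in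
  let a3 : R := 3 - 2 * cos (pi / 9) - 2 * sin (pi / 18) in
  exists eps : probability (torus R) R,
    is_joint_spectral_measure iota eps /\
    forall A : set (torus R), measurable A ->
      (eps A =
         (1 / (448 * pi ^+ 4))%:E * \int[unif_roots_sq R 7]_(w in A) (J w ^+ 2)%:E
         + (1 / 6)%:E * unif_roots_sq R 3 A
         + (1 / 6)%:E * unif_roots_sq R 2 A
         - (5 / 126)%:E * unif_roots_sq R 1 A
         - (1 / 18)%:E * unif_p R 1 A
         + (1 / (864 * pi ^+ 4) * a3^-1)%:E
             * \int[unif_pp R 9]_(w in A) (J w ^+ 2)%:E
         + (1 / (864 * pi ^+ 4) * a1^-1)%:E
             * \int[unif_pp R (9 / 2)]_(w in A) (J w ^+ 2)%:E
         + (1 / (864 * pi ^+ 4) * a2^-1)%:E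
             * \int[unif_pp R (9 / 4)]_(w in A) (J w ^+ 2)%:E)%E.
Proof.
move=> a1 a2 a3; exists (eps R); split; first exact: eps_joint_spectral.
move=> A mA; pose g q : R := \1_A (ptn R q).
have [cp9 c2p9 sp18] := cos_ninths R.
have [d1 d2 d4] := cosz_double9 R; have c9 := cosz9 R.
have pi0 := pi_neq0 R.
have a3E : a3 = 4 / 9 * (3 / 2 + 3 * cosz R (nrm (4 * 14))) ^+ 2.
  by rewrite /a3 cp9 sp18 -[nrm _]/56%N; nra.
have a1E : a1 = 4 / 9 * (3 / 2 + 3 * cosz R (nrm (4 * 28))) ^+ 2.
  by rewrite /a1 cp9 c2p9 -[nrm _]/14%N; nra.
have a2E : a2 = 4 / 9 * (3 / 2 + 3 * cosz R (nrm (4 * 56))) ^+ 2.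
  by rewrite /a2 c2p9 sp18 -[nrm _]/28%N; nra.
rewrite -!mulNe -!EFinN.
rewrite (term_J mA (n := 216) (unif_roots_sq_supported (R := R) (isT : 0 < 7)%N (isT : 7 %| 126)%N) (J7 R)); last first.
  by have -> : size (grid 7) = 49%N by []; move: pi pi0 => p p0; field.
rewrite (@term_roots _ A mA _ 3 112) //; last by field.
rewrite (@term_roots _ A mA _ 2 252) //; last by field.
rewrite (@term_roots _ A mA _ 1 (- 240)) //; last by rewrite !intrN; field.
rewrite (@term_wall _ A mA _ (- 112)) //; last by rewrite !intrN; field.
rewrite (@term_pp _ A mA _ 14 a3) //; last by rewrite ratr_nat; field.
rewrite (@term_pp _ A mA _ 28 a1) //; last by rewrite fmorph_div /= !ratr_nat; field.
rewrite (@term_pp _ A mA _ 56 a2) //; last by rewrite fmorph_div /= !ratr_nat; field.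
rewrite -!EFinD -!mulrDr eps_wsum weights_agree; congr (_ * _)%:E.
by rewrite /formula_weights !wsum_cat !addrA.
Qed.
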